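(* Consider the OPE associated with ${\rm d}\mu_0(x)=\frac{\sqrt{4-x^2}}{2\pi}\chi_{[-2,2]}(x)\,{\rm d}x$ (recurrence coefficients $a_n\equiv1$, $b_n\equiv0$). Fix $x_0\in(-2,2)$ and $0<\alpha<1$. Let $N\in\mathbb{N}$, $\eta_1,\dots,\eta_N\in\mathbb{C}$ with $\operatorname{Im}\eta_j>0$, $c_1,\dots,c_N\in\mathbb{R}$, and $f(x)=\sum_{j=1}^Nc_j\operatorname{Im}\frac{1}{x-\eta_j}$. Then $$X^{(n)}_{f,\alpha,x_0}-\mathbb{E}X^{(n)}_{f,\alpha,x_0}\to N(0,\sigma_f^2)$$ in distribution, where $\sigma_f^2=\frac{1}{4\pi^2}\iint_{\mathbb{R}^2}\left(\frac{f(x)-f(y)}{x-y}\right)^2{\rm d}x\,{\rm d}y$.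
   Context: The OPE of size $n$ for a measure $\mu$ is the probability measure on $\mathbb{R}^n$ proportional to $\prod_{i<j}(x_i-x_j)^2\,{\rm d}\mu(x_1)\cdots{\rm d}\mu(x_n)$; $X^{(n)}_{f,\alpha,x_0}=\sum_{j=1}^nf(n^\alpha(x_j-x_0))$ and $\mathbb{E}$ is expectation under the OPE. *)

(* Defs.v *)
From mathcomp Require Import all_boot all_order all_algebra.
From mathcomp Require Import all_classical all_reals all_analysis.
Set Implicit Arguments. Unset Strict Implicit. Unset Printing Implicit Defensive.
Import Order.TTheory GRing.Theory Num.Theory.
Import numFieldTopology.Exports numFieldNormedType.Exports.
From mathcomp.real_closed Require Import complex.
Local Open Scope classical_set_scope.
Local Open Scope ring_scope.

Section OPE.
Variable R : realType.

Definition mu0_density (x : R) : R :=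
  if (-2 <= x <= 2) then Num.sqrt (4 - x ^+ 2) / (pi *+ 2) else 0.

Definition mu0_int (h : R -> R) : R :=
  Rintegral (@lebesgue_measure R) setT (fun x => h x * mu0_density x).

(* integral of F against the product measure mu_0^{(x) n} on R^n, points of
   R^n being represented by sequences of length n (iterated integral) *)
Fixpoint ope_int (n : nat) (F : seq R -> R) : R :=
  match n with
  | 0 => F [::]
  | k.+1 => mu0_int (fun x => ope_int k (fun s => F (x :: s)))
  end.

Definition vdm2 (n : nat) (s : seq R) : R :=
  \prod_(i < n) \prod_(j < n | (i < j)%N) (nth 0 s i - nth 0 s j) ^+ 2.

Definition ope_E (n : nat) (G : seq R -> R) : R :=
  ope_int n (fun s => G s * vdm2 n s) / ope_int n (vdm2 n).

Definition lin_stat (f : R -> R) (alpha x0 : R) (n : nat) (s : seq R) : R :=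
  \sum_(x <- s) f ((n%:R) `^ alpha * (x - x0)).

Definition sigma2 (f : R -> R) : R :=
  fine (\int[@lebesgue_measure R]_x \int[@lebesgue_measure R]_y
          ((((f x - f y) / (x - y)) ^+ 2)%:E))%E / (pi ^+ 2 *+ 4).

(* E[g(Z)] for Z ~ N(0, v); N(0,0) is the Dirac mass at 0 *)
Definition normal_expect (v : R) (g : R -> R) : R :=
  if v == 0 then g 0
  else Rintegral (@lebesgue_measure R) setT
         (fun x => g x * normal_pdf 0 (Num.sqrt v) x).

Definition ope_cvg_in_distribution_normal (Y : forall n : nat, seq R -> R)
    (v : R) : Prop :=
  forall g : R -> R, continuous g -> (exists M : R, forall x, `|g x| <= M) ->
    (fun n : nat => ope_E n (fun s => g (Y n s))) @ \oo --> normal_expect v g.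

End OPE.

(* Main.v *)
Require Import Defs.
From mathcomp Require Import all_boot all_order all_algebra all_fingroup.
From mathcomp Require Import all_classical all_reals all_analysis measurable_realfun.
From mathcomp Require Import zify ring lra.
Import Order.TTheory GRing.Theory Num.Theory.
Import numFieldTopology.Exports numFieldNormedType.Exports.
From mathcomp.real_closed Require Import complex.
Set Implicit Arguments. Unset Strict Implicit. Unset Printing Implicit Defensive.
Local Open Scope classical_set_scope.
Local Open Scope ring_scope.

(** The density of the ensemble is, up to a constant, [D ^+ 2] times the semicircle
    weights, where [D] is the determinant with rows U_0, ..., U_(n-1) (Chebyshev
    polynomials, x = 2 cos t). Multiplying [D] by the power sum T_k(x_1) + ... +
    T_k(x_n) only shifts row indices, and determinants with different rows are
    orthogonal; this yields an exact Wick rule for products of power sums of total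
    degree at most n, in which the T_k behave as independent Gaussians.

    With z = x0 + eta / n^alpha = u + 1/u and |u| < 1, the function
    Im 1 / (n^alpha (x - x0) - eta) has Chebyshev coefficients proportional to
    n^-alpha Im (u / (1 - u^2) * u^k), and 1 - |u| is of order n^-alpha. As
    alpha < 1, truncating the expansion at k <= n / r costs an error smaller than
    any power of n, for every fixed r. So arbitrarily many moments of the
    statistic are eventually those of a Gaussian whose variance is
    the sum of k g_k^2. That sum converges to
    - 1/2 sum_(j,l) c_j c_l Re (eta_j - conj eta_l)^-2, which is also the value of
    [sigma2 f], computed from the integrals of products of two resolvents.
    Convergence of the moments gives convergence of the means of cos (t X) and
    sin (t X), and trigonometric polynomials approximate a bounded continuous
    function up to e (1 + x^2). *)

(** The Wick rule is established as an exact identity for degrees adding up to at most n. A moment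
    of order r of a statistic of degree K therefore asks for r K <= n, which dictates the cut at n /
    r: for each n only finitely many moments are known to be Gaussian. Hence cosine and sine are
    replaced by Taylor polynomials, with a remainder that is itself an even power and so has a known
    mean.

    Moments are computed for the truncated statistic only. The truncation error, even multiplied by
    the number n of points, is uniformly small on [-2,2], so it passes through the Lipschitz
    functions cos and sin.

    The power sums are not centred: the rows whose index is pushed below zero come back with a sign,
    and this gives mean -1 to those of even degree.

    Expectations are iterated integrals over lists, so every use of linearity has to be justified.
    Functions that are bounded and uniformly continuous on the cube [-2,2]^n form a class in which
    this is automatic. Tightness comes from second moments alone, which is why test functions are
    approximated with the weight 1 + x^2. *)

(** * Shifting the rows of an alternant: the Wick rule *)

Definition upd (n : nat) (l : 'I_n -> int) (i : 'I_n) (v : int) : 'I_n -> int :=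
  fun j => if j == i then v else l j.

(** Invariant for the induction on the list of power sums: starting from [rho], which is filled up
    to n, a shift by m that does not create a repeated row leaves at least the first p - m rows
    untouched and all others above p - m. *)
Definition filled (n p : nat) (l : 'I_n -> int) : Prop :=
  forall i : 'I_n, if (i < p)%N then l i = i.+1 :> int else (p%:Z < l i)%R.

Definition rho n : 'I_n -> int := fun i => i.+1.

(* [val F l] stands for the integral of [powprod F * altU l * altU rho]: the
   determinant [altU l], with rows indexed by [l], is alternating in [l] and odd
   in each [l i], and a power sum acts on it by shifting one entry (lemma
   [powsum_altU]); by orthogonality [val [::] l] vanishes when some [l i > n]. *)
Section WickRule.
Variables (R : realFieldType) (n : nat) (val : seq nat -> ('I_n -> int) -> R).
Hypothesis val_ext : forall F l l', l =1 l' -> val F l = val F l'.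
Hypothesis val_cons : forall m F l, val (m :: F) l =
  \sum_j val F (upd l j (l j + m%:Z)) + \sum_j val F (upd l j (l j - m%:Z)).
Hypothesis val_perm : forall F F' l, perm_eq F F' -> val F l = val F' l.
Hypothesis val_rep : forall F l i j, i != j -> l i = l j -> val F l = 0.
Hypothesis val_neg : forall F l i v, val F (upd l i (- v)) = - val F (upd l i v).
Hypothesis val_swap : forall F l i j a b, i != j ->
  val F (upd (upd l i a) j b) = - val F (upd (upd l i b) j a).
Hypothesis val_nil : forall l i, (n%:Z < l i)%R -> val [::] l = 0.

Let up F k l := \sum_i val F (upd l i (l i + k%:Z)).

Let upd_id (l : 'I_n -> int) i v : l i = v -> upd l i v =1 l.
Proof. by move=> e j; rewrite /upd; case: eqP => // ->. Qed.

Let val0 F l i : l i = 0 -> val F l = 0.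
Proof.
move=> l0; have := val_neg F l i 0; rewrite oppr0.
rewrite (@val_ext _ _ l); last exact: upd_id.
by move=> h; lra.
Qed.

(** Shifting one or the other of two equal rows gives families that differ by a transposition, so
    these two terms cancel; every other shift keeps the repetition. *)
Let up_rep F k l i j : i != j -> l i = l j -> up F k l = 0.
Proof.
move=> ij e; rewrite /up (bigD1 i)//= (bigD1 j) ?(eq_sym j)//=.
rewrite [X in _ + (_ + X)]big1 ?addr0; last first.
  move=> x /andP[xi xj]; apply: (@val_rep _ _ i j) => //.
  by rewrite /upd eq_sym (negbTE xi) eq_sym (negbTE xj).
rewrite (@val_ext _ _ (upd (upd l j (l j)) i (l i + k%:Z))); last first.
  move=> x; rewrite /upd; case: eqP => // _; by case: eqP => // ->.
rewrite val_swap 1?eq_sym// [X in - X](@val_ext _ _ (upd l j (l j + k%:Z))) ?addNr//.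
move=> x; rewrite /upd; case: eqP => [->|_]; last by rewrite e.
by rewrite (negbTE ij) e.
Qed.

(** Lowering row j < m by m gives j + 1 - m, which is 0 or the opposite of the index m - j - 1 of an
    earlier row. By oddness the result repeats a row and vanishes, unless that row is j itself: this
    happens for m = 2j + 2 only, and then the row merely changes sign. *)
Let flip1 F (m : nat) l : (0 < m <= n)%N ->
  (forall j : 'I_n, (j < m)%N -> l j = j.+1 :> int) ->
  \sum_(j < n | (j < m)%N) val F (upd l j (l j - m%:Z)) = - (~~ odd m)%:R * val F l.
Proof.
move=> /andP[m0 mn] lm.
have zero (j : 'I_n) : (j < m)%N -> (m != j.*2.+2)%N ->
    val F (upd l j (l j - m%:Z)) = 0.
  move=> jm mj; have [e|ne] := eqVneq m j.+1.
    by apply: (@val0 _ _ j); rewrite /upd eqxx lm// e; lia.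
  have j'n : (m - j.+2 < n)%N by lia.
  pose j' := Ordinal j'n.
  have jj' : j' != j by apply/eqP => /(congr1 (@nat_of_ord n)) /=; lia.
  rewrite (_ : l j - m%:Z = - l j'); last by rewrite !lm /=; lia.
  rewrite val_neg (@val_rep _ _ j' j) ?oppr0//.
  by rewrite /upd eqxx (negbTE jj').
have [om|om] /= := boolP (odd m).
  rewrite oppr0 mul0r big1// => j jm; apply: zero => //.
  by apply/eqP => e; move: om; rewrite e /= odd_double.
have em := even_halfK om.
have j0n : (m./2.-1 < n)%N by lia.
pose j0 := Ordinal j0n.
rewrite (bigD1 j0) /=; last by lia.
rewrite big1 ?addr0; last first.
  move=> j /andP[jm jj0]; apply: zero => //.
  apply: contraNN jj0 => /eqP e; apply/eqP/val_inj => /=; lia.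
rewrite (_ : l j0 - m%:Z = - l j0); last by rewrite !lm /=; lia.
rewrite val_neg mulNr mul1r; congr (- _); apply: val_ext; exact: upd_id.
Qed.

Let updC (l : 'I_n -> int) i j a b : i != j -> upd (upd l i a) j b =1 upd (upd l j b) i a.
Proof.
move=> ij x; rewrite /upd; case: eqP => [->|//]; by rewrite eq_sym (negbTE ij).
Qed.

Let upd_ne (l : 'I_n -> int) i j v : i != j -> upd l i v j = l j.
Proof. by move=> ij; rewrite /upd eq_sym (negbTE ij). Qed.

Let updd (l : 'I_n -> int) i a b : upd (upd l i a) i b =1 upd l i b.
Proof. by move=> x; rewrite /upd; case: eqP. Qed.

(** A raised row i >= m does not interfere with the lowered rows, so [flip1] applies. For i < m two
    terms can survive: j = i, where row i moves by k - m, and j = i + k < m, where the two rows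
    exchange roles; they cancel. If i + k >= m only the first remains, and it repeats row i + k - m
    unless m = k. In that last case each of the k rows i < k returns to its place, which is the
    origin of the factor k in the covariance. *)
Let flip2 F (m k p : nat) l : (0 < m)%N -> (0 < k)%N -> (m + k <= p <= n)%N ->
  filled p l ->
  \sum_(j < n | (j < m)%N) up F k (upd l j (l j - m%:Z)) =
    - (~~ odd m)%:R * up F k l + (k * (m == k))%:R * val F l.
Proof.
move=> m0 k0 /andP[mkp pn] fl.
have lp (j : 'I_n) : (j < p)%N -> l j = j.+1 :> int by move=> jp; have := fl j; rewrite jp.
rewrite /up exchange_big /= (bigID (fun i : 'I_n => (i < m)%N)) /= addrC.
have top : \sum_(i < n | ~~ (i < m)%N) \sum_(j < n | (j < m)%N)
   val F (upd (upd l j (l j - m%:Z)) i (upd l j (l j - m%:Z) i + k%:Z)) =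
   - (~~ odd m)%:R * \sum_i val F (upd l i (l i + k%:Z)).
  rewrite [in RHS](bigID (fun i : 'I_n => (i < m)%N)) /=.
  rewrite [X in _ * (X + _)]big1 ?add0r; last first.
    move=> i im; have ikn : (i + k < n)%N by lia.
    apply: (@val_rep _ _ i (Ordinal ikn)).
      by apply/eqP => /(congr1 (@nat_of_ord n)) /=; lia.
    rewrite /upd eqxx; case: eqP => [/(congr1 (@nat_of_ord n)) /=|_]; first lia.
    rewrite !lp /=; lia.
  rewrite mulr_sumr; apply: eq_bigr => i im.
  rewrite -(@flip1 F m (upd l i (l i + k%:Z))); last 2 first.
  - lia.
  - move=> j jm; rewrite /upd; case: eqP => [e|_]; last by rewrite lp//; lia.
    by move: im; rewrite -e jm.
  apply: eq_bigr => j jm.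
  have ij : i != j by apply: contraNneq im => ->.
  rewrite (_ : upd l j (l j - m%:Z) i = l i); last by rewrite /upd (negbTE ij).
  rewrite (_ : upd l i (l i + k%:Z) j = l j); last by rewrite /upd eq_sym (negbTE ij).
  by apply: val_ext; apply: updC; rewrite eq_sym.
rewrite top; congr (_ + _).
pose D (j : 'I_n) := val F (upd l j (l j + k%:Z - m%:Z)).
have inner (i : 'I_n) : (i < m)%N -> \sum_(j < n | (j < m)%N)
   val F (upd (upd l j (l j - m%:Z)) i (upd l j (l j - m%:Z) i + k%:Z)) =
   D i - (i + k < m)%:R * D i.
  move=> im; rewrite (bigD1 i) //=; congr (_ + _).
    rewrite (@val_ext _ _ (upd l i (l i + k%:Z - m%:Z)))//.
    by move=> x; rewrite updd /upd eqxx; case: eqP => // _; lia.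
  have ikn : (i + k < n)%N by lia.
  have rest (j : 'I_n) : j != i -> (j < m)%N -> j != Ordinal ikn ->
      val F (upd (upd l j (l j - m%:Z)) i (upd l j (l j - m%:Z) i + k%:Z)) = 0.
    move=> ji jm jik; apply: (@val_rep _ _ i (Ordinal ikn)).
      by apply/eqP => /(congr1 (@nat_of_ord n)) /=; lia.
    rewrite /upd eqxx [i == j]eq_sym (negbTE ji) [Ordinal ikn == j]eq_sym (negbTE jik).
    case: eqP => [/(congr1 (@nat_of_ord n)) /=|_]; first lia.
    rewrite !lp /=; lia.
  have [ikm|ikm] := ltnP (i + k) m; last first.
    rewrite mul0r oppr0 big1// => j /andP[jm ji]; apply: rest => //.
    by apply/eqP => /(congr1 (@nat_of_ord n)) /=; lia.
  rewrite mul1r (bigD1 (Ordinal ikn)) /=; last first.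
    by rewrite ikm /=; apply/eqP => /(congr1 (@nat_of_ord n)) /=; lia.
  rewrite big1 ?addr0; last first.
    by move=> j /andP[/andP[jm ji] jik]; apply: rest.
  set j := Ordinal ikn.
  have ji : j != i by apply/eqP => /(congr1 (@nat_of_ord n)) /=; lia.
  have lj : l j = (i + k).+1 :> int by rewrite lp//=; lia.
  have li : l i = i.+1 :> int by rewrite lp//; lia.
  rewrite val_swap//; congr (- _); apply: val_ext => x; rewrite /upd.
  case: eqP => [_|xi]; first by rewrite lj li; lia.
  case: eqP => [->|//]; by rewrite [i == j]eq_sym (negbTE ji) lj li; lia.
rewrite (eq_bigr _ inner).
have [mk|mk] := eqVneq m k.
  rewrite (eq_bigr (fun=> val F l)); last first.
    move=> i im; rewrite mk ltnNge leq_addl /= mul0r subr0 /D; apply: val_ext.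
    by apply: upd_id; lia.
  rewrite mk sumr_const muln1 -[LHS]mulr_natl; congr (_%:R * _).
  have kn : (k <= n)%N by lia.
  rewrite -[RHS](card_ord k) -[RHS](fintype.card_image (f := widen_ord kn)); last first.
    by move=> x y /(congr1 (@nat_of_ord n)) /= ?; apply: val_inj.
  apply: eq_card => x; apply/idP/fintype.imageP => [xk|[y _ ->]]; last first.
    by rewrite unfold_in /=; exact: (ltn_ord y).
  by exists (Ordinal xk) => //; apply: val_inj.
rewrite muln0 mul0r big1// => i im.
have [ikm|ikm] := ltnP (i + k) m; first by rewrite mul1r subrr.
rewrite mul0r subr0 /D.
have j'n : (i + k - m < n)%N by lia.
apply: (@val_rep _ _ i (Ordinal j'n)).
  by apply/eqP => /(congr1 (@nat_of_ord n)) /=; lia.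
rewrite /upd eqxx; case: eqP => [/(congr1 (@nat_of_ord n)) /=|_]; first lia.
rewrite !lp /=; lia.
Qed.

(** Without power sums a family survives only if its indices are 1, ..., n in some order. Their sum
    is then fixed, whereas shifting one index of such a family raises the sum by k > 0. *)
Let up_nil k p l : (0 < k <= p)%N -> (p <= n)%N -> filled p l -> up [::] k l = 0.
Proof.
move=> /andP[k0 kp] pn fl.
have lpos i : (0 < l i)%R by have := fl i; case: ifP => _; lia.
have [[i ln]|nex] := pselect (exists i, (n%:Z < l i)%R).
  rewrite /up big1// => j _; apply: (@val_nil _ i); rewrite /upd.
  by case: eqP => [<-|_]; lia.
have [inj|/injectivePn [i [j ij lij]]] := boolP (injectiveb l); last first.
  by apply: (@up_rep _ _ _ i j) => //; rewrite eq_sym.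
have ub i : (l i <= n%:Z)%R by rewrite leNgt; apply/negP => h; apply: nex; exists i.
have sum_inj (g : 'I_n -> int) : injective g -> (forall i, 0 < g i <= n%:Z)%R ->
    \sum_i g i = \sum_(i < n) (i.+1)%:Z.
  move=> ginj gb.
  have gn i : ((absz (g i)).-1 < n)%N by have := gb i; lia.
  pose h i := Ordinal (gn i).
  have hinj : injective h.
    move=> i j /(congr1 (@nat_of_ord n)) /= e; apply: ginj.
    by have := gb i; have := gb j; lia.
  rewrite [RHS](reindex_inj hinj); apply: eq_bigr => i _ /=.
  by have := gb i; lia.
rewrite /up big1// => i _.
have [lin|lin] := lerP (l i + k%:Z) n%:Z; last first.
  by apply: (@val_nil _ i); rewrite /upd eqxx.
have [uinj|/injectivePn [x [y xy uxy]]] := boolP (injectiveb (upd l i (l i + k%:Z))); last first.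
  by apply: (@val_rep _ _ x y) => //; rewrite eq_sym.
have : \sum_j upd l i (l i + k%:Z) j = \sum_j l j.
  rewrite (sum_inj _ (injectiveP _ uinj)) ?(sum_inj _ (injectiveP _ inj))// => j.
    by rewrite lpos ub.
  rewrite /upd; case: eqP => _; last by rewrite lpos ub.
  by rewrite lin andbT; have := lpos i; lia.
rewrite (bigD1 i)//= [in RHS](bigD1 i)//= /upd eqxx.
rewrite (eq_bigr l) => [e|j /negbTE -> //].
by exfalso; move: e; set S := \sum_(_ | _) _; lia.
Qed.

(* Shifting an entry of a family that fills the slots 1, ..., p either repeats an
   entry or pushes it above p - k, so the shift commutes with the remaining power
   sums except when it is undone by a factor of the same index k. *)
Lemma wick F : forall p l k, filled p l -> (0 < k)%N -> all (leq 1) F ->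
  (k + sumn F <= p <= n)%N ->
  \sum_i val F (upd l i (l i + k%:Z)) = (k * count_mem k F)%:R * val (rem k F) l.
Proof.
rewrite -/(up _ _ _).
elim: F => [|m F IH] p l k fl k0 /=.
  move=> _ /andP[kp pn]; rewrite muln0 mul0r; apply: (@up_nil _ p) => //; lia.
move=> /andP[m0 F0] /andP[kmp pn].
pose r := (k * count_mem k F)%:R : R.
have upcons : up (m :: F) k l = \sum_j up F k (upd l j (l j + m%:Z)) +
    \sum_j up F k (upd l j (l j - m%:Z)).
  rewrite /up exchange_big [X in _ = _ + X]exchange_big -big_split /=.
  apply: eq_bigr => i _; rewrite val_cons; congr (_ + _); apply: eq_bigr => j _.
    have [->|ij] := eqVneq i j.
      apply: val_ext => x; rewrite !updd /upd eqxx; case: eqP => // _; lia.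
    have ji : j != i by rewrite eq_sym.
    by rewrite upd_ne // upd_ne //; apply: val_ext; exact: updC.
  have [->|ij] := eqVneq i j.
    apply: val_ext => x; rewrite !updd /upd eqxx; case: eqP => // _; lia.
  have ji : j != i by rewrite eq_sym.
  by rewrite upd_ne // upd_ne //; apply: val_ext; exact: updC.
have lp (j : 'I_n) : (j < p)%N -> l j = j.+1 :> int by move=> jp; have := fl j; rewrite jp.
have lq (j : 'I_n) : (p <= j)%N -> (p%:Z < l j)%R.
  by move=> jp; have := fl j; rewrite ltnNge jp.
have rep i j l' : i != j -> l' i = l' j -> up F k l' = r * val (rem k F) l'.
  by move=> ij e; rewrite (up_rep _ _ ij e) (val_rep _ ij e) mulr0.
have good l' : filled (p - m) l' -> up F k l' = r * val (rem k F) l'.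
  by move=> fl'; apply: (IH (p - m)%N) => //; lia.
have plus j : up F k (upd l j (l j + m%:Z)) = r * val (rem k F) (upd l j (l j + m%:Z)).
  have [jm|jm] := ltnP (j + m) p.
    have jn : (j + m < n)%N by lia.
    have ne : j != Ordinal jn by apply/eqP => /(congr1 (@nat_of_ord n)) /=; lia.
    apply: (@rep j (Ordinal jn)) => //.
    by rewrite /upd eqxx eq_sym (negbTE ne) !lp /=; lia.
  apply: good => i; rewrite /upd; case: eqP => [->|_].
    by have := fl j; case: ifP; case: ifP; lia.
  by have := fl i; case: ifP; case: ifP; lia.
have minus (j : 'I_n) : ~~ (j < m)%N ->
    up F k (upd l j (l j - m%:Z)) = r * val (rem k F) (upd l j (l j - m%:Z)).
  move=> jm; have [jp|jp] := ltnP j p.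
    have jn : (j - m < n)%N by lia.
    have ne : j != Ordinal jn by apply/eqP => /(congr1 (@nat_of_ord n)) /=; lia.
    apply: (@rep j (Ordinal jn)) => //.
    by rewrite /upd eqxx eq_sym (negbTE ne) !lp /=; lia.
  apply: good => i; rewrite /upd; case: eqP => [->|_].
    by have := fl j; case: ifP; case: ifP; lia.
  by have := fl i; case: ifP; case: ifP; lia.
rewrite -/(up _ _ _) upcons (eq_bigr _ (fun j _ => plus j)) -mulr_sumr.
rewrite [X in _ + X = _](bigID (fun j : 'I_n => (j < m)%N)) /= (eq_bigr _ minus) -mulr_sumr.
(* Only the rows below [m] can be pushed through zero; they alone produce the contraction of [m]
   with [k]. *)
rewrite (@flip2 F m k p)//; last lia.
have -> : up F k l = r * val (rem k F) l by apply: (IH p) => //; lia.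
have key : r * \sum_j val (rem k F) (upd l j (l j + m%:Z)) +
   (- (~~ odd m)%:R * (r * val (rem k F) l) +
     r * \sum_(j < n | ~~ (j < m)%N) val (rem k F) (upd l j (l j - m%:Z))) =
   r * val (m :: rem k F) l.
  rewrite val_cons [X in _ = _ * (_ + X)](bigID (fun j : 'I_n => (j < m)%N)) /=.
  rewrite (@flip1 (rem k F)); [ring | lia | move=> j jm; apply: lp; lia].
rewrite -/r [X in _ + X = _]addrAC [LHS]addrA key /r.
have [->|mk] := eqVneq m k.
  have [kF|kF] := boolP (k \in F).
    rewrite -(@val_perm F) ?perm_to_rem//.
    by rewrite -mulrDl -natrD -mulnDr addnC ?eqxx.
  by rewrite (count_memPn kF) muln0 mul0r add0r addn0.
by rewrite muln0 mul0r addr0 add0n.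
Qed.

(** From [rho], a row j >= k lowered by k repeats row j - k, and the rows below k are handled by
    [flip1]. So adding 1 to a power sum of even degree leaves exactly the upward shift that [wick]
    evaluates. *)
Lemma wick_rho F k : (0 < k)%N -> all (leq 1) F -> (k + sumn F <= n)%N ->
  val (k :: F) (@rho n) + (~~ odd k)%:R * val F (@rho n) =
  (k * count_mem k F)%:R * val (rem k F) (@rho n).
Proof.
move=> k0 F0 kF.
have fl : filled n (@rho n) by move=> i; rewrite ltn_ord.
rewrite -(wick fl k0 F0) ?kF ?leqnn// val_cons -addrA; apply/eqP.
rewrite -subr_eq0 addrAC subrr add0r; apply/eqP.
rewrite (bigID (fun j : 'I_n => (j < k)%N)) /= flip1; [|lia|by []].
rewrite big1 ?addr0 ?mulNr ?addNr// => j jk.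
have jn : (j - k < n)%N by have := ltn_ord j; lia.
have ne : j != Ordinal jn by apply/eqP => /(congr1 (@nat_of_ord n)) /=; lia.
apply: (@val_rep _ _ j (Ordinal jn)) => //.
by rewrite [RHS]upd_ne// /upd eqxx /rho /=; lia.
Qed.

End WickRule.

(** * Chebyshev polynomials and their alternants *)

Section Chebyshev.
Variable R : realFieldType.
Implicit Types (x : R) (s : seq R).

(* [chebU k x] is U_(k-1)(x/2): the shifted index makes its extension [chebUz] to
   the integers odd. [chebT k x] is 2 T_k(x/2); in particular [chebT 0 x = 2]. *)
Fixpoint chebU (k : nat) x : R :=
  if k is j.+1 then (if j is i.+1 then x * chebU j x - chebU i x else 1) else 0.

Fixpoint chebT (k : nat) x : R :=
  if k is j.+1 then (if j is i.+1 then x * chebT j x - chebT i x else x) else 2.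

Definition chebUz (l : int) x : R :=
  match l with Posz k => chebU k x | Negz k => - chebU k.+1 x end.

Lemma chebUzN l x : chebUz (- l) x = - chebUz l x.
Proof. by case: l => [[|k]|k] //=; rewrite ?oppr0 ?opprK. Qed.

Lemma chebUz_rec l x : chebUz (l + 1) x = x * chebUz l x - chebUz (l - 1) x.
Proof.
case: l => [[|k]|[|k]].
- by rewrite /=; lra.
- by rewrite -PoszD addn1 (_ : k.+1%:Z - 1 = k) //; lia.
- by rewrite /=; lra.
- rewrite (_ : Negz k.+1 + 1 = Negz k); last by lia.
  rewrite (_ : Negz k.+1 - 1 = Negz k.+2); last by lia.
  by rewrite /chebUz [chebU k.+3 x]/= -/(chebU k.+2 x) -/(chebU k.+1 x); ring.
Qed.

Lemma chebUz_chebT l m x :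
  chebUz l x * chebT m x = chebUz (l + m%:Z) x + chebUz (l - m%:Z) x.
Proof.
suff [] : chebUz l x * chebT m x = chebUz (l + m%:Z) x + chebUz (l - m%:Z) x /\
  chebUz l x * chebT m.+1 x = chebUz (l + m.+1%:Z) x + chebUz (l - m.+1%:Z) x by [].
elim: m => [|m [IH1 IH2]].
  have e1 : l + 0%:Z = l by exact: addr0.
  rewrite e1 /=; split; first by ring.
  by rewrite chebUz_rec; ring.
split=> //.
rewrite [chebT m.+2 x]/= -/(chebT m.+1 x) mulrBr mulrCA IH1 IH2.
rewrite (_ : l + m.+2%:Z = l + m.+1%:Z + 1); last by lia.
rewrite chebUz_rec (_ : l + m.+1%:Z - 1 = l + m%:Z); last by lia.
have := chebUz_rec (l - m.+1%:Z) x.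
rewrite (_ : l - m.+1%:Z + 1 = l - m%:Z); last by lia.
rewrite (_ : l - m.+1%:Z - 1 = l - m.+2%:Z); last by lia.
move=> ->; ring.
Qed.

Definition altU (n : nat) (l : 'I_n -> int) s : R :=
  \det (\matrix_(i < n, j < n) chebUz (l i) s`_j).

Definition powsum (n m : nat) s : R := \sum_(j < n) chebT m s`_j.

Definition powprod (n : nat) (F : seq nat) s : R := \prod_(m <- F) powsum n m s.

Lemma altU_rep n (l : 'I_n -> int) s i j : i != j -> l i = l j -> altU l s = 0.
Proof.
move=> ij e; apply: (determinant_alternate ij) => k.
by rewrite !mxE e.
Qed.

Lemma altU_upd n (l : 'I_n -> int) s i v :
  altU (upd l i v) s = \sum_(j < n) chebUz v s`_j * cofactor
    (\matrix_(i < n, j < n) chebUz (l i) s`_j) i j.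
Proof.
rewrite /altU (expand_det_row _ i); apply: eq_bigr => j _.
rewrite mxE /upd eqxx; congr (_ * _).
rewrite /cofactor; congr (_ * \det _); apply/matrixP => a b; rewrite !mxE.
by rewrite eq_sym (negbTE (neq_lift _ _)).
Qed.

Lemma altU_neg n (l : 'I_n -> int) s i v :
  altU (upd l i (- v)) s = - altU (upd l i v) s.
Proof.
by rewrite !altU_upd -sumrN; apply: eq_bigr => j _; rewrite chebUzN mulNr.
Qed.

Lemma altU_swap n (l : 'I_n -> int) s i j a b : i != j ->
  altU (upd (upd l i a) j b) s = - altU (upd (upd l i b) j a) s.
Proof.
move=> ij; rewrite /altU.
set M := \matrix_(_, _) _; set M' := \matrix_(_, _) _.
have -> : M' = row_perm (tperm i j) M.
  apply/matrixP => x y; rewrite !mxE /upd; congr (chebUz _ _).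
  case: tpermP => [->|->|/eqP xi /eqP xj].
  - by rewrite !eqxx (negbTE ij).
  - by rewrite !eqxx (negbTE ij).
  - by rewrite (negbTE xi) (negbTE xj).
by rewrite row_permE det_mulmx det_perm odd_tperm ij expr1 mulN1r opprK.
Qed.

(** Laplace expansion along the shifted rows turns the right-hand side into a double sum over
    entries, each entry multiplied by [chebT m] at its column's point; summed column by column it is
    an expansion of the original determinant. *)
Lemma powsum_altU n m (l : 'I_n -> int) s : powsum n m s * altU l s =
  \sum_j altU (upd l j (l j + m%:Z)) s + \sum_j altU (upd l j (l j - m%:Z)) s.
Proof.
rewrite -big_split /=.
under [RHS]eq_bigr => i _.
  rewrite !altU_upd -big_split /=.
  under eq_bigr => j _ do rewrite -mulrDl -chebUz_chebT.
  over.
rewrite exchange_big /= /powsum mulr_suml; apply: eq_bigr => j _.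
rewrite /altU (expand_det_col _ j) mulr_sumr; apply: eq_bigr => i _.
by rewrite mxE mulrCA mulrA.
Qed.

(** Row i of [altU rho] is a monic polynomial of degree i (the [P i] below), so the matrix is a
    unitriangular matrix times the Vandermonde matrix. *)
Lemma altU_rho_sqr n s : altU (@rho n) s ^+ 2 = \prod_(i < n) \prod_(j < n | (i < j)%N)
  (s`_i - s`_j) ^+ 2.
Proof.
pose fix P (k : nat) : {poly R} :=
  if k is j.+1 then (if j is i.+1 then 'X * P j - P i else 'X) else 1.
have hP k : forall x, (P k).[x] = chebU k.+1 x.
  move=> x; suff [] : (P k).[x] = chebU k.+1 x /\ (P k.+1).[x] = chebU k.+2 x by [].
  elim: k => [|k [IH1 IH2]]; first by rewrite /= !hornerE; split => //; lra.
  split=> //; rewrite [P k.+2]/= -/(P k.+1) hornerD hornerN hornerM hornerX IH1 IH2.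
  by [].
have sP k : size (P k) = k.+1 /\ P k \is monic.
  suff [] : (size (P k) = k.+1 /\ P k \is monic) /\
            (size (P k.+1) = k.+2 /\ P k.+1 \is monic) by [].
  elim: k => [|k [[s1 m1] [s2 m2]]].
    by rewrite /= size_poly1 size_polyX monic1 monicX.
  split => //; rewrite [P k.+2]/= -/(P k.+1).
  have sX : size ('X * P k.+1) = k.+3.
    by rewrite mulrC size_mulX ?s2// monic_neq0.
  have lt : (size (- P k)%R < size ('X * P k.+1)%R)%N by rewrite size_polyN s1 sX.
  split; first by rewrite size_polyDl.
  by rewrite monicE lead_coefDl// -monicE monicMl// monicX.
pose L := \matrix_(i < n, k < n) (P i)`_k.
pose a := \row_(j < n) s`_j.
have -> : altU (@rho n) s = \det (Vandermonde n a).
  rewrite /altU (_ : \matrix_(_, _) _ = L *m Vandermonde n a); last first.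
    apply/matrixP => i j; rewrite !mxE [LHS](_ : _ = chebU i.+1 s`_j)// -hP.
    have [si _] := sP i.
    rewrite (@horner_coef_wide _ n); last by rewrite si.
    by apply: eq_bigr => k _; rewrite !mxE.
  rewrite det_mulmx (_ : \det L = 1) ?mul1r// det_trig.
    rewrite big1// => i _; rewrite mxE; have [si] := sP i.
    by rewrite monicE lead_coefE si => /eqP.
  apply/is_trig_mxP => i j ij; rewrite mxE nth_default//.
  by have [-> _] := sP i.
rewrite det_Vandermonde -prodrXl; apply: eq_bigr => i _.
rewrite -prodrXl; apply: eq_bigr => j _.
by rewrite !mxE -sqrrN opprB.
Qed.

End Chebyshev.

(** * Integration against the semicircle density *)

Section Integrals.
Variable R : realType.
Implicit Types (x y : R) (s t : seq R).
Notation mu := (@lebesgue_measure R).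

Lemma heine (g : R -> R) (M : R) : continuous g -> forall e, 0 < e ->
  exists2 d, 0 < d & forall x y, `|x| <= M -> `|x - y| <= d -> `|g x - g y| <= e.
Proof.
move=> cg e e0.
have cov := (compact_near_coveringP _).1 (@segment_compact R (- M) M) R (0 : R)^'+
  (fun d x => forall y, `|x - y| <= d -> `|g x - g y| <= e) _ _.
have /cov near_d : forall x, `[- M, M]%classic x ->
    \forall x' \near x & d \near 0^'+, forall y, `|x' - y| <= d -> `|g x' - g y| <= e.
  move=> x _; have /cvgrPdist_le/(_ (e / 2)) := cg x.
  rewrite divr_gt0// => /(_ isT) /nbhs_ballP[r /= r0 hr].
  exists (ball x (r / 2), [set d | 0 < d < r / 2]).
    split => /=; first by apply: nbhsx_ballx; lra.
    near=> d; apply/andP; split; near: d; [exact: nbhs_right_gt|apply: nbhs_right_lt; lra].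
  move=> [x' d] /= [bx /andP[d0 dr]] y xy.
  have h1 : `|g x - g x'| <= e / 2 by apply: hr; apply: le_ball bx; lra.
  have h2 : `|g x - g y| <= e / 2.
    apply: hr; rewrite /ball /=.
    rewrite (_ : x - y = (x - x') + (x' - y)); last by ring.
    apply: (le_lt_trans (ler_normD _ _)).
    by move: bx; rewrite /ball /=; lra.
  rewrite (_ : g x' - g y = (g x' - g x) + (g x - g y)); last by ring.
  apply: (le_trans (ler_normD _ _)); rewrite (distrC (g x')); lra.
have [d [d0 hd]] := filter_ex (filterI (nbhs_right_gt (0 : R)) near_d).
exists d => // x y xM xy; apply: hd => //=.
by rewrite in_itv /= -ler_norml.
Unshelve. all: by end_near. Qed.

(* Uniform continuity on [-2,2] without mentioning subspace topologies. *)
Definition cont2 (h : R -> R) : Prop := forall e, 0 < e ->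
  exists2 d, 0 < d & forall x y, `|x| <= 2 -> `|y| <= 2 -> `|x - y| <= d -> `|h x - h y| <= e.

Let clip x := Num.max (-2) (Num.min 2 x).

Lemma clip_id x : `|x| <= 2 -> clip x = x.
Proof.
rewrite ler_norml => /andP[h1 h2].
by rewrite /clip (min_idPr h2) (max_idPr h1).
Qed.

Lemma clip_le x : `|clip x| <= 2.
Proof.
rewrite ler_norml /clip le_max lexx /= ge_max ge_min lexx /= andbT; lra.
Qed.

Lemma clip_lip x y : `|clip x - clip y| <= `|x - y|.
Proof.
rewrite /clip; case: (leP 2 x) => h1; case: (leP 2 y) => h2.
- by rewrite subrr normr0.
- case: (leP (-2) y) => h3; case: (leP (-2) 2) => h4; rewrite !ger0_norm; lra.
- case: (leP (-2) x) => h3; case: (leP (-2) 2) => h4; rewrite !ler0_norm; lra.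
- case: (leP (-2) x) => h3; case: (leP (-2) y) => h4 //; last by rewrite subrr normr0.
  + rewrite !ger0_norm; lra.
  + rewrite !ler0_norm; lra.
Qed.

Lemma cont2_clip (h : R -> R) : cont2 h -> continuous (h \o clip).
Proof.
move=> ch x; apply/cvgrPdist_le => e e0.
have [d d0 hd] := ch e e0.
near=> y; apply: hd; [exact: clip_le|exact: clip_le|].
apply: (le_trans (clip_lip _ _)).
by near: y; apply: cvgr_dist_le.
Unshelve. all: by end_near. Qed.

(** [Num.sqrt] is 0 on negative numbers, so a single formula holds on the whole line and yields
    continuity at the end points. *)
Lemma mu0_densityE x : mu0_density x = Num.sqrt (4 - x ^+ 2) / (pi *+ 2).
Proof.
rewrite /mu0_density; case: ifPn => // hx.
rewrite ler0_sqrtr ?mul0r//.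
move: hx; rewrite negb_and -!ltNge => /orP[]; nra.
Qed.

Lemma continuous_mu0_density : continuous (@mu0_density R).
Proof.
move=> x; rewrite (_ : @mu0_density R = fun x => Num.sqrt (4 - x ^+ 2) / (pi *+ 2)).
  apply: cvgMr_tmp.
  apply: (continuous_comp (f := fun x : R => 4 - x ^+ 2)); last exact: sqrt_continuous.
  by apply: cvgB; [exact: cvg_cst|exact: exprn_continuous].
by apply/funext => y; rewrite mu0_densityE.
Qed.

(** The density vanishes off [-2,2], so [h] may be replaced by its composition with the retraction
    [clip], which is continuous on the line. *)
Lemma integrable_mu0 (h : R -> R) : cont2 h ->
  mu.-integrable setT (EFin \o (fun x => h x * mu0_density x)).
Proof.
move=> ch.
have ci : mu.-integrable `[-2, 2] (EFin \o (fun x => (h \o clip) x * mu0_density x)).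
  apply: continuous_compact_integrable; first exact: segment_compact.
  apply: continuous_subspaceT => x.
  by apply: cvgM; [exact: cont2_clip|exact: continuous_mu0_density].
have : mu.-integrable setT ((EFin \o (fun x => (h \o clip) x * mu0_density x)) \_ `[-2, 2]).
  by apply: (integrable_mkcond _ _).1 => //; exact: measurable_itv.
apply: eq_integrable => // x _.
rewrite restrict_EFin /= /patch; case: ifPn => [|].
  rewrite inE /= in_itv /= => h2; rewrite clip_id//.
  by rewrite ler_norml.
rewrite notin_setE /= in_itv /= => /negP h2.
by rewrite /mu0_density (negbTE h2) mulr0.
Qed.

Lemma eq_mu0_int (h k : R -> R) : (forall x, `|x| <= 2 -> h x = k x) ->
  mu0_int h = mu0_int k.
Proof.
move=> hk; apply: eq_Rintegral => x _; rewrite /mu0_density; case: ifP.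
  by move=> hx; rewrite hk// ler_norml.
by rewrite !mulr0.
Qed.

Lemma mu0_intD (h k : R -> R) : cont2 h -> cont2 k ->
  mu0_int (fun x => h x + k x) = mu0_int h + mu0_int k.
Proof.
move=> ch ck; rewrite -RintegralD//; try exact: integrable_mu0.
by apply: eq_Rintegral => x _; rewrite mulrDl.
Qed.

Lemma mu0_intZ (a : R) (h : R -> R) : cont2 h ->
  mu0_int (fun x => a * h x) = a * mu0_int h.
Proof.
move=> ch; rewrite -RintegralZl//; try exact: integrable_mu0.
by apply: eq_Rintegral => x _; rewrite mulrA.
Qed.

Lemma mu0_density_ge0 x : 0 <= mu0_density x.
Proof. by rewrite mu0_densityE divr_ge0 ?sqrtr_ge0// mulrn_wge0// pi_ge0. Qed.

Lemma le_mu0_int (h k : R -> R) : cont2 h -> cont2 k ->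
  (forall x, `|x| <= 2 -> h x <= k x) -> mu0_int h <= mu0_int k.
Proof.
move=> ch ck hk; apply: le_Rintegral => //; try exact: integrable_mu0.
move=> x _; rewrite /mu0_density; case: ifP; last by rewrite !mulr0.
move=> hx; have := mu0_density_ge0 x; rewrite /mu0_density hx => w0.
by rewrite ler_wpM2r// hk// ler_norml.
Qed.

End Integrals.

(** * Iterated integrals over the cube *)

Section IteratedIntegrals.
Variable R : realType.
Implicit Types (x y a : R) (s t : seq R) (F G : seq R -> R).

Definition cube (n : nat) s := (size s == n) && all (fun x => `|x| <= 2) s.

(** The class of admissible integrands. It is stable under algebra and continuous composition, and
    also under integrating out all coordinates but the first (the last clause of [ope_int_spec]),
    which replaces joint measurability on lists. *)
Definition ucont (n : nat) F : Prop :=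
  (exists M, forall s, cube n s -> `|F s| <= M) /\
  forall e, 0 < e -> exists2 d, 0 < d & forall s t, cube n s -> cube n t ->
    (forall i, `|s`_i - t`_i| <= d) -> `|F s - F t| <= e.

Lemma ucont_cst n a : ucont n (fun=> a).
Proof.
split; first by exists `|a|.
by move=> e e0; exists 1 => // s t _ _ _; rewrite subrr normr0 ltW.
Qed.

Lemma ucontD n F G : ucont n F -> ucont n G -> ucont n (fun s => F s + G s).
Proof.
move=> [[M hM] uF] [[M' hM'] uG]; split.
  exists (M + M') => s cs; apply: (le_trans (ler_normD _ _)).
  by rewrite lerD ?hM ?hM'.
move=> e e0; have e2 : 0 < e / 2 by lra.
have [d d0 hd] := uF _ e2; have [d' d'0 hd'] := uG _ e2.
exists (Num.min d d'); first by rewrite lt_min d0.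
move=> s t cs ct st.
rewrite (_ : _ - _ = (F s - F t) + (G s - G t)); last by ring.
apply: (le_trans (ler_normD _ _)); rewrite [e in _ <= e](_ : e = e / 2 + e / 2); last by lra.
by apply: lerD; [apply: hd|apply: hd'] => // i; have := st i; rewrite le_min => /andP[].
Qed.

Lemma ucontM n F G : ucont n F -> ucont n G -> ucont n (fun s => F s * G s).
Proof.
move=> [[M hM] uF] [[M' hM'] uG]; split.
  exists (M * M') => s cs; rewrite normrM.
  by apply: ler_pM => //; [exact: hM|exact: hM'].
move=> e e0.
pose K := `|M| + `|M'| + 1.
have K0 : 0 < K by rewrite /K; have := normr_ge0 M; have := normr_ge0 M'; lra.
have e2 : 0 < e / (2 * K) by apply: divr_gt0 => //; lra.
have [d d0 hd] := uF _ e2; have [d' d'0 hd'] := uG _ e2.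
exists (Num.min d d'); first by rewrite lt_min d0.
move=> s t cs ct st.
have h1 : `|F s - F t| <= e / (2 * K).
  by apply: hd => // i; have := st i; rewrite le_min => /andP[].
have h2 : `|G s - G t| <= e / (2 * K).
  by apply: hd' => // i; have := st i; rewrite le_min => /andP[].
rewrite (_ : _ - _ = (F s - F t) * G s + F t * (G s - G t)); last by ring.
apply: (le_trans (ler_normD _ _)); rewrite !normrM.
have hG : `|G s| <= K.
  apply: (le_trans (hM' _ cs)); rewrite /K; have := ler_norm M'; have := normr_ge0 M; lra.
have hF : `|F t| <= K.
  apply: (le_trans (hM _ ct)); rewrite /K; have := ler_norm M; have := normr_ge0 M'; lra.
have -> : e = e / (2 * K) * K + K * (e / (2 * K)) by field; apply/eqP; lra.
by apply: lerD; apply: ler_pM.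
Qed.

Lemma ucontZ n a F : ucont n F -> ucont n (fun s => a * F s).
Proof. by move=> uF; apply: ucontM => //; exact: ucont_cst. Qed.

Lemma ucontN n F : ucont n F -> ucont n (fun s => - F s).
Proof.
move=> uF; rewrite (_ : (fun s => - F s) = (fun s => -1 * F s)); first exact: ucontZ.
by apply/funext => s; rewrite mulN1r.
Qed.

Lemma ucontB n F G : ucont n F -> ucont n G -> ucont n (fun s => F s - G s).
Proof. by move=> uF uG; apply: ucontD => //; exact: ucontN. Qed.

Lemma ucont_sum n (I : Type) (r : seq I) (P : pred I) (F : I -> seq R -> R) :
  (forall i, ucont n (F i)) -> ucont n (fun s => \sum_(i <- r | P i) F i s).
Proof.
move=> uF; elim: r => [|i r IH].
  by under eq_fun do rewrite big_nil; exact: ucont_cst.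
under eq_fun do rewrite big_cons.
by case: (P i) => //; apply: ucontD.
Qed.

Lemma ucont_prod n (I : Type) (r : seq I) (P : pred I) (F : I -> seq R -> R) :
  (forall i, ucont n (F i)) -> ucont n (fun s => \prod_(i <- r | P i) F i s).
Proof.
move=> uF; elim: r => [|i r IH].
  by under eq_fun do rewrite big_nil; exact: ucont_cst.
under eq_fun do rewrite big_cons.
by case: (P i) => //; apply: ucontM.
Qed.

Lemma ucontX n F k : ucont n F -> ucont n (fun s => F s ^+ k).
Proof.
move=> uF; elim: k => [|k IH]; first exact: ucont_cst.
by under eq_fun do rewrite exprS; exact: ucontM.
Qed.

Lemma ucont_comp n (g : R -> R) F : continuous g -> ucont n F ->
  ucont n (fun s => g (F s)).
Proof.
move=> cg [[M hM] uF].
have K e : 0 < e -> exists2 d, 0 < d & forall s t, cube n s -> cube n t ->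
    (forall i, `|s`_i - t`_i| <= d) -> `|g (F s) - g (F t)| <= e.
  move=> e0; have [d d0 hd] := heine M cg e0; have [d' d'0 hd'] := uF _ d0.
  by exists d' => // s t cs ct st; apply: hd; [exact: hM|exact: hd'].
split=> //.
have gb : {within `[- `|M|, `|M|], continuous g} by exact: continuous_subspaceT.
have lM : - `|M| <= `|M| by have := normr_ge0 M; lra.
have [c _ hc] := EVT_max lM gb; have [c' _ hc'] := EVT_min lM gb.
exists (`|g c| + `|g c'|) => s cs.
have /andP[h1 h2] : - `|M| <= F s <= `|M|.
  by rewrite -ler_norml (le_trans (hM _ cs))// ler_norm.
have := hc (F s); have := hc' (F s); rewrite in_itv /= h1 h2.
move=> /(_ isT) l1 /(_ isT) l2.
have := ler_norm (g c); have := ler_norm (- g c'); rewrite normrN => l3 l4.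
have := normr_ge0 (g c); have := normr_ge0 (g c') => l5 l6.
by rewrite ler_norml; apply/andP; split; lra.
Qed.

Lemma cube_nth n s i : cube n s -> `|s`_i| <= 2.
Proof.
move=> /andP[/eqP sn /allP h]; have [l|l] := ltnP i (size s); first by apply/h/mem_nth.
by rewrite nth_default// normr0.
Qed.

Lemma ucont_cont2 n (h : R -> R) i : cont2 h -> ucont n (fun s => h s`_i).
Proof.
move=> ch; split.
  have c := cont2_clip ch.
  have lM : (-2 : R) <= 2 by lra.
  have gb : {within `[(-2 : R), 2], continuous (h \o (fun x => Num.max (-2) (Num.min 2 x)))}.
    exact: continuous_subspaceT.
  have [c1 _ hc] := EVT_max lM gb; have [c2 _ hc'] := EVT_min lM gb.
  set h1 := (_ \o _) in hc hc'.
  exists (`|h1 c1| + `|h1 c2|) => s cs.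
  have cn := cube_nth i cs.
  have -> : h s`_i = h1 s`_i by rewrite /h1 /= clip_id.
  have := hc s`_i; have := hc' s`_i; rewrite in_itv /= -ler_norml cn.
  move=> /(_ isT) l1 /(_ isT) l2.
  have := ler_norm (h1 c1); have := ler_norm (- h1 c2); rewrite normrN => l3 l4.
  have := normr_ge0 (h1 c1); have := normr_ge0 (h1 c2) => l5 l6.
  by rewrite ler_norml; apply/andP; split; lra.
move=> e e0; have [d d0 hd] := ch _ e0.
by exists d => // s t cs ct st; apply: hd => //; [exact: cube_nth cs|exact: cube_nth ct].
Qed.

Lemma cube_cons n x s : cube n.+1 (x :: s) = (`|x| <= 2) && cube n s.
Proof. by rewrite /cube /= eqSS andbCA. Qed.

Lemma ucont_cons n F x : `|x| <= 2 -> ucont n.+1 F -> ucont n (fun s => F (x :: s)).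
Proof.
move=> x2 [[M hM] uF]; split.
  by exists M => s cs; apply: hM; rewrite cube_cons x2.
move=> e e0; have [d d0 hd] := uF _ e0; exists d => // s t cs ct st.
apply: hd; rewrite ?cube_cons ?x2// => -[|i] /=; last exact: st.
by rewrite subrr normr0 ltW.
Qed.

Let m0 : R := mu0_int (fun=> 1).

Lemma cont2_cst a : cont2 (fun=> a).
Proof. by move=> e e0; exists 1 => // *; rewrite subrr normr0 ltW. Qed.

Lemma mu0_int1_ge0 : 0 <= m0.
Proof.
have -> : 0 = mu0_int (fun _ : R => 0 * 1 : R) by rewrite mu0_intZ ?mul0r//; exact: cont2_cst.
apply: le_mu0_int; try exact: cont2_cst.
by move=> x _; rewrite mul0r.
Qed.

(** The four facts need one another: linearity and monotonicity in dimension n + 1 use the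
    continuity of the inner integral in dimension n, and the next continuity statement follows from
    linearity, monotonicity and the value on constants. *)
Lemma ope_int_spec n :
  [/\ forall a F G, ucont n F -> ucont n G ->
        ope_int n (fun s => a * F s + G s) = a * ope_int n F + ope_int n G,
      forall F G, ucont n F -> ucont n G -> (forall s, cube n s -> F s <= G s) ->
        ope_int n F <= ope_int n G,
      forall a, ope_int n (fun=> a) = a * m0 ^+ n &
      forall F, ucont n.+1 F -> cont2 (fun x => ope_int n (fun s => F (x :: s)))].
Proof.
elim: n => [|n [lin mono cst inner]].
  split=> //=; first by move=> F G _ _; apply.
    by move=> a; rewrite mulr1.
  move=> F [_ uF] e e0; have [d d0 hd] := uF _ e0; exists d => // x y x2 y2 xy.
  apply: hd; rewrite ?cube_cons ?x2 ?y2// => -[|i] //=.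
  by rewrite nth_nil subrr normr0 ltW.
have lin' a F G : ucont n.+1 F -> ucont n.+1 G ->
    ope_int n.+1 (fun s => a * F s + G s) = a * ope_int n.+1 F + ope_int n.+1 G.
  move=> uF uG /=; have cF := inner _ uF; have cG := inner _ uG.
  have caF : cont2 (fun x => a * ope_int n (fun s => F (x :: s))).
    have := inner _ (ucontZ a uF).
    move=> h e e0; have [d d0 hd] := h _ e0; exists d => // x y x2 y2 xy.
    have := hd _ _ x2 y2 xy.
    have E z : `|z| <= 2 -> ope_int n (fun s => a * F (z :: s)) = a * ope_int n (fun s => F (z :: s)).
      move=> z2; have := lin a _ _ (ucont_cons z2 uF) (ucont_cst n 0).
      by rewrite cst mul0r addr0 => <-; congr ope_int; apply/funext => s; rewrite addr0.
    by rewrite !E.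
  rewrite -mu0_intZ// -mu0_intD//.
  apply: eq_mu0_int => x x2; apply: lin; exact: ucont_cons.
have mono' F G : ucont n.+1 F -> ucont n.+1 G -> (forall s, cube n.+1 s -> F s <= G s) ->
    ope_int n.+1 F <= ope_int n.+1 G.
  move=> uF uG FG /=; apply: le_mu0_int; try exact: inner.
  move=> x x2; apply: mono; try exact: ucont_cons.
  by move=> s cs; apply: FG; rewrite cube_cons x2.
have cst' a : ope_int n.+1 (fun=> a) = a * m0 ^+ n.+1.
  rewrite /= cst exprSr mulrA -mu0_intZ; last exact: cont2_cst.
  by apply: eq_mu0_int => x _; rewrite mulr1.
split=> // F uF e e0.
(* The total mass [m0] is only known to be nonnegative here; adding 1 makes the division safe. *)
have K0 : 0 < m0 ^+ n.+1 + 1 by rewrite ltr_wpDl// exprn_ge0// mu0_int1_ge0.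
have e1 : 0 < e / (m0 ^+ n.+1 + 1) by exact: divr_gt0.
have [d d0 hd] := uF.2 _ e1; exists d => // x y x2 y2 xy.
have ux := ucont_cons x2 uF; have uy := ucont_cons y2 uF.
have -> : ope_int n.+1 (fun s => F (x :: s)) - ope_int n.+1 (fun s => F (y :: s)) =
    ope_int n.+1 (fun s => -1 * F (y :: s) + F (x :: s)).
  by rewrite lin'// mulN1r addrC.
have b s : cube n.+1 s -> `|-1 * F (y :: s) + F (x :: s)| <= e / (m0 ^+ n.+1 + 1).
  move=> cs; rewrite mulN1r addrC; apply: hd; rewrite ?cube_cons ?x2 ?y2// => -[|i] //=.
  by rewrite subrr normr0 ltW.
have ub : e / (m0 ^+ n.+1 + 1) * m0 ^+ n.+1 <= e.
  rewrite -mulrA ler_piMr//; first exact: ltW.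
  by rewrite mulrC ler_pdivrMr//; lra.
have uxy : ucont n.+1 (fun s => -1 * F (y :: s) + F (x :: s)) by apply: ucontD => //; exact: ucontZ.
rewrite ler_norml; apply/andP; split.
  have := mono' _ _ (ucont_cst _ (- (e / (m0 ^+ n.+1 + 1)))) uxy.
  rewrite cst' mulNr => h; apply: le_trans (h _); first by rewrite lerN2.
  by move=> s cs; have := b s cs; rewrite ler_norml => /andP[].
apply: le_trans ub; rewrite -cst'; apply: mono' => //; first exact: ucont_cst.
by move=> s cs; have := b s cs; rewrite ler_norml => /andP[].
Qed.

Lemma ope_int_cst n a : ope_int n (fun=> a) = a * m0 ^+ n.
Proof. by have [_ _ h _] := ope_int_spec n. Qed.

Lemma le_ope_int n F G : ucont n F -> ucont n G -> (forall s, cube n s -> F s <= G s) ->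
  ope_int n F <= ope_int n G.
Proof. by have [_ h _ _] := ope_int_spec n; exact: h. Qed.

Lemma eq_ope_int n F G : (forall s, cube n s -> F s = G s) -> ope_int n F = ope_int n G.
Proof.
elim: n F G => [|n IH] F G FG /=; first exact: FG.
by apply: eq_mu0_int => x x2; apply: IH => s cs; apply: FG; rewrite cube_cons x2.
Qed.

Lemma ope_intZ n a F : ucont n F -> ope_int n (fun s => a * F s) = a * ope_int n F.
Proof.
move=> uF; have [lin _ _ _] := ope_int_spec n.
have := lin a _ _ uF (ucont_cst n 0); rewrite ope_int_cst mul0r addr0 => <-.
by apply: eq_ope_int => s _; rewrite addr0.
Qed.

Lemma ope_intD n F G : ucont n F -> ucont n G ->
  ope_int n (fun s => F s + G s) = ope_int n F + ope_int n G.
Proof.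
move=> uF uG; have [lin _ _ _] := ope_int_spec n.
have := lin 1 _ _ uF uG; rewrite mul1r => <-.
by apply: eq_ope_int => s _; rewrite mul1r.
Qed.

Lemma ope_int_sum n (I : Type) (r : seq I) (P : pred I) (F : I -> seq R -> R) :
  (forall i, ucont n (F i)) ->
  ope_int n (fun s => \sum_(i <- r | P i) F i s) = \sum_(i <- r | P i) ope_int n (F i).
Proof.
move=> uF; elim: r => [|i r IH].
  by rewrite big_nil; under eq_fun do rewrite big_nil; rewrite ope_int_cst mul0r.
rewrite big_cons -IH; under eq_fun do rewrite big_cons.
by case: (P i) => //; rewrite ope_intD//; exact: ucont_sum.
Qed.

Lemma ope_int_prod n (h : nat -> R -> R) : (forall i, cont2 (h i)) ->
  ope_int n (fun s => \prod_(j < n) h j s`_j) = \prod_(j < n) mu0_int (h j).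
Proof.
elim: n h => [|n IH] h ch /=; first by rewrite !big_ord0.
rewrite big_ord_recl /= -(IH (fun i => h i.+1))// mulrC -mu0_intZ//.
apply: eq_mu0_int => x x2; rewrite mulrC -ope_intZ.
  by congr ope_int; apply/funext => s; rewrite big_ord_recl.
by apply: ucont_prod => i; exact: ucont_cont2.
Qed.

End IteratedIntegrals.

(** * Orthonormality of the Chebyshev polynomials for the semicircle law *)

Section Orthogonality.
Variable R : realType.
Implicit Types (x y : R) (h H : R -> R).
Notation mu := (@lebesgue_measure R).

Lemma sin_natpi (n : nat) : sin (n%:R * pi) = 0 :> R.
Proof.
elim: n => [|n IH]; first by rewrite mul0r sin0.
by rewrite -natr1 mulrDl mul1r sinD IH sinpi mul0r mulr0 addr0.
Qed.

Lemma chebU_cos k (t : R) : chebU k (2 * cos t) * sin t = sin (k%:R * t).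
Proof.
suff [] : chebU k (2 * cos t) * sin t = sin (k%:R * t) /\
   chebU k.+1 (2 * cos t) * sin t = sin (k.+1%:R * t) by [].
elim: k => [|k [IH1 IH2]]; first by rewrite /= !mul0r !mul1r sin0.
split=> //; rewrite [chebU k.+2 _]/= -/(chebU k.+1 _) mulrBl -mulrA IH2 IH1.
have -> : k.+2%:R * t = k.+1%:R * t + t by rewrite -[k.+2%:R]natr1; ring.
have -> : k%:R * t = k.+1%:R * t - t by rewrite -natr1; ring.
by rewrite sinB sinD; ring.
Qed.

Lemma chebT_cos k (t : R) : chebT k (2 * cos t) = 2 * cos (k%:R * t).
Proof.
suff [] : chebT k (2 * cos t) = 2 * cos (k%:R * t) /\
   chebT k.+1 (2 * cos t) = 2 * cos (k.+1%:R * t) by [].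
elim: k => [|k [IH1 IH2]]; first by rewrite /= !mul0r !mul1r cos0 mulr1.
split=> //; rewrite [chebT k.+2 _]/= -/(chebT k.+1 _) IH2 IH1.
have -> : k.+2%:R * t = k.+1%:R * t + t by rewrite -[k.+2%:R]natr1; ring.
have -> : k%:R * t = k.+1%:R * t - t by rewrite -natr1; ring.
by rewrite cosB cosD; ring.
Qed.

Lemma chebT_le k x : `|x| <= 2 -> `|chebT k x| <= 2.
Proof.
move=> x2; have xb : -1 <= x / 2 <= 1 by move: x2; rewrite ler_norml => /andP[]; lra.
have -> : x = 2 * cos (acos (x / 2)) by rewrite acosK ?in_itv//=; field.
rewrite chebT_cos normrM ger0_norm// ler_piMr// ler_norml.
by rewrite cos_geN1 cos_le1.
Qed.

(** The substitution x = 2 cos t carries the semicircle law to 2 (sin t)^2 / pi dt on [0, pi].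
    Taking the primitive as an argument makes each later integral a differentiation. *)
Lemma mu0_int_trig h H : continuous h ->
  (forall t : R, is_derive t 1 H (h (2 * cos t) * (2 * sin t ^+ 2 / pi))) ->
  mu0_int h = H pi - H 0.
Proof.
move=> ch dH.
pose F (t : R) := 2 * cos t.
have dF t : is_derive t (1 : R) F (- (2 * sin t)).
  by rewrite /F; apply: is_derive_eq; rewrite /GRing.scale /=; ring.
have F'E : derive1 F = (fun t => - (2 * sin t)).
  by apply/funext => t; rewrite derive1E derive_val.
have cF' : continuous (derive1 F : R -> R).
  move=> t; rewrite F'E; apply: cvgN; apply: cvgM; first exact: cvg_cst.
  exact: continuous_sin.
have cF : continuous F.
  move=> t; apply: cvgM; first exact: cvg_cst.
  exact: continuous_cos.
pose G x := h x * mu0_density x.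
have cG : continuous G.
  by move=> x; apply: cvgM; [exact: ch|exact: continuous_mu0_density].
have F0 : F 0 = 2 by rewrite /F cos0 mulr1.
have Fpi : F pi = -2 by rewrite /F cospi; lra.
pose I : set R := `[-2, 2]%classic.
pose J : set R := `[0, pi]%classic.
pose K : R -> R := (G \o F) * - (derive1 F : R -> R).
have sub : (\int[mu]_(x in I) (G x)%:E = \int[mu]_(x in J) (K x)%:E)%E.
  have -> : I = `[F pi, F 0]%classic by rewrite F0 Fpi.
  apply: integration_by_substitution_decreasing.
  - exact: pi_ge0.
  - move=> x y; rewrite !in_itv /= => hx hy xy.
    by rewrite /F ltr_pM2l// ltr_cos// in_itv.
  - by move=> x _; exact: cF'.
  - by apply/cvg_ex; eexists; apply: cvg_at_right_filter; exact: cF'.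
  - by apply/cvg_ex; eexists; apply: cvg_at_left_filter; exact: cF'.
  - split; first by move=> x _; exact: ex_derive.
    + by apply: cvg_at_right_filter; exact: cF.
    + by apply: cvg_at_left_filter; exact: cF.
  - exact: continuous_subspaceT.
rewrite /mu0_int /Rintegral.
have -> : (\int[mu]_x (h x * mu0_density x)%:E = \int[mu]_(x in I) (G x)%:E)%E.
  rewrite [RHS]integral_mkcond; apply: eq_integral => x _.
  rewrite /patch; case: ifPn => //.
  rewrite notin_setE /I /= in_itv /= => /negP h2.
  by rewrite /mu0_density (negbTE h2) mulr0.
rewrite sub.
pose L t := h (2 * cos t) * (2 * sin t ^+ 2 / pi).
have E : {in J, K =1 L}.
  move=> t; rewrite inE /J /= in_itv /= => ht; rewrite /K /L !fctE /G F'E opprK mu0_densityE /F.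
  have -> : 4 - (2 * cos t) ^+ 2 = (2 * sin t) ^+ 2 :> R.
    by have := cos2Dsin2 t; nra.
  rewrite sqrtr_sqr ger0_norm; last first.
    by rewrite mulr_ge0// sin_ge0_pi// in_itv.
  rewrite -mulr_natr; field.
  by apply/eqP; have := pi_gt0 R; lra.
have -> : (\int[mu]_(x in J) (K x)%:E = \int[mu]_(x in J) (L x)%:E)%E.
  by apply: eq_integral => t tI; rewrite E.
rewrite (@continuous_FTC2 R _ H) ?pi_gt0//.
- apply: continuous_subspaceT => t; apply: cvgM.
    by apply: (continuous_comp (f := F)); [exact: cF|exact: ch].
  apply: cvgMr_tmp; apply: cvgM; first exact: cvg_cst.
  by apply: (@continuous_comp _ _ _ (@sin R) (fun y : R => y ^+ 2)); [exact: continuous_sin|exact: exprn_continuous].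
- have cH : continuous H.
    by move=> t; apply: differentiable_continuous; apply/derivable1_diffP; exact: ex_derive.
  split; first by move=> x _; exact: ex_derive.
    by apply: cvg_at_right_filter; exact: cH.
  by apply: cvg_at_left_filter; exact: cH.
- by move=> t _; rewrite derive1E derive_val.
Qed.

Lemma chebU_mulSS a b x :
  chebU a.+1 x * chebU b.+1 x = chebU (a + b).+1 x + chebU a x * chebU b x.
Proof.
have rec k : chebU k.+2 x = x * chebU k.+1 x - chebU k x by [].
suff [] : chebU a.+1 x * chebU b.+1 x = chebU (a + b).+1 x + chebU a x * chebU b x /\
  chebU a.+1 x * chebU b.+2 x = chebU (a + b).+2 x + chebU a x * chebU b.+1 x by [].
elim: b => [|b [IH1 IH2]].
  by rewrite addn0 rec; split => /=; ring.
by rewrite addnS; split => //; rewrite [chebU b.+3 x]rec mulrBr mulrCA IH2 IH1 [chebU b.+2 x]rec (rec (a + b).+1); ring.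
Qed.

Lemma continuous_chebU k : continuous (@chebU R k).
Proof.
suff [] : continuous (@chebU R k) /\ continuous (@chebU R k.+1) by [].
elim: k => [|k [IH1 IH2]]; first by split => x; exact: cvg_cst.
split=> // x.
apply: (@cvgB _ _ _ _ _ (fun y => y * chebU k.+1 y)); last exact: IH1.
by apply: cvgM; [exact: cvg_id|exact: IH2].
Qed.

Lemma continuous_chebT k : continuous (@chebT R k).
Proof.
suff [] : continuous (@chebT R k) /\ continuous (@chebT R k.+1) by [].
elim: k => [|k [IH1 IH2]]; first by split => x; [exact: cvg_cst|exact: cvg_id].
split=> // x.
apply: (@cvgB _ _ _ _ _ (fun y => y * chebT k.+1 y)); last exact: IH1.
by apply: cvgM; [exact: cvg_id|exact: IH2].
Qed.

Lemma continuous_cont2 h : continuous h -> cont2 h.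
Proof.
by move=> ch e e0; have [d d0 hd] := heine 2 ch e0; exists d => // x y x2 _; exact: hd.
Qed.

Lemma mu0_int1 : mu0_int (fun=> 1) = 1 :> R.
Proof.
pose H (t : R) := (t - sin t * cos t) / pi.
transitivity (H pi - H 0); last first.
  rewrite /H sinpi sin0 !mul0r !subr0 mul0r subr0 divff//.
  by apply/eqP; have := pi_gt0 R; lra.
apply: mu0_int_trig; first by move=> x; exact: cvg_cst.
move=> t; rewrite /H; apply: is_derive_eq; rewrite /GRing.scale /=.
have -> : 2 * sin t ^+ 2 = 1 - (sin t * - sin t + cos t * cos t).
  by have := cos2Dsin2 t; nra.
by ring.
Qed.

Lemma mu0_int_chebU k : mu0_int (@chebU R k.+2) = 0.
Proof.
(* Primitive of 2 sin t sin((k+2)t) / pi = (cos((k+1)t) - cos((k+3)t)) / pi; it vanishes at both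
   ends. *)
pose H (t : R) := (sin (k.+1%:R * t) / k.+1%:R - sin (k.+3%:R * t) / k.+3%:R) / pi.
transitivity (H pi - H 0); last first.
  by rewrite /H !(sin_natpi, mulr0, sin0, mul0r, subr0).
apply: mu0_int_trig; first exact: continuous_chebU.
move=> t; rewrite /H; apply: is_derive_eq; rewrite /GRing.scale /=.
have -> : chebU k.+2 (2 * cos t) * (2 * sin t ^+ 2 / pi) =
  2 * sin t / pi * (chebU k.+2 (2 * cos t) * sin t) by ring.
rewrite chebU_cos.
have -> : k.+1%:R * t = k.+2%:R * t - t by rewrite -[k.+2%:R]natr1; ring.
have -> : k.+3%:R * t = k.+2%:R * t + t by rewrite -[k.+3%:R]natr1; ring.
have := pi_gt0 R; generalize (@pi R) => P p0; rewrite cosB cosD; field.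
by rewrite (gt_eqF p0) -(natrD _ 3) -(natrD _ 1) !pnatr_eq0.
Qed.

(** By [chebU_mulSS] both indices drop together, each time leaving one polynomial of integral 0,
    unless that polynomial is the constant [chebU 1]. The constant is reached exactly when the two
    indices come to 1 together, that is for a = b > 0. *)
Lemma mu0_int_chebUU a b :
  mu0_int (fun x => chebU a x * chebU b x) = ((a == b) && (0 < a)%N)%:R :> R.
Proof.
have c0 k : cont2 (@chebU R k) by apply: continuous_cont2; exact: continuous_chebU.
have c2 i j : cont2 (fun x : R => chebU i x * chebU j x).
  by apply: continuous_cont2 => x; apply: cvgM; exact: continuous_chebU.
have z : mu0_int (fun=> 0) = 0 :> R.
  have -> : mu0_int (fun=> 0) = mu0_int (fun x : R => 0 * x ) by apply: eq_mu0_int => x _; rewrite mul0r.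
  by rewrite mu0_intZ ?mul0r//; apply: continuous_cont2 => x; exact: cvg_id.
elim: a b => [|a IH] [|b]; rewrite ?andbF.
- by rewrite -[RHS]z; apply: eq_mu0_int => x _; rewrite mul0r.
- by rewrite -[RHS]z; apply: eq_mu0_int => x _; rewrite mul0r.
- by rewrite -[RHS]z; apply: eq_mu0_int => x _; rewrite mulr0.
rewrite (_ : (fun x => _) = (fun x => chebU (a + b).+1 x + chebU a x * chebU b x)); last first.
  by apply/funext => x; rewrite chebU_mulSS.
rewrite mu0_intD// IH eqSS andbT.
case: a {IH} => [|a]; last by rewrite addSn mu0_int_chebU add0r andbT.
case: b => [|b]; first by rewrite andbF addr0 eqxx -[RHS]mu0_int1.
by rewrite (mu0_int_chebU b) add0r andbF.
Qed.

End Orthogonality.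

(** * Moments of power sums under the ensemble *)

Section OpeMoments.
Variable R : realType.
Implicit Types (s : seq R) (F G : seq R -> R).

Lemma cont2_chebUz l : cont2 (@chebUz R l).
Proof.
apply: continuous_cont2; case: l => k; first exact: continuous_chebU.
by move=> x; apply: cvgN; exact: continuous_chebU.
Qed.

Lemma ucont_altU n (l : 'I_n -> int) : ucont n (@altU R n l).
Proof.
rewrite /altU /determinant; apply: ucont_sum => sg; apply: ucontZ.
apply: ucont_prod => i.
have -> : (fun s => (\matrix_(i, j) chebUz (l i) s`_j : 'M[R]_n) i (sg i)) =
          (fun s => chebUz (l i) s`_(sg i)).
  by apply/funext => s; rewrite mxE.
by apply: ucont_cont2; exact: cont2_chebUz.
Qed.

Lemma ucont_powsum n m : ucont n (@powsum R n m).
Proof.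
apply: ucont_sum => i; apply: ucont_cont2; apply: continuous_cont2.
exact: continuous_chebT.
Qed.

Lemma ucont_powprod n L : ucont n (@powprod R n L).
Proof. by apply: ucont_prod => m; exact: ucont_powsum. Qed.

Lemma vdm2E n : @vdm2 R n = fun s => altU (@rho n) s ^+ 2.
Proof. by apply/funext => s; rewrite altU_rho_sqr. Qed.

Lemma ucont_vdm2 n : ucont n (@vdm2 R n).
Proof. by rewrite vdm2E; apply: ucontX; exact: ucont_altU. Qed.

Lemma ope_int_prod_ord n (h : 'I_n -> R -> R) : (forall i, cont2 (h i)) ->
  ope_int n (fun s => \prod_(j < n) h j s`_j) = \prod_(j < n) mu0_int (h j).
Proof.
move=> ch; pose g (i : nat) : R -> R := if insub i is Some j then h j else fun=> 0.
have gh (j : 'I_n) : g j = h j by rewrite /g valK.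
under [RHS]eq_bigr do rewrite -gh.
rewrite -ope_int_prod; last first.
  move=> i; rewrite /g; case: insub => [j|]; first exact: ch.
  exact: cont2_cst.
by congr ope_int; apply/funext => s; apply: eq_bigr => j _; rewrite gh.
Qed.

Lemma altU_tr n (l : 'I_n -> int) s :
  altU l s = \sum_(p : 'S_n) (-1) ^+ p * \prod_(j < n) chebUz (l (p j)) s`_j.
Proof.
rewrite /altU -det_tr /determinant; apply: eq_bigr => p _; congr (_ * _).
by apply: eq_bigr => j _; rewrite !mxE.
Qed.

(** The expansion behind Andreief's identity, kept as a double sum because orthogonality is applied
    term by term. *)
Lemma ope_int_altU2 n (l l' : 'I_n -> int) :
  ope_int n (fun s => altU l s * altU l' s) =
  \sum_(p : 'S_n) \sum_(q : 'S_n) (-1) ^+ p * (-1) ^+ q *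
    \prod_(j < n) mu0_int (fun x : R => chebUz (l (p j)) x * chebUz (l' (q j)) x).
Proof.
have cc (p q : 'S_n) j : cont2 (fun x : R => chebUz (l (p j)) x * chebUz (l' (q j)) x).
  have c z : continuous (@chebUz R z).
    case: z => k; first exact: continuous_chebU.
    by move=> x; apply: cvgN; exact: continuous_chebU.
  by apply: continuous_cont2 => x; apply: cvgM; exact: c.
transitivity (ope_int n (fun s => \sum_(p : 'S_n) \sum_(q : 'S_n) ((-1) ^+ p * (-1) ^+ q) *
    \prod_(j < n) (fun x : R => chebUz (l (p j)) x * chebUz (l' (q j)) x) s`_j)).
  congr ope_int; apply/funext => s; rewrite !altU_tr mulr_suml; apply: eq_bigr => p _.
  rewrite mulr_sumr; apply: eq_bigr => q _.
  by rewrite mulrACA -big_split.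
have up (p q : 'S_n) : ucont n (fun s => \prod_(j < n)
    (fun x : R => chebUz (l (p j)) x * chebUz (l' (q j)) x) s`_j).
  by apply: ucont_prod => j; apply: ucont_cont2 (cc p q j).
rewrite ope_int_sum; last by move=> p; apply: ucont_sum => q; exact: ucontZ.
apply: eq_bigr => p _; rewrite ope_int_sum; last by move=> q; exact: ucontZ.
by apply: eq_bigr => q _; rewrite ope_intZ//; congr (_ * _); exact: ope_int_prod_ord (cc p q).
Qed.

Lemma mu0_int_chebUz (a b : nat) : a != b ->
  mu0_int (fun x : R => chebUz a x * chebUz b x) = 0.
Proof. by move=> ab; rewrite mu0_int_chebUU (negbTE ab). Qed.

(** Row i is orthogonal to every row of [rho], whose indices stop at n: each pair of permutations
    has a zero factor in the column to which the first one assigns row i. *)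
Lemma ope_int_altU_top n (l : 'I_n -> int) i : n%:Z < l i ->
  ope_int n (fun s => @altU R n l s * altU (@rho n) s) = 0.
Proof.
move=> li; rewrite ope_int_altU2 big1// => p _; rewrite big1// => q _.
rewrite (bigD1 ((p^-1)%g i)) //= permKV.
case: (l i) li => // k nk; rewrite (@mu0_int_chebUz k (q ((p^-1)%g i)).+1) ?mul0r ?mulr0//.
by apply/eqP; have := ltn_ord (q ((p^-1)%g i)); lia.
Qed.

(** By orthonormality only the pairs of equal permutations contribute, each with 1. *)
Lemma ope_int_vdm2 n : ope_int n (@vdm2 R n) = n`!%:R.
Proof.
have -> : ope_int n (@vdm2 R n) = ope_int n (fun s => altU (@rho n) s * altU (@rho n) s).
  by rewrite vdm2E; congr ope_int; apply/funext => s; rewrite expr2.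
rewrite ope_int_altU2 -card_Sn -sum1_card natr_sum; apply: eq_bigr => p _.
rewrite (bigD1 p) //= [X in _ + X]big1 ?addr0 => [|q qp].
  rewrite -signr_addb addbb mul1r big1// => j _.
  by rewrite [LHS](mu0_int_chebUU R (p j).+1 (p j).+1) eqxx.
have [j pq] : exists j, p j != q j.
  apply/existsP; apply: contraNT qp => /existsPn h.
  by apply/eqP/permP => j; apply/eqP; rewrite eq_sym; have := h j; rewrite negbK.
rewrite (bigD1 j)//= (@mu0_int_chebUz (p j).+1 (q j).+1) ?mul0r ?mulr0//.
Qed.

Lemma ope_E_unfold n F : ope_E n F = ope_int n (fun s => F s * vdm2 n s) / n`!%:R.
Proof. by rewrite /ope_E ope_int_vdm2. Qed.

Lemma ope_E_cst n (a : R) : ope_E n (fun=> a) = a.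
Proof.
rewrite ope_E_unfold ope_intZ; last exact: ucont_vdm2.
by rewrite ope_int_vdm2 mulfK// pnatr_eq0 -lt0n fact_gt0.
Qed.

Lemma ope_ED n F G : ucont n F -> ucont n G ->
  ope_E n (fun s => F s + G s) = ope_E n F + ope_E n G.
Proof.
move=> uF uG; rewrite !ope_E_unfold -mulrDl; congr (_ / _).
rewrite -ope_intD; try by apply: ucontM => //; exact: ucont_vdm2.
by congr ope_int; apply/funext => s; rewrite mulrDl.
Qed.

Lemma ope_EZ n a F : ucont n F -> ope_E n (fun s => a * F s) = a * ope_E n F.
Proof.
move=> uF; rewrite !ope_E_unfold mulrA; congr (_ / _).
rewrite -ope_intZ; last by apply: ucontM => //; exact: ucont_vdm2.
by congr ope_int; apply/funext => s; rewrite mulrA.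
Qed.

Lemma ope_EB n F G : ucont n F -> ucont n G ->
  ope_E n (fun s => F s - G s) = ope_E n F - ope_E n G.
Proof.
move=> uF uG; rewrite ope_ED//; last exact: ucontN.
congr (_ + _); rewrite -mulN1r -ope_EZ//.
by congr ope_E; apply/funext => s; rewrite mulN1r.
Qed.

Lemma ope_E_sum n (I : Type) (r : seq I) (P : pred I) (F : I -> seq R -> R) :
  (forall i, ucont n (F i)) ->
  ope_E n (fun s => \sum_(i <- r | P i) F i s) = \sum_(i <- r | P i) ope_E n (F i).
Proof.
move=> uF; elim: r => [|i r IH].
  by rewrite big_nil; under eq_fun do rewrite big_nil; rewrite ope_E_cst.
rewrite big_cons -IH; under eq_fun do rewrite big_cons.
by case: (P i) => //; rewrite ope_ED//; exact: ucont_sum.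
Qed.

Lemma le_ope_E n F G : ucont n F -> ucont n G -> (forall s, cube n s -> F s <= G s) ->
  ope_E n F <= ope_E n G.
Proof.
move=> uF uG FG; rewrite !ope_E_unfold ler_wpM2r ?invr_ge0//.
apply: le_ope_int; try by apply: ucontM => //; exact: ucont_vdm2.
by move=> s cs; rewrite ler_wpM2r ?FG// vdm2E sqr_ge0.
Qed.

Lemma ope_E_wick n L k : (0 < k)%N -> all (leq 1) L -> (k + sumn L <= n)%N ->
  ope_E n (powprod n (k :: L)) + (~~ odd k)%:R * ope_E n (powprod n L) =
  (k * count_mem k L)%:R * ope_E n (@powprod R n (rem k L)).
Proof.
move=> k0 L0 kL.
pose val (L : seq nat) (l : 'I_n -> int) :=
  ope_int n (fun s => powprod n L s * altU l s * @altU R n (@rho n) s).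
have E L' : ope_E n (@powprod R n L') = (val L' (@rho n)) / n`!%:R.
  rewrite ope_E_unfold vdm2E; congr (_ / _); congr ope_int; apply/funext => s.
  by rewrite -mulrA -expr2.
have uv L' (l : 'I_n -> int) : ucont n (fun s => powprod n L' s * altU l s * @altU R n (@rho n) s).
  by apply: ucontM; [apply: ucontM; [exact: ucont_powprod|exact: ucont_altU]|exact: ucont_altU].
have w : val (k :: L) (@rho n) + (~~ odd k)%:R * val L (@rho n) =
  (k * count_mem k L)%:R * val (rem k L) (@rho n).
  apply: wick_rho => //.
  - move=> L' l l' ll'; rewrite /val; congr ope_int; apply/funext => s.
    by congr (_ * altU _ _ * _); apply/funext.
  - move=> m L' l; rewrite /val -ope_int_sum// -ope_int_sum// -ope_intD; try exact: ucont_sum.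
    congr ope_int; apply/funext => s.
    rewrite /powprod big_cons -!mulr_suml -!mulr_sumr -mulrDl -mulrDr -powsum_altU.
    by congr (_ * _); ring.
  - move=> L1 L2 l pL; rewrite /val; congr ope_int; apply/funext => s.
    by rewrite /powprod (perm_big _ pL).
  - move=> L' l i j ij lij; rewrite -[RHS](mul0r (mu0_int (fun=> 1) ^+ n)) -ope_int_cst.
    by congr ope_int; apply/funext => s; rewrite (altU_rep _ ij lij) mulr0 mul0r.
  - move=> L' l i v; rewrite -[RHS]mulN1r /val -ope_intZ//; congr ope_int; apply/funext => s.
    by rewrite altU_neg; ring.
  - move=> L' l i j a b ij; rewrite -[RHS]mulN1r /val -ope_intZ//; congr ope_int; apply/funext => s.
    by rewrite altU_swap//; ring.
  - move=> l i li; rewrite -(ope_int_altU_top li) /val; congr ope_int; apply/funext => s.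
    by rewrite /powprod big_nil mul1r.
rewrite !E -[X in X + _]/(val (k :: L) (@rho n) / _) mulrA -mulrDl w.
by rewrite -[val (rem k L) _]/(val (rem k L) (@rho n)) mulrA.
Qed.

(** The bound [N] is there for the ensemble, where the recurrence is available up to a finite order
    only; the Gaussian law satisfies it at every order. At r = 0 the factor [r%:R] cancels the
    meaningless [a r.-1]. *)
Lemma moments_of_recurrence (a : nat -> R) (v : R) (N : nat) :
  a 0%N = 1 -> (forall r, (r < N)%N -> a r.+1 = r%:R * v * a r.-1) ->
  forall j, (j.*2.+1 <= N)%N ->
  a j.*2 = (j.*2)`!%:R / (2 ^+ j * j`!%:R) * v ^+ j /\ a j.*2.+1 = 0.
Proof.
move=> a0 rec; elim=> [|j IH] jN.
  by rewrite (rec 0%N)// double0 a0 fact0 !expr0 !mul0r !mulr1 divff// oner_neq0.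
have [|e o] := IH; first lia.
split; last by rewrite doubleS rec /= ?o ?mulr0//; lia.
rewrite doubleS rec /=; last lia.
rewrite e !factS !exprS !natrM -[j.*2.+2%:R]natr1.
have -> : (j.*2.+1%:R = j%:R * 2 + 1 :> R) by rewrite -natr1 -muln2 natrM.
have P0 : (2 : R) ^+ j != 0 by rewrite expf_neq0// pnatr_eq0.
have J0 : (j`!)%:R != 0 :> R by rewrite pnatr_eq0 -lt0n fact_gt0.
have x0 : j%:R + 1 != 0 :> R by rewrite natr1 pnatr_eq0.
rewrite -[j.+1%:R]natr1; move: P0 J0 x0; move: (_ ^+ j) (j`!)%:R j%:R => P J x P0 J0 x0.
field.
by rewrite P0 J0 x0.
Qed.

Section PolynomialStatistic.
Variables (n K : nat) (g : nat -> R).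

(** The added constants are minus the means: for 0 < k <= n, [ope_E_wick] without further factors
    gives [powsum n k] the mean -1 for k even and 0 for k odd. *)
Definition trigstat s : R :=
  \sum_(k < K) g k.+1 * (powsum n k.+1 s + (~~ odd k.+1)%:R).

Lemma ucont_trigstat : ucont n trigstat.
Proof.
apply: ucont_sum => k; apply: ucontZ; apply: ucontD; first exact: ucont_powsum.
exact: ucont_cst.
Qed.

Let S k s : R := powsum n k s + (~~ odd k)%:R.

Let uS k : ucont n (S k).
Proof. by apply: ucontD; [exact: ucont_powsum|exact: ucont_cst]. Qed.

(* Wick's rule is linear in the multi-index, so it becomes a Gaussian
   integration by parts for polynomials in the statistic. *)
Lemma ope_E_stein a : forall L k, (k < K)%N -> all (leq 1) L ->
  (k.+1 + a * K + sumn L <= n)%N ->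
  ope_E n (fun s => S k.+1 s * (trigstat s ^+ a * powprod n L s)) =
  a%:R * (k.+1%:R * g k.+1) * ope_E n (fun s => trigstat s ^+ a.-1 * powprod n L s) +
  (k.+1 * count_mem k.+1 L)%:R * ope_E n (fun s => trigstat s ^+ a * powprod n (rem k.+1 L) s).
Proof.
elim: a => [|a IH] L k kK L0 kL.
  rewrite !mul0r add0r.
  have -> : (fun s => trigstat s ^+ 0 * powprod n (rem k.+1 L) s) = powprod n (rem k.+1 L).
    by apply/funext => s; rewrite mul1r.
  rewrite -ope_E_wick//; last by rewrite mul0n addn0 in kL.
  rewrite -ope_EZ -?ope_ED//; try exact: ucont_powprod; last by apply: ucontZ; exact: ucont_powprod.
  congr ope_E; apply/funext => s; rewrite mul1r /S /powprod big_cons; ring.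
have uX b : ucont n (fun s => trigstat s ^+ b) by apply: ucontX; exact: ucont_trigstat.
have uXP b L' : ucont n (fun s => trigstat s ^+ b * powprod n L' s).
  by apply: ucontM => //; exact: ucont_powprod.
have uSXP j b L' : ucont n (fun s => S j s * (trigstat s ^+ b * powprod n L' s)).
  by apply: ucontM.
(* One factor of the statistic is opened and its power sums are moved into the multi-index. This is
   why the statement carries an arbitrary [L]. *)
have split b L' s : trigstat s ^+ b.+1 * powprod n L' s =
    \sum_(m < K) (g m.+1 * (trigstat s ^+ b * powprod n (m.+1 :: L') s) +
       g m.+1 * (~~ odd m.+1)%:R * (trigstat s ^+ b * powprod n L' s)).
  rewrite exprS {1}/trigstat -mulrA mulr_suml; apply: eq_bigr => m _.
  by rewrite /powprod big_cons; ring.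
have Esplit b L' : ope_E n (fun s => trigstat s ^+ b.+1 * powprod n L' s) =
    \sum_(m < K) (g m.+1 * ope_E n (fun s => trigstat s ^+ b * powprod n (m.+1 :: L') s) +
       g m.+1 * (~~ odd m.+1)%:R * ope_E n (fun s => trigstat s ^+ b * powprod n L' s)).
  under eq_fun do rewrite split.
  rewrite ope_E_sum; last by move=> m; apply: ucontD; exact: ucontZ.
  by apply: eq_bigr => m _; rewrite ope_ED ?ope_EZ//; exact: ucontZ.
have -> : ope_E n (fun s => S k.+1 s * (trigstat s ^+ a.+1 * powprod n L s)) =
    \sum_(m < K) (g m.+1 * ope_E n (fun s => S k.+1 s * (trigstat s ^+ a * powprod n (m.+1 :: L) s)) +
       g m.+1 * (~~ odd m.+1)%:R * ope_E n (fun s => S k.+1 s * (trigstat s ^+ a * powprod n L s))).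
  transitivity (ope_E n (fun s => \sum_(m < K) (g m.+1 * (S k.+1 s * (trigstat s ^+ a * powprod n (m.+1 :: L) s)) +
       g m.+1 * (~~ odd m.+1)%:R * (S k.+1 s * (trigstat s ^+ a * powprod n L s))))).
    congr ope_E; apply/funext => s; rewrite split mulr_sumr; apply: eq_bigr => m _; ring.
  rewrite ope_E_sum; last by move=> m; apply: ucontD; exact: ucontZ.
  by apply: eq_bigr => m _; rewrite ope_ED ?ope_EZ//; exact: ucontZ.
pose e b L' := ope_E n (fun s => trigstat s ^+ b * powprod n L' s).
have perm_e b L1 L2 : perm_eq L1 L2 -> e b L1 = e b L2.
  by move=> p; rewrite /e; congr ope_E; apply/funext => s; rewrite /powprod (perm_big _ p).
rewrite -/(e _ _) -/(e _ _) in Esplit *.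
(* The contraction with the power sum just opened is separated from those with [L]; summed over [m]
   it supplies the missing unit in the factor [a.+1]. *)
have cnt (m : 'I_K) : (k.+1 * count_mem k.+1 (m.+1 :: L))%:R * e a (rem k.+1 (m.+1 :: L)) =
   (m == k :> nat)%:R * k.+1%:R * e a L +
   (k.+1 * count_mem k.+1 L)%:R * e a (m.+1 :: rem k.+1 L).
  rewrite /= eqSS; have [->|mk] := eqVneq (m : nat) k; last first.
    by rewrite add0n !mul0r add0r.
  have [kL'|kL'] := boolP (k.+1 \in L).
    rewrite -(perm_e _ L (k.+1 :: rem k.+1 L)); last exact: perm_to_rem.
    by rewrite -mulrDl mulnDr muln1 natrD mul1r.
  by rewrite (count_memPn kL') !muln0 addn0 muln1 mul0r addr0 mul1r.
transitivity (\sum_(m < K) (a%:R * (k.+1%:R * g k.+1) *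
     (g m.+1 * e a.-1 (m.+1 :: L) + g m.+1 * (~~ odd m.+1)%:R * e a.-1 L) +
   (k.+1 * count_mem k.+1 L)%:R *
     (g m.+1 * e a (m.+1 :: rem k.+1 L) + g m.+1 * (~~ odd m.+1)%:R * e a (rem k.+1 L)) +
   g m.+1 * ((m == k :> nat)%:R * k.+1%:R * e a L))).
  apply: eq_bigr => m _; have mK := ltn_ord m.
  rewrite !IH//=; try by move: kL; rewrite mulSn; lia.
  rewrite -!/(e _ _) cnt; ring.
rewrite big_split big_split /= -!mulr_sumr.
have -> : \sum_(m < K) g m.+1 * ((m == k :> nat)%:R * k.+1%:R * e a L) =
    g k.+1 * (k.+1%:R * e a L).
  rewrite (bigD1 (Ordinal kK)) //= eqxx mul1r big1 ?addr0// => m mk.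
  rewrite (_ : (m == k :> nat) = false) ?mul0r ?mulr0//.
  by apply: contraNF mk => /eqP mk; apply/eqP/val_inj.
have Es b L' : \sum_(m < K) (g m.+1 * e b (m.+1 :: L') + g m.+1 * (~~ odd m.+1)%:R * e b L') = e b.+1 L'.
  by rewrite /e Esplit.
rewrite !Es -/(e a L) -/(e a.+1 _).
case: (a) Es => [|b] Es; first by rewrite /= !mul0r; ring.
by rewrite /= -[b.+2%:R]natr1; ring.
Qed.

(** [ope_E_stein] with empty [L], summed over k with weights [g k]: the factors k g_k become the
    variance, sum of k g_k^2. *)
Lemma ope_E_trigstat_rec r : (r.+1 * K <= n)%N ->
  ope_E n (fun s => trigstat s ^+ r.+1) =
  r%:R * (\sum_(k < K) k.+1%:R * g k.+1 ^+ 2) * ope_E n (fun s => trigstat s ^+ r.-1).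
Proof.
move=> rK.
have e b : ope_E n (fun s => trigstat s ^+ b) = ope_E n (fun s => trigstat s ^+ b * powprod n [::] s).
  by congr ope_E; apply/funext => s; rewrite /powprod big_nil mulr1.
transitivity (ope_E n (fun s => \sum_(k < K) g k.+1 * (S k.+1 s * (trigstat s ^+ r * powprod n [::] s)))).
  congr ope_E; apply/funext => s; rewrite exprS {1}/trigstat mulr_suml; apply: eq_bigr => k _.
  by rewrite /powprod big_nil mulr1 mulrA.
have uST j : ucont n (fun s => S j s * (trigstat s ^+ r * powprod n [::] s)).
  apply: ucontM => //; apply: ucontM; last exact: ucont_powprod.
  by apply: ucontX; exact: ucont_trigstat.
rewrite ope_E_sum; last by move=> k; exact: ucontZ.
rewrite [in RHS]e mulr_sumr mulr_suml; apply: eq_bigr => k _.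
rewrite ope_EZ// ope_E_stein//=; last first.
  by move: rK (ltn_ord k); rewrite mulSn addn0; nia.
by rewrite muln0 mul0r addr0; ring.
Qed.

Lemma ope_E_trigstat_moments j : (j.*2.+1 * K <= n)%N ->
  ope_E n (fun s => trigstat s ^+ j.*2) =
    (j.*2)`!%:R / (2 ^+ j * j`!%:R) * (\sum_(k < K) k.+1%:R * g k.+1 ^+ 2) ^+ j /\
  ope_E n (fun s => trigstat s ^+ j.*2.+1) = 0.
Proof.
move=> jK; apply: (@moments_of_recurrence (fun r => ope_E n (fun s => trigstat s ^+ r)) _ j.*2.+1) => //.
  have -> : (fun s => trigstat s ^+ 0) = (fun=> 1) by apply/funext => s; rewrite expr0.
  by rewrite ope_E_cst.
move=> r rj; apply: ope_E_trigstat_rec; apply: leq_trans jK.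
by rewrite leq_mul2r rj orbT.
Qed.

End PolynomialStatistic.

End OpeMoments.

(** * Taylor bounds for cosine and sine *)

Section TrigTaylor.
Variable R : realType.
Implicit Types (x t : R).

Fixpoint cosT (m : nat) x : R :=
  if m is i.+1 then cosT i x + (-1) ^+ i * (x ^+ i.*2 / (i.*2)`!%:R) else 0.

Fixpoint sinT (m : nat) x : R :=
  if m is i.+1 then sinT i x + (-1) ^+ i * (x ^+ i.*2.+1 / (i.*2.+1)`!%:R) else 0.

Lemma is_derive_monomial k x :
  is_derive x 1 (fun y => y ^+ k.+1 / (k.+1)`!%:R) (x ^+ k / k`!%:R).
Proof.
have f0 : (k`!)%:R != 0 :> R by rewrite pnatr_eq0 -lt0n fact_gt0.
have k0 : k%:R + 1 != 0 :> R by rewrite natr1 pnatr_eq0.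
have d : is_derive x 1 (fun y : R => y ^+ k.+1) (k.+1%:R * x ^+ k).
  apply: DeriveDef; first exact: exprn_derivable.
  by rewrite exp_derive /GRing.scale /= mulr1.
rewrite factS natrM; apply: is_derive_eq; rewrite /GRing.scale /= -natr1; field.
by rewrite f0 k0.
Qed.

Lemma is_derive_sinT m x : is_derive x 1 (sinT m) (cosT m x).
Proof.
elim: m => [|m IH]; first exact: is_derive_cst.
exact: (is_deriveD IH (is_deriveZ ((-1) ^+ m) (is_derive_monomial m.*2 x))).
Qed.

Lemma is_derive_cosT m x : is_derive x 1 (cosT m.+1) (- sinT m x).
Proof.
elim: m => [|m IH].
  have -> : cosT 1 = cst 1 by apply/funext => y; rewrite /= add0r expr0 mul1r divr1.
  by rewrite /= oppr0; exact: is_derive_cst.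
have d := is_deriveD IH (is_deriveZ ((-1) ^+ m.+1) (is_derive_monomial m.*2.+1 x)).
have -> : cosT m.+2 = (fun y => cosT m.+1 y + (-1) ^+ m.+1 * (y ^+ m.*2.+2 / (m.*2.+2)`!%:R)) by [].
have e : - sinT m x + (-1) ^+ m.+1 *: (x ^+ m.*2.+1 / (m.*2.+1)`!%:R) = - sinT m.+1 x.
  by rewrite /GRing.scale /= exprS; ring.
exact: (is_derive_eq d e).
Qed.

(** Integrates a bound once by the mean value theorem: the difference of the monomial and f, or -f,
    vanishes at 0 and has a nonnegative derivative. *)
Let step (f df : R -> R) k : (forall x, is_derive x 1 f (df x)) -> f 0 = 0 ->
  (forall x, 0 <= x -> `|df x| <= x ^+ k / k`!%:R) ->
  forall x, 0 <= x -> `|f x| <= x ^+ k.+1 / (k.+1)`!%:R.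
Proof.
move=> d f0 b x x0.
have key (g dg : R -> R) : (forall x, is_derive x 1 g (dg x)) -> g 0 = 0 ->
    (forall x, 0 <= x -> dg x <= x ^+ k / k`!%:R) -> g x <= x ^+ k.+1 / (k.+1)`!%:R.
  move=> dG g0 bg.
  pose h y := y ^+ k.+1 / (k.+1)`!%:R - g y.
  have dh (y : R) : is_derive y 1 h (y ^+ k / k`!%:R - dg y).
    exact: (is_deriveB (is_derive_monomial k y) (dG y)).
  have ch : {within `[0, x], continuous h}.
    apply: continuous_subspaceT => y.
    by apply: differentiable_continuous; apply/derivable1_diffP; exact: ex_derive.
  have [c] := MVT_segment x0 (fun y _ => dh y) ch.
  rewrite in_itv /= => /andP[c0 _]; rewrite /h g0 expr0n /= mul0r !subr0 => e.
  by rewrite -subr_ge0 e mulr_ge0// subr_ge0 bg.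
rewrite ler_norml; apply/andP; split; last first.
  by apply: (key f df) => // y y0; apply: le_trans (b y y0); exact: ler_norm.
rewrite lerNl; apply: (key (fun y => - f y) (fun y => - df y)).
- by rewrite f0 oppr0.
- by move=> y y0; apply: le_trans (b y y0); rewrite -normrN; exact: ler_norm.
Qed.

Lemma cosT0 m : cosT m.+1 0 = 1.
Proof.
elim: m => [|m IH]; first by rewrite /= add0r mul1r divr1.
by rewrite [cosT _ _]/= -/(cosT m.+1 0) IH doubleS expr0n /= mul0r mulr0 addr0.
Qed.

Lemma sinT0 m : sinT m 0 = 0.
Proof.
elim: m => [|m IH] //=; by rewrite IH expr0n /= mul0r mulr0 addr0.
Qed.

Let dcos m x : is_derive x 1 (fun y => cos y - cosT m.+1 y) (- (sin x - sinT m x)).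
Proof.
have d := is_derive_cosT m x; apply: is_derive_eq; ring.
Qed.

Let dsin m x : is_derive x 1 (fun y => sin y - sinT m y) (cos x - cosT m x).
Proof. have d := is_derive_sinT m x; exact: is_derive_eq. Qed.

Let cos0T m : cos 0 - cosT m.+1 0 = 0 :> R. Proof. by rewrite cos0 cosT0 subrr. Qed.
Let sin0T m : sin 0 - sinT m 0 = 0 :> R. Proof. by rewrite sin0 sinT0 subrr. Qed.

(** Each induction step integrates twice, through the sine and back to the cosine, which accounts
    for the exponent growing by 2. *)
Let cos_pos m x : 0 <= x -> `|cos x - cosT m x| <= x ^+ m.*2 / (m.*2)`!%:R.
Proof.
elim: m x => [|m IH] x x0.
  rewrite /= subr0 expr0 divr1 ler_norml cos_geN1 cos_le1//.
rewrite doubleS; apply: (step (dcos m) (cos0T m)) x0 => y y0; rewrite normrN.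
by apply: (step (dsin m) (sin0T m)) y0; exact: IH.
Qed.

Let sin_pos m x : 0 <= x -> `|sin x - sinT m x| <= x ^+ m.*2 / (m.*2)`!%:R.
Proof.
elim: m x => [|m IH] x x0.
  rewrite /= subr0 expr0 divr1 ler_norml sin_geN1 sin_le1//.
rewrite doubleS; apply: (step (dsin m.+1) (sin0T m.+1)) x0 => y y0.
by apply: (step (dcos m) (cos0T m)) y0 => z z0; rewrite normrN; exact: IH.
Qed.

Lemma exprN_double m x : (- x) ^+ m.*2 = x ^+ m.*2.
Proof. by rewrite -mul2n !exprM sqrrN. Qed.

Lemma cosTN m x : cosT m (- x) = cosT m x.
Proof. by elim: m => //= m ->; rewrite exprN_double. Qed.

Lemma sinTN m x : sinT m (- x) = - sinT m x.
Proof.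
elim: m => [|m IH] /=; first by rewrite oppr0.
by rewrite IH !exprS exprN_double; ring.
Qed.

Lemma cos_cosT m x : `|cos x - cosT m x| <= x ^+ m.*2 / (m.*2)`!%:R.
Proof.
have [x0|x0] := leP 0 x; first exact: cos_pos.
have := @cos_pos m (- x); rewrite cosN cosTN oppr_ge0 ltW// => /(_ isT).
by rewrite exprN_double.
Qed.

(** The even power, rather than the next odd one, keeps the bound nonnegative for both signs of x
    and makes its mean an even moment. *)
Lemma sin_sinT m x : `|sin x - sinT m x| <= x ^+ m.*2 / (m.*2)`!%:R.
Proof.
have [x0|x0] := leP 0 x; first exact: sin_pos.
have := @sin_pos m (- x); rewrite sinN sinTN oppr_ge0 ltW// => /(_ isT).
by rewrite -opprD normrN exprN_double.
Qed.

End TrigTaylor.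

(** * Characteristic functions from finitely many moments *)

(** Linear, monotone, normalized functionals on a domain [D]. The same argument then serves the
    ensemble, the Gaussian law and the Dirac mass. *)
Record positive_mean (R : realType) (T : Type) (D : (T -> R) -> Prop)
    (E : (T -> R) -> R) : Prop := PositiveMean {
  mean_dom_cst : forall a, D (fun=> a);
  mean_cst : forall a, E (fun=> a) = a;
  mean_dom_lin : forall a F G, D F -> D G -> D (fun s => a * F s + G s);
  mean_lin : forall a F G, D F -> D G -> E (fun s => a * F s + G s) = a * E F + E G;
  mean_le : forall F G, D F -> D G -> (forall s, F s <= G s) -> E F <= E G }.

Section Mean.
Variables (R : realType) (T : Type) (D : (T -> R) -> Prop) (E : (T -> R) -> R).
Hypothesis pm : positive_mean D E.

Lemma mean_domD F G : D F -> D G -> D (fun s => F s + G s).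
Proof.
move=> dF dG; have := mean_dom_lin pm 1 dF dG; congr D.
by apply/funext => s; rewrite mul1r.
Qed.

Lemma meanD F G : D F -> D G -> E (fun s => F s + G s) = E F + E G.
Proof.
move=> dF dG; have := mean_lin pm 1 dF dG; rewrite mul1r => <-.
by congr E; apply/funext => s; rewrite mul1r.
Qed.

Lemma mean_domZ a F : D F -> D (fun s => a * F s).
Proof.
move=> dF; have := mean_dom_lin pm a dF (mean_dom_cst pm 0); congr D.
by apply/funext => s; rewrite addr0.
Qed.

Lemma meanZ a F : D F -> E (fun s => a * F s) = a * E F.
Proof.
move=> dF; have := mean_lin pm a dF (mean_dom_cst pm 0).
rewrite (mean_cst pm) addr0 => <-.
by congr E; apply/funext => s; rewrite addr0.
Qed.

Lemma mean_domB F G : D F -> D G -> D (fun s => F s - G s).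
Proof.
move=> dF dG; have := mean_domD dF (mean_domZ (-1) dG); congr D.
by apply/funext => s; rewrite mulN1r.
Qed.

Lemma meanB F G : D F -> D G -> E (fun s => F s - G s) = E F - E G.
Proof.
move=> dF dG; have := meanD dF (mean_domZ (-1) dG); rewrite meanZ// mulN1r => <-.
by congr E; apply/funext => s; rewrite mulN1r.
Qed.

Lemma mean_norm F G : D F -> D G -> (forall s, `|F s| <= G s) -> `|E F| <= E G.
Proof.
move=> dF dG FG; rewrite ler_norml; apply/andP; split; last first.
  by apply: (mean_le pm) => // s; apply: le_trans (FG s); exact: ler_norm.
rewrite lerNl -mulN1r -meanZ//; apply: (mean_le pm) => //; first exact: mean_domZ.
by move=> s; apply: le_trans (FG s); rewrite mulN1r -normrN; exact: ler_norm.
Qed.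

Variables (X : T -> R) (v : R) (m : nat).
Hypothesis dX : forall j, D (fun s => X s ^+ j).
Hypothesis even_moment : forall j, (j <= m)%N ->
  E (fun s => X s ^+ j.*2) = (j.*2)`!%:R / (2 ^+ j * j`!%:R) * v ^+ j.
Hypothesis odd_moment : forall j, (j < m)%N -> E (fun s => X s ^+ j.*2.+1) = 0.

Let fact_neq0 j : (j`!)%:R != 0 :> R.
Proof. by rewrite pnatr_eq0 -lt0n fact_gt0. Qed.

Let mean_even_term t j : (j <= m)%N ->
  D (fun s => (t * X s) ^+ j.*2 / (j.*2)`!%:R) /\
  E (fun s => (t * X s) ^+ j.*2 / (j.*2)`!%:R) = exp_coeff (t ^+ 2 * v / 2) j.
Proof.
move=> jm.
have -> : (fun s => (t * X s) ^+ j.*2 / (j.*2)`!%:R) =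
    (fun s => t ^+ j.*2 / (j.*2)`!%:R * X s ^+ j.*2).
  by apply/funext => s; rewrite exprMn; ring.
split; first exact: mean_domZ.
rewrite meanZ// even_moment// exp_coeffE /= !exprMn.
rewrite -exprD addnn exprVn.
have P0 : (2 : R) ^+ j != 0 by rewrite expf_neq0// pnatr_eq0.
move: (fact_neq0 j) (fact_neq0 j.*2) P0 => f1 f2 P0; field.
by rewrite f1 f2 P0.
Qed.

(** The even moments turn the Taylor terms of the cosine into the terms of exp(- t^2 v / 2). The
    remainder is bounded by the next even term, whose mean is the corresponding term for + t^2 v /
    2. *)
Lemma mean_cos t : D (fun s => cos (t * X s)) ->
  `|E (fun s => cos (t * X s)) - series (exp_coeff (- (t ^+ 2 * v / 2))) m| <=
  exp_coeff (t ^+ 2 * v / 2) m.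
Proof.
move=> dc.
have [dT eT] : D (fun s => cosT m (t * X s)) /\
    E (fun s => cosT m (t * X s)) = series (exp_coeff (- (t ^+ 2 * v / 2))) m.
  have : (m <= m)%N by [].
  elim: {1 3 4 5}m => [|k IH] km.
    split; first exact: (mean_dom_cst pm).
    by rewrite /series /= big_geq// (mean_cst pm).
  have [d1 e1] := IH (ltnW km); have [d2 e2] := mean_even_term t (ltnW km).
  split => /=; first exact: mean_domD (mean_domZ _ d2).
  rewrite meanD// ?meanZ//; last exact: mean_domZ.
  rewrite e1 e2 /series /= big_nat_recr//=; congr (_ + _).
  by rewrite !exp_coeffE /= [in RHS]exprNn; ring.
have [d1 e1] := mean_even_term t (leqnn m).
rewrite -eT -meanB// -e1; apply: mean_norm => //; first exact: mean_domB.
by move=> s; exact: cos_cosT.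
Qed.

Lemma mean_sin t : D (fun s => sin (t * X s)) ->
  `|E (fun s => sin (t * X s))| <= exp_coeff (t ^+ 2 * v / 2) m.
Proof.
move=> dc.
have [dT eT] : D (fun s => sinT m (t * X s)) /\ E (fun s => sinT m (t * X s)) = 0.
  have : (m <= m)%N by [].
  elim: {1 3 4}m => [|k IH] km.
    split; first exact: (mean_dom_cst pm).
    exact: (mean_cst pm).
  have [d1 e1] := IH (ltnW km).
  have E2 : (fun s => (-1) ^+ k * ((t * X s) ^+ k.*2.+1 / (k.*2.+1)`!%:R)) =
      (fun s => (-1) ^+ k * t ^+ k.*2.+1 / (k.*2.+1)`!%:R * X s ^+ k.*2.+1).
    by apply/funext => s; rewrite exprMn; ring.
  have d2 : D (fun s => (-1) ^+ k * ((t * X s) ^+ k.*2.+1 / (k.*2.+1)`!%:R)).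
    by rewrite E2; exact: mean_domZ.
  have e2 : E (fun s => (-1) ^+ k * ((t * X s) ^+ k.*2.+1 / (k.*2.+1)`!%:R)) = 0.
    by rewrite E2 meanZ// odd_moment// mulr0.
  split => /=; first exact: mean_domD d2.
  by rewrite meanD// e1 e2 addr0.
have [d1 e1] := mean_even_term t (leqnn m).
rewrite -[E _]subr0 -[X in _ - X]eT -meanB// -e1; apply: mean_norm => //; first exact: mean_domB.
by move=> s; exact: sin_sinT.
Qed.

End Mean.

(** * Weighted approximation by trigonometric polynomials *)

Section TrigApproximation.
Variable R : realType.
Implicit Types (f g : R -> R) (w x t : R).

Inductive trigpoly : (R -> R) -> Prop :=
| trigpoly_cos t : trigpoly (fun x => cos (t * x))
| trigpoly_sin t : trigpoly (fun x => sin (t * x))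
| trigpolyD f g : trigpoly f -> trigpoly g -> trigpoly (fun x => f x + g x)
| trigpolyZ a f : trigpoly f -> trigpoly (fun x => a * f x).

Lemma eq_trigpoly f g : f =1 g -> trigpoly f -> trigpoly g.
Proof. by move=> /funext ->. Qed.

Lemma trigpoly_cst (a : R) : trigpoly (fun=> a).
Proof.
apply: eq_trigpoly (trigpolyZ a (trigpoly_cos 0)) => x.
by rewrite mul0r cos0 mulr1.
Qed.

(** Product-to-sum formulas. With w = (1 + sin(t x)) / 2, this is the only product that the
    recursion defining [bernstein] requires. *)
Lemma trigpolyM_sin t f : trigpoly f -> trigpoly (fun x => sin (t * x) * f x).
Proof.
elim=> [u|u|g h _ ig _ ih|a g _ ig].
- apply: eq_trigpoly (trigpolyZ 2^-1 (trigpolyD (trigpoly_sin (t + u)) (trigpoly_sin (t - u)))) => x.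
  by rewrite [(t + u) * x]mulrDl [(t - u) * x]mulrBl sinD sinB; field.
- apply: eq_trigpoly (trigpolyZ 2^-1 (trigpolyD (trigpoly_cos (t - u)) (trigpolyZ (-1) (trigpoly_cos (t + u))))) => x.
  by rewrite [(t + u) * x]mulrDl [(t - u) * x]mulrBl cosB cosD; field.
- by apply: eq_trigpoly (trigpolyD ig ih) => x; rewrite mulrDr.
- by apply: eq_trigpoly (trigpolyZ a ig) => x; rewrite mulrCA.
Qed.

Lemma trigpoly_continuous f : trigpoly f -> continuous f.
Proof.
have ct (t : R) : continuous (fun x => t * x).
  by move=> x; apply: cvgM; [exact: cvg_cst|exact: cvg_id].
elim=> [u|u|g h _ ig _ ih|a g _ ig] x.
- by apply: (continuous_comp (f := fun x => u * x)); [exact: ct|exact: continuous_cos].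
- by apply: (continuous_comp (f := fun x => u * x)); [exact: ct|exact: continuous_sin].
- by apply: cvgD; [exact: ig|exact: ih].
- by apply: cvgM; [exact: cvg_cst|exact: ig].
Qed.

Lemma trigpoly_bounded f : trigpoly f -> exists M, forall x, `|f x| <= M.
Proof.
elim=> [u|u|g h _ [M hM] _ [M' hM']|a g _ [M hM]].
- by exists 1 => x; rewrite ler_norml cos_geN1 cos_le1.
- by exists 1 => x; rewrite ler_norml sin_geN1 sin_le1.
- by exists (M + M') => x; apply: (le_trans (ler_normD _ _)); rewrite lerD.
- by exists (`|a| * M) => x; rewrite normrM ler_wpM2l.
Qed.

(* The mean of [phi] under the binomial law with parameters [n] and [w]. *)
Fixpoint bernstein (n : nat) (phi : nat -> R) w : R :=
  if n is k.+1 then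
    w * bernstein k (fun i => phi i.+1) w + (1 - w) * bernstein k phi w
  else phi 0%N.

Lemma bernstein_lin n a phi psi w : bernstein n (fun i => a * phi i + psi i) w =
  a * bernstein n phi w + bernstein n psi w.
Proof. by elim: n phi psi => //= n IH phi psi; rewrite !IH; ring. Qed.

Lemma bernstein_le n phi psi w : 0 <= w <= 1 -> (forall i, phi i <= psi i) ->
  bernstein n phi w <= bernstein n psi w.
Proof.
move=> /andP[w0 w1]; elim: n phi psi => //= n IH phi psi pp.
by apply: lerD; apply: ler_wpM2l; rewrite ?subr_ge0// IH.
Qed.

Lemma bernstein_cst n a w : bernstein n (fun=> a) w = a.
Proof. by elim: n => //= n ->; ring. Qed.

(** Variance plus squared bias of the binomial law; conditioning on one trial moves b to b - 1. *)
Lemma bernstein_quad n b w :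
  bernstein n (fun i => (i%:R - b) ^+ 2) w = n%:R * w * (1 - w) + (n%:R * w - b) ^+ 2.
Proof.
elim: n b => [|n IH] b /=; first by ring.
have -> : (fun i => (i.+1%:R - b) ^+ 2) = (fun i => (i%:R - (b - 1)) ^+ 2).
  by apply/funext => i; rewrite -natr1; ring.
by rewrite !IH -natr1; ring.
Qed.

Lemma bernstein_trigpoly n phi t : trigpoly (fun x => bernstein n phi ((1 + sin (t * x)) / 2)).
Proof.
elim: n phi => [|n IH] phi /=; first exact: trigpoly_cst.
set p := fun i => phi i.+1.
apply: eq_trigpoly (trigpolyZ 2^-1 (trigpolyD (trigpolyD (IH p) (trigpolyM_sin t (IH p)))
  (trigpolyD (IH phi) (trigpolyZ (-1) (trigpolyM_sin t (IH phi)))))) => x.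
by field.
Qed.

Lemma bernstein_approx (h : R -> R) (M e : R) : continuous h -> (forall x, `|h x| <= M) ->
  0 < e -> exists n, forall w, 0 <= w <= 1 -> `|bernstein n (fun i => h (i%:R / n%:R)) w - h w| <= e.
Proof.
move=> ch hM e0.
have e2 : 0 < e / 2 by lra.
have [d d0 hd] := heine 1 ch e2.
have M0 : 0 <= M by apply: le_trans (hM 0); exact: normr_ge0.
(* Chebyshev's inequality bounds the far part by 2 M w (1 - w) / (n d^2); since w (1 - w) <= 1, this
   is at most e / 2 once n >= 4 M / (e d^2). *)
have q0 : 0 <= 4 * M / (e * d ^+ 2).
  by apply: divr_ge0; [lra|rewrite mulr_ge0// ltW// exprn_gt0].
have [k] : exists k : nat, 4 * M / (e * d ^+ 2) < k.+1%:R.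
  exists (Num.truncn (4 * M / (e * d ^+ 2))).
  by have /andP[] := truncn_itv q0.
set n := k.+1 => hn; exists n => w w01; have /andP[w0 w1] := w01.
have n0 : 0 < n%:R :> R by rewrite ltr0n.
(* Dominates the deviation of h in both cases: by e / 2 if i / n is within d of w, and otherwise by
   2 M times a square that is at least 1. *)
pose b i := e / 2 + 2 * M / (n%:R * d) ^+ 2 * (i%:R - n%:R * w) ^+ 2.
have hb i : `|h (i%:R / n%:R) - h w| <= b i.
  have c0 : 0 <= 2 * M / (n%:R * d) ^+ 2 by apply: divr_ge0; [lra|exact: sqr_ge0].
  have [dl|dl] := leP `|w - i%:R / n%:R| d.
    rewrite distrC; apply: (@le_trans _ _ (e / 2)); last by rewrite lerDl mulr_ge0// sqr_ge0.
    by apply: hd => //; rewrite ger0_norm.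
  apply: (@le_trans _ _ (2 * M)).
    by apply: (le_trans (ler_normB _ _)); have := hM (i%:R / n%:R); have := hM w; lra.
  rewrite /b; have : 2 * M <= 2 * M / (n%:R * d) ^+ 2 * (i%:R - n%:R * w) ^+ 2; last by lra.
  rewrite -mulrA ler_peMr//; first lra.
  rewrite mulrC ler_pdivlMr ?mul1r; last by rewrite exprn_gt0// mulr_gt0.
  rewrite -(real_normK (num_real (i%:R - _))) ler_pXn2r ?nnegrE ?mulr_ge0//; try exact: ltW.
  have -> : i%:R - n%:R * w = - (n%:R * (w - i%:R / n%:R)) by field; rewrite gt_eqF.
  by rewrite normrN normrM ger0_norm ?ler_pM2l// ltW.
have lin (phi : nat -> R) : bernstein n (fun i => phi i - h w) w = bernstein n phi w - h w.
  have := bernstein_lin n (-1) (fun=> h w) phi w.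
  rewrite bernstein_cst mulN1r addrC => <-.
  congr bernstein; apply/funext => i; ring.
rewrite -lin.
have up : bernstein n b w <= e.
  rewrite /b (_ : (fun i => _) = (fun i => 2 * M / (n%:R * d) ^+ 2 * (i%:R - n%:R * w) ^+ 2 + e / 2)).
    rewrite (bernstein_lin n _ (fun i => (i%:R - n%:R * w) ^+ 2) (fun=> e / 2)).
    rewrite bernstein_cst bernstein_quad subrr expr0n /= addr0.
    have : 2 * M / (n%:R * d) ^+ 2 * (n%:R * w * (1 - w)) <= e / 2; last by lra.
    have d20 : 0 < d ^+ 2 by exact: exprn_gt0.
    have hn' : 4 * M <= n%:R * (e * d ^+ 2).
      by rewrite -ler_pdivrMr ?mulr_gt0//; exact: ltW.
    rewrite mulrAC ler_pdivrMr; last by rewrite exprn_gt0// mulr_gt0.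
    have ww : w * (1 - w) <= 1 by nra.
    have ww0 : 0 <= w * (1 - w) by nra.
    have -> : e / 2 * (n%:R * d) ^+ 2 = n%:R * (n%:R * (e * d ^+ 2)) / 2 by field.
    have -> : 2 * M * (n%:R * w * (1 - w)) = n%:R * (4 * M * (w * (1 - w))) / 2 by field.
    rewrite ler_pM2r ?invr_gt0// ler_pM2l//.
    by apply: le_trans hn'; rewrite ler_piMr//; lra.
  by apply/funext => i; rewrite addrC.
rewrite ler_norml; apply/andP; split; last first.
  apply: le_trans up; apply: bernstein_le => // i.
  by apply: le_trans (hb i); exact: ler_norm.
rewrite lerNl; apply: le_trans up.
have -> : - bernstein n (fun i => h (i%:R / n%:R) - h w) w =
  bernstein n (fun i => - (h (i%:R / n%:R) - h w)) w.
  have := bernstein_lin n (-1) (fun i => h (i%:R / n%:R) - h w) (fun=> 0) w.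
  rewrite bernstein_cst addr0 mulN1r => <-.
  by congr bernstein; apply/funext => i; ring.
apply: bernstein_le => // i; apply: le_trans (hb i); rewrite -normrN; exact: ler_norm.
Qed.

(* [g] is written as a continuous function of [sin (t * x)] for [|x| <= L], and
   Bernstein's polynomials are applied to that function; outside this range the
   error is absorbed by the factor [1 + x ^+ 2]. *)
Lemma trigpoly_approx g (M e : R) : continuous g -> (forall x, `|g x| <= M) -> 0 < e ->
  exists2 p, trigpoly p & forall x, `|g x - p x| <= e * (1 + x ^+ 2).
Proof.
move=> cg gM e0.
have M0 : 0 <= M by apply: le_trans (gM 0); exact: normr_ge0.
(* Chosen so that 2 M = e (L - 1): beyond [L] the crude error 2 M lies below e (1 + x^2). The scale
   [t] then keeps t x within [-1/2, 1/2], where the sine can be inverted. *)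
pose L := 2 * M / e + 1.
have L1 : 1 <= L by rewrite /L lerDr divr_ge0//; lra.
have L0 : 0 < L by lra.
pose t : R := (2 * L)^-1.
have t0 : 0 < t by rewrite invr_gt0; lra.
pose c : R := sin 2^-1.
have pi1 := @pihalf_ge1 R.
have half_itv : (2^-1 : R) \in `[(- (pi / 2)), pi / 2] by rewrite in_itv /=; lra.
have Nhalf_itv : - (2^-1 : R) \in `[(- (pi / 2)), pi / 2] by rewrite in_itv /=; lra.
have pih_itv : (pi / 2 : R) \in `[(- (pi / 2)), pi / 2] by rewrite in_itv /=; lra.
have c1 : c < 1 by rewrite -sin_pihalf ltr_sin//; lra.
have c0 : 0 < c by apply: sin_gt0_pihalf; lra.
(* Cuts at sin(1/2) < 1, so that [asin] is only evaluated inside (-1, 1), where it is continuous;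
   the cut is invisible for |x| <= L. *)
pose clip (y : R) := Num.max (- c) (Num.min c y).
have clipb y : -1 < clip y < 1.
  by rewrite /clip lt_max gt_max gt_min; lra.
have cclip : continuous clip.
  apply: (@max_fun_continuous _ _ _ (cst (- c)) (cst c \min id)); first exact: cst_continuous.
  by apply: min_fun_continuous; [exact: cst_continuous|move=> y; exact: cvg_id].
pose h w := g (2 * L * asin (clip (2 * w - 1))).
have ch : continuous h.
  move=> w; apply: (continuous_comp (f := fun w => 2 * L * asin (clip (2 * w - 1)))); last exact: cg.
  apply: cvgM; first exact: cvg_cst.
  apply: (continuous_comp (f := fun w => clip (2 * w - 1))); last exact: continuous_asin.
  apply: (continuous_comp (f := fun w => 2 * w - 1)); last exact: cclip.
  by apply: cvgB; [apply: cvgM; [exact: cvg_cst|exact: cvg_id]|exact: cvg_cst].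
have [n hn] := bernstein_approx ch (fun w => gM _) e0.
exists (fun x => bernstein n (fun i => h (i%:R / n%:R)) ((1 + sin (t * x)) / 2)).
  exact: bernstein_trigpoly.
move=> x; set w := (1 + _) / 2.
have w01 : 0 <= w <= 1.
  by have := sin_geN1 (t * x); have := sin_le1 (t * x); rewrite /w; lra.
have [xL|xL] := leP `|x| L.
  have tx : - 2^-1 <= t * x <= 2^-1.
    rewrite -ler_norml normrM (gtr0_norm t0) /t mulrC ler_pdivrMr; lra.
  have tx_itv : t * x \in `[(- (pi / 2)), pi / 2] by rewrite in_itv /=; lra.
  have -> : g x = h w.
    rewrite /h /w (_ : 2 * ((1 + sin (t * x)) / 2) - 1 = sin (t * x)); last by field.
    have s1 : sin (t * x) <= c by rewrite leNgt ltr_sin// -leNgt; lra.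
    have s2 : - c <= sin (t * x) by rewrite -sinN leNgt ltr_sin// -leNgt; lra.
    rewrite /clip (min_idPr s1) (max_idPr s2) sinK// /t; congr g; field; lra.
  rewrite distrC; apply: (le_trans (hn w w01)).
  by rewrite ler_peMr ?lerDl ?sqr_ge0//; exact: ltW.
have hb : `|bernstein n (fun i => h (i%:R / n%:R)) w| <= M.
  rewrite ler_norml -[X in X <= _ <= _](bernstein_cst n _ w).
  rewrite -[X in _ <= _ <= X](bernstein_cst n _ w); apply/andP; split.
    by apply: bernstein_le => // i; have := gM (2 * L * asin (clip (2 * (i%:R / n%:R) - 1))); rewrite ler_norml => /andP[].
  by apply: bernstein_le => // i; have := gM (2 * L * asin (clip (2 * (i%:R / n%:R) - 1))); rewrite ler_norml => /andP[].
apply: (@le_trans _ _ (2 * M)).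
  by apply: (le_trans (ler_normB _ _)); have := gM x; lra.
have x2 : L <= x ^+ 2.
  rewrite -(real_normK (num_real x)) expr2; apply: (le_trans (ltW xL)).
  by rewrite ler_peMr//; apply: ltW; apply: le_lt_trans xL.
have -> : 2 * M = e * (L - 1) by rewrite /L addrK mulrCA divff ?mulr1// gt_eqF.
by rewrite ler_pM2l//; lra.
Qed.

End TrigApproximation.

(** * The fundamental theorem of calculus on the whole line *)

Section FundamentalTheoremLine.
Variable R : realType.
Notation mu := (@lebesgue_measure R).

Lemma is_derive_continuous (F f : R -> R) :
  (forall x : R, is_derive x 1 F (f x)) -> continuous F.
Proof.
by move=> dF x; apply: differentiable_continuous; apply/derivable1_diffP; exact: ex_derive.
Qed.

(** Dominated convergence over the intervals [-n, n], with |f| as the dominating function; limits of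
    the primitive along integers are then enough. *)
Lemma integral_line_FTC (f F : R -> R) (l l' : R) :
  continuous f -> (forall x : R, is_derive x 1 F (f x)) ->
  mu.-integrable setT (EFin \o f) ->
  F n%:R @[n --> \oo] --> l -> F (- n%:R) @[n --> \oo] --> l' ->
  Rintegral mu setT f = l - l'.
Proof.
move=> cf dF intf Fl Fl'.
have cF := is_derive_continuous dF.
pose I (n : nat) : set R := `[- n%:R, n%:R]%classic.
pose g (n : nat) (x : R) : \bar R := ((EFin \o f) \_ (I n)) x.
have mI n : measurable (I n) by exact: measurable_itv.
have ig n : mu.-integrable setT (g n).
  apply: (integrable_mkcond _ _).1; first exact: measurable_itv.
  apply: integrableS intf => //; exact: measurable_itv.
have dc : (\int[mu]_x g n x)%E @[n --> \oo] --> (\int[mu]_x (f x)%:E)%E.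
  apply: (@dominated_cvg _ _ R mu setT measurableT g (EFin \o f) (abse \o (EFin \o f))).
  - move=> n; exact: measurable_int (ig n).
  - move=> x _; apply: cvg_near_cst.
    exists (Num.truncn `|x|).+1 => // n /= hn.
    rewrite /g /patch mem_set// /I /= in_itv /= -ler_norml.
    have : `|x| < (Num.truncn `|x|).+1%:R by have /andP[] := truncn_itv (normr_ge0 x).
    by move=> /ltW /le_trans; apply; rewrite ler_nat.
  - by move=> x _.
  - exact: integrable_abse.
  - move=> n x _; rewrite /g /patch; case: ifP => // _.
    by rewrite (_ : point = 0%E) ?abse0 //=; exact: abse_ge0.
have gE n : (0 < n)%N -> (\int[mu]_x g n x = (F n%:R - F (- n%:R))%:E)%E.
  move=> n0; have nn : - n%:R < n%:R :> R by rewrite gtrN ?ltr0n.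
  rewrite /g -integral_mkcond /I (@continuous_FTC2 R f F)//.
  - exact: continuous_subspaceT.
  - split; first by move=> x _; exact: ex_derive.
    + by apply: cvg_at_right_filter; exact: cF.
    + by apply: cvg_at_left_filter; exact: cF.
  - by move=> x _; rewrite derive1E derive_val.
have dc' : (\int[mu]_x g n x)%E @[n --> \oo] --> (l - l')%:E.
  apply: (@cvg_trans _ ((F n%:R - F (- n%:R))%:E @[n --> \oo])).
    apply: near_eq_cvg; exists 1%N => // n /= n1; rewrite gE//.
  by apply: cvg_EFin; [exact: nearW|exact: cvgB].
rewrite /Rintegral.
have -> : (\int[mu]_x (f x)%:E = (l - l')%:E)%E.
  exact: (cvg_unique (@ereal_hausdorff R) dc dc').
by [].
Qed.

End FundamentalTheoremLine.

(** * Moments and Fourier transform of the normal law *)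

Section GaussianMean.
Variables (R : realType) (s : R).
Hypothesis s0 : 0 < s.
Notation mu := (@lebesgue_measure R).
Local Notation phi := (normal_pdf 0 s).
Local Notation phi2 := (normal_pdf 0 (2 * s)).

Let pdfE (r : R) : 0 < r -> forall x, normal_pdf 0 r x = normal_peak r * expR (- (x ^+ 2 / (2 * r ^+ 2))).
Proof.
move=> r0 x; rewrite normal_pdfE ?gt_eqF// /normal_fun subr0.
by congr (_ * expR _); rewrite mulNr -mulr_natl.
Qed.

Let s20 : 0 < 2 * s. Proof. by rewrite mulr_gt0. Qed.

(** A power is absorbed by passing to the density of twice the standard deviation. The quotient of
    the two exponentials is exp(c x^2), with c = 1/(2 s^2) - 1/(8 s^2). *)
Let pow_phi_bound k : exists2 C, 0 <= C & forall x, `|x| ^+ k * phi x <= C * phi2 x.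
Proof.
pose c := 3 / (8 * s ^+ 2).
have ss : 0 < s ^+ 2 by exact: exprn_gt0.
have c0 : 0 < c by rewrite divr_gt0// mulr_gt0.
have ck : 0 < c ^+ k by exact: exprn_gt0.
have p1 : 0 < normal_peak s by rewrite normal_peak_gt0// gt_eqF.
have p2 : 0 < normal_peak (2 * s) by rewrite normal_peak_gt0// gt_eqF.
have C0 : 0 <= 1 + k`!%:R / c ^+ k by rewrite addr_ge0// divr_ge0// ltW.
exists ((1 + k`!%:R / c ^+ k) * (normal_peak s / normal_peak (2 * s))).
  by rewrite mulr_ge0// divr_ge0// ltW.
move=> x; rewrite !pdfE//.
set e1 := expR (- (x ^+ 2 / (2 * s ^+ 2))).
have e12 : expR (c * x ^+ 2) * e1 = expR (- (x ^+ 2 / (2 * (2 * s) ^+ 2))).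
  by rewrite /e1 -expRD; congr expR; rewrite /c; field; rewrite gt_eqF.
rewrite -e12.
have x20 : 0 <= c * x ^+ 2 by rewrite mulr_ge0 ?sqr_ge0// ltW.
have b1 : 1 <= expR (c * x ^+ 2) by rewrite -expR0 ler_expR.
have b2 : x ^+ k.*2 <= k`!%:R / c ^+ k * expR (c * x ^+ 2).
  rewrite mulrAC ler_pdivlMr// mulrC -mul2n exprM -exprMn.
  case: (k) => [|j]; first by rewrite expr0 fact0 mul1r.
  have := expR_ge1Dxn j x20 => h.
  rewrite [leRHS]mulrC -ler_pdivrMr ?ltr0n ?fact_gt0//.
  by apply: le_trans h; rewrite lerDr.
have b3 : `|x| ^+ k <= 1 + x ^+ k.*2.
  have h0 : 0 <= `|x| ^+ k by exact: exprn_ge0.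
  have -> : x ^+ k.*2 = (`|x| ^+ k) ^+ 2.
    by rewrite -exprM muln2 -mul2n !exprM real_normK// num_real.
  by nra.
have key : `|x| ^+ k <= (1 + k`!%:R / c ^+ k) * expR (c * x ^+ 2).
  by apply: (le_trans b3); rewrite mulrDl mul1r lerD.
rewrite [leRHS](_ : _ = ((1 + k`!%:R / c ^+ k) * expR (c * x ^+ 2)) * (normal_peak s * e1)).
  by rewrite ler_wpM2r// mulr_ge0 ?expR_ge0// ltW.
by field; rewrite !gt_eqF.
Qed.

(** Continuous functions of polynomial growth: wide enough for both the monomials and the bounded
    test functions. *)
Let dom (F : R -> R) : Prop := continuous F /\ exists k C, forall x, `|F x| <= C * (1 + `|x| ^+ k).

Let dom_integrable F : dom F -> mu.-integrable setT (EFin \o (fun x => F x * phi x)).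
Proof.
move=> [cF [k [C FC]]].
have [C1 C10 h1] := pow_phi_bound k.
have [C2 C20 h2] := pow_phi_bound 0.
have ib : mu.-integrable setT (EFin \o (fun x => (`|C| * (C2 + C1)) * phi2 x)).
  have := integrableZl measurableT (`|C| * (C2 + C1)) (integrable_normal_pdf 0 (2 * s)).
  by apply: eq_integrable.
apply: le_integrable ib => //.
  apply/measurable_EFinP; apply: continuous_measurable_fun => x.
  apply: cvgM; first exact: cF.
  by apply: continuous_normal_pdf; rewrite gt_eqF.
move=> x _ /=; rewrite lee_fin normrM (ger0_norm (normal_pdf_ge0 _ _ _)).
apply: (@le_trans _ _ (`|C| * (C2 + C1) * phi2 x)); last exact: ler_norm.
apply: (@le_trans _ _ (`|C| * (1 + `|x| ^+ k) * phi x)).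
  rewrite ler_wpM2r ?normal_pdf_ge0//; apply: (le_trans (FC x)).
  by rewrite ler_wpM2r ?addr_ge0 ?exprn_ge0// ler_norm.
rewrite -!mulrA ler_wpM2l// mulrDl [leRHS]mulrDl lerD//.
by have := h2 x; rewrite expr0.
Qed.

Definition gauss_dom := dom.
Definition gauss_mean (F : R -> R) : R := Rintegral mu setT (fun x => F x * phi x).

Lemma gauss_dom_bounded (F : R -> R) (M : R) : continuous F -> (forall x, `|F x| <= M) ->
  gauss_dom F.
Proof.
move=> cF FM; split=> //; exists 0%N, M => x; apply: (le_trans (FM x)).
have : 0 <= M by apply: le_trans (FM 0); exact: normr_ge0.
rewrite expr0; lra.
Qed.

Lemma gauss_dom_pow k : gauss_dom (fun x => x ^+ k).
Proof.
split; first by move=> x; exact: exprn_continuous.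
exists k, 1 => x; rewrite mul1r normrX lerDr//.
Qed.

Lemma positive_mean_gauss : positive_mean gauss_dom gauss_mean.
Proof.
split.
- by move=> a; apply: (@gauss_dom_bounded _ `|a|) => // x; exact: cvg_cst.
- move=> a; rewrite /gauss_mean RintegralZl//; last exact: integrable_normal_pdf.
  by rewrite /Rintegral integral_normal_pdf mulr1.
- move=> a F G [cF [k [C FC]]] [cG [k' [C' GC]]]; split.
    by move=> x; apply: cvgD; [apply: cvgM; [exact: cvg_cst|exact: cF]|exact: cG].
  exists (k + k')%N, (2 * (`|a| * `|C| + `|C'|)) => x.
  have pw (i j : nat) : (i <= j)%N -> 1 + `|x| ^+ i <= 2 * (1 + `|x| ^+ j).
    move=> ij; have [x1|x1] := leP `|x| 1.
      have := exprn_ile1 i (normr_ge0 x) x1; have : 0 <= `|x| ^+ j by exact: exprn_ge0.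
      lra.
    have := ler_weXn2l (ltW x1) ij; have : 0 <= `|x| ^+ j by exact: exprn_ge0.
    lra.
  apply: (le_trans (ler_normD _ _)); rewrite normrM.
  rewrite [2 * _]mulrC -mulrA mulrDl; apply: lerD.
    rewrite -mulrA ler_wpM2l//; apply: (le_trans (FC x)).
    apply: (@le_trans _ _ (`|C| * (1 + `|x| ^+ k))).
      by rewrite ler_wpM2r ?addr_ge0 ?exprn_ge0// ler_norm.
    by rewrite ler_wpM2l// pw// leq_addr.
  apply: (le_trans (GC x)).
  apply: (@le_trans _ _ (`|C'| * (1 + `|x| ^+ k'))).
    by rewrite ler_wpM2r ?addr_ge0 ?exprn_ge0// ler_norm.
  by rewrite ler_wpM2l// pw// leq_addl.
- move=> a F G dF dG; rewrite /gauss_mean.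
  rewrite -RintegralZl//; last exact: dom_integrable.
  rewrite -RintegralD//; last exact: dom_integrable.
    by apply: eq_Rintegral => x _; ring.
  have := integrableZl measurableT a (dom_integrable dF).
  by apply: eq_integrable.
- move=> F G dF dG FG; apply: le_Rintegral => //; try exact: dom_integrable.
  by move=> x _; rewrite ler_wpM2r// normal_pdf_ge0.
Qed.

Let is_derive_phi (x : R) : is_derive x 1 phi (- (x / s ^+ 2) * phi x).
Proof.
have -> : phi = fun x => normal_peak s * expR (- (x ^+ 2 / (2 * s ^+ 2))).
  by apply/funext => y; rewrite pdfE.
have d : is_derive x 1 (fun x : R => x ^+ 2) (2 * x).
  apply: DeriveDef; first exact: exprn_derivable.
  by rewrite exp_derive /GRing.scale /= mulr1 expr1.
apply: is_derive_eq; rewrite /GRing.scale /=.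
by field; rewrite gt_eqF.
Qed.

(** Integration by parts: the derivative of x^r phi is r x^(r-1) phi - x^(r+1) phi / s^2, and its
    integral over the line is 0. *)
Let gauss_rec r : gauss_mean (fun x => x ^+ r.+1) =
  r%:R * s ^+ 2 * gauss_mean (fun x => x ^+ r.-1).
Proof.
have [C C0 hC] := pow_phi_bound r.+1.
have ss : s ^+ 2 != 0 by rewrite gt_eqF// exprn_gt0.
have p2 : 0 <= normal_peak (2 * s) by exact: normal_peak_ge0.
have phi2_le x : phi2 x <= normal_peak (2 * s).
  rewrite pdfE ?mulr_gt0// ler_piMr// -[leRHS]expR0 ler_expR oppr_le0.
  by rewrite divr_ge0 ?sqr_ge0// mulr_ge0// sqr_ge0.
pose F x := x ^+ r * phi x.
pose f x := r%:R * (x ^+ r.-1 * phi x) + (- (s ^+ 2)^-1) * (x ^+ r.+1 * phi x).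
have dF (x : R) : is_derive x 1 F (f x).
  have d1 : is_derive x 1 (fun x : R => x ^+ r) (x ^+ r.-1 *+ r).
    apply: DeriveDef; first exact: exprn_derivable.
    by rewrite exp_derive /GRing.scale /= mulr1 mulr_natl.
  have d2 := is_derive_phi x.
  have d3 := is_deriveM d1 d2.
  apply: (is_derive_eq d3); rewrite /GRing.scale /= /f [x ^+ r.+1]exprS -mulr_natr.
  by move: (phi x) => w; field; rewrite gt_eqF.
have ipow k := dom_integrable (gauss_dom_pow k).
have i1 : mu.-integrable setT (EFin \o (fun x => r%:R * (x ^+ r.-1 * phi x))).
  by have := integrableZl measurableT r%:R (ipow r.-1); apply: eq_integrable.
have i2 : mu.-integrable setT (EFin \o (fun x => (- (s ^+ 2)^-1) * (x ^+ r.+1 * phi x))).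
  by have := integrableZl measurableT (- (s ^+ 2)^-1) (ipow r.+1); apply: eq_integrable.
have phic : continuous phi by apply: continuous_normal_pdf; rewrite gt_eqF.
have cpow k : continuous (fun x : R => x ^+ k * phi x).
  by move=> x; apply: cvgM; [exact: exprn_continuous|exact: phic].
(* The bound for the exponent r + 1 gives one more factor n than is present, hence decay like 1 / n
   at both ends. *)
have F0 (y : nat -> R) : (forall n, `|y n| = n%:R) -> F (y n) @[n --> \oo] --> (0 : R).
  move=> yn; apply/cvgr0Pnorm_le => e e0.
  exists (Num.truncn (C * normal_peak (2 * s) / e)).+1 => // n /= hn.
  have n0 : 0 < n%:R :> R by rewrite ltr0n; apply: leq_trans hn.
  rewrite /F normrM (ger0_norm (normal_pdf_ge0 _ _ _)) normrX.
  have h := hC (y n); rewrite yn in h *.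
  have e1 : C * normal_peak (2 * s) <= e * n%:R.
    rewrite -ler_pdivrMl// mulrC; apply: ltW.
    apply: (@lt_le_trans _ _ (Num.truncn (C * normal_peak (2 * s) / e)).+1%:R); last by rewrite ler_nat.
    have q0 : 0 <= C * normal_peak (2 * s) / e by rewrite divr_ge0 ?mulr_ge0// ltW.
    by have /andP[] := truncn_itv q0.
  rewrite -(ler_pM2l n0) mulrA -exprS [leRHS]mulrC; apply: (le_trans h).
  by apply: le_trans e1; rewrite ler_wpM2l.
have z : Rintegral mu setT f = 0.
  rewrite -[RHS](subrr 0); apply: (integral_line_FTC _ dF).
  - move=> x; apply: cvgD; apply: cvgM; [exact: cvg_cst|exact: cpow|exact: cvg_cst|exact: cpow].
  - by have := integrableD measurableT i1 i2; apply: eq_integrable.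
  - by apply: F0 => n; rewrite normr_nat.
  - by apply: F0 => n; rewrite normrN normr_nat.
move: z; rewrite RintegralD// !RintegralZl// -/(gauss_mean _) -/(gauss_mean _).
rewrite mulNr => /eqP; rewrite subr_eq0 => /eqP e.
by rewrite -mulrA [_ * (s ^+ 2 * _)]mulrCA -[X in s ^+ 2 * X]/(_) e mulrA divff// mul1r.
Qed.

Lemma gauss_moments j :
  gauss_mean (fun x => x ^+ j.*2) = (j.*2)`!%:R / (2 ^+ j * j`!%:R) * (s ^+ 2) ^+ j /\
  gauss_mean (fun x => x ^+ j.*2.+1) = 0.
Proof.
apply: (@moments_of_recurrence _ (fun r => gauss_mean (fun x => x ^+ r)) _ j.*2.+1) => //.
by have := mean_cst positive_mean_gauss 1.
Qed.

Lemma cvg_series_exp (x : R) : series (exp_coeff x) n @[n --> \oo] --> expR x.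
Proof. exact: is_cvg_series_exp_coeff. Qed.

(** Here every moment is known, so [mean_cos] holds for all m and its error bound tends to 0. *)
Lemma gauss_cos (t : R) : gauss_mean (fun x => cos (t * x)) = expR (- (t ^+ 2 * s ^+ 2 / 2)).
Proof.
have ct : continuous (fun x : R => t * x).
  by move=> x; apply: cvgM; [exact: cvg_cst|exact: cvg_id].
have dc : gauss_dom (fun x => cos (t * x)).
  apply: (@gauss_dom_bounded _ 1) => [x|x]; last by rewrite ler_norml cos_geN1 cos_le1.
  by apply: (continuous_comp (f := fun x => t * x)); [exact: ct|exact: continuous_cos].
have b m := @mean_cos _ _ _ _ positive_mean_gauss id (s ^+ 2) m gauss_dom_pow
   (fun j _ => (gauss_moments j).1) t dc.
set y := t ^+ 2 * s ^+ 2 / 2 in b *.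
have c0 : series (exp_coeff (- y)) n @[n --> \oo] --> gauss_mean (fun x => cos (t * x)).
  apply/cvgrPdist_le => e e0.
  have := cvg_exp_coeff y => /cvgrPdist_le/(_ e e0); apply: filterS => m hm.
  apply: (le_trans (b m)); apply: le_trans hm.
  by rewrite sub0r normrN; exact: ler_norm.
by rewrite -(cvg_lim _ c0)//; exact: cvg_lim (cvg_series_exp _).
Qed.

Lemma gauss_sin (t : R) : gauss_mean (fun x => sin (t * x)) = 0.
Proof.
have ct : continuous (fun x : R => t * x).
  by move=> x; apply: cvgM; [exact: cvg_cst|exact: cvg_id].
have dc : gauss_dom (fun x => sin (t * x)).
  apply: (@gauss_dom_bounded _ 1) => [x|x]; last by rewrite ler_norml sin_geN1 sin_le1.
  by apply: (continuous_comp (f := fun x => t * x)); [exact: ct|exact: continuous_sin].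
have b m := @mean_sin _ _ _ _ positive_mean_gauss id (s ^+ 2) m gauss_dom_pow
   (fun j _ => (gauss_moments j).1) (fun j _ => (gauss_moments j).2) t dc.
set y := t ^+ 2 * s ^+ 2 / 2 in b.
apply/eqP; rewrite -normr_le0; apply/ler_addgt0Pr => e e0; rewrite add0r.
have := cvg_exp_coeff y => /cvgrPdist_le/(_ e e0)/filter_ex[m hm].
apply: (le_trans (b m)); apply: le_trans hm.
by rewrite sub0r normrN; exact: ler_norm.
Qed.

Lemma gauss_second_moment : gauss_mean (fun x => x ^+ 2) = s ^+ 2.
Proof.
have [+ _] := gauss_moments 1; rewrite /= expr1 => ->.
by rewrite !factS fact0 !muln1 expr1 mulr1 divff ?mul1r// pnatr_eq0.
Qed.

End GaussianMean.

(** * From cosines and sines to bounded continuous test functions *)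

Section WeakConvergence.
Variable R : realType.

Lemma positive_mean_ope n : positive_mean (@ucont R n) (@ope_E R n).
Proof.
split; [exact: ucont_cst|exact: ope_E_cst| | |].
- by move=> a F G uF uG; apply: ucontD => //; exact: ucontZ.
- by move=> a F G uF uG; rewrite ope_ED ?ope_EZ//; exact: ucontZ.
- by move=> F G uF uG FG; apply: le_ope_E.
Qed.

(** Packages the nondegenerate Gaussian law and the Dirac mass at v = 0 together, so that the limit
    argument does not split. *)
Lemma positive_mean_normal (v : R) : 0 <= v -> exists D : (R -> R) -> Prop,
  [/\ positive_mean D (normal_expect v),
      forall g M, continuous g -> (forall x, `|g x| <= M) -> D g,
      forall t, normal_expect v (fun x => cos (t * x)) = expR (- (t ^+ 2 * v / 2)),
      forall t, normal_expect v (fun x => sin (t * x)) = 0 &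
      D (fun x => x ^+ 2) /\ normal_expect v (fun x => x ^+ 2) = v].
Proof.
move=> v0; have [e|vn0] := eqVneq v 0.
  exists (fun=> True); rewrite /normal_expect e eqxx; split=> //.
  - by move=> t; rewrite !mulr0 mul0r oppr0 expR0 cos0.
  - by move=> t; rewrite mulr0 sin0.
  - by rewrite expr0n.
have s0 : 0 < Num.sqrt v by rewrite sqrtr_gt0 lt_neqAle eq_sym vn0.
have s2 : Num.sqrt v ^+ 2 = v by rewrite sqr_sqrtr.
have -> : normal_expect v = gauss_mean (Num.sqrt v).
  by apply/funext => g; rewrite /normal_expect (negbTE vn0).
exists (@gauss_dom R); split.
- exact: positive_mean_gauss.
- by move=> g M cg gM; exact: gauss_dom_bounded gM.
- by move=> t; rewrite gauss_cos// s2.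
- by move=> t; rewrite gauss_sin.
- by split; [exact: gauss_dom_pow|rewrite gauss_second_moment// s2].
Qed.

Variables (Y : forall n : nat, seq R -> R) (v : R).
Hypothesis v0 : 0 <= v.
Hypothesis uY : forall n, ucont n (Y n).
Hypothesis cosY : forall t : R,
  ope_E n (fun s => cos (t * Y n s)) @[n --> \oo] --> expR (- (t ^+ 2 * v / 2)).
Hypothesis sinY : forall t : R, ope_E n (fun s => sin (t * Y n s)) @[n --> \oo] --> (0 : R).
Variable B : R.
Hypothesis secondY : \forall n \near \oo, ope_E n (fun s => Y n s ^+ 2) <= B.

(** By linearity convergence holds for trigonometric polynomials. Replacing [g] by one of them costs
    a small multiple of 1 + x^2, whose mean is controlled by the second moment: [v] for the normal
    law, at most [B] eventually for the ensemble. *)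
Lemma ope_weak_cvg : ope_cvg_in_distribution_normal Y v.
Proof.
move=> g cg [M gM].
have [D [pmD Db Dc Ds [D2 E2]]] := positive_mean_normal v0.
have uT p n : trigpoly p -> ucont n (fun s => p (Y n s)).
  by move=> tp; apply: ucont_comp => //; exact: trigpoly_continuous.
have DT p : trigpoly p -> D p.
  move=> tp; have [K hK] := trigpoly_bounded tp.
  exact: Db (trigpoly_continuous tp) hK.
have cvgT p : trigpoly p -> ope_E n (fun s => p (Y n s)) @[n --> \oo] --> normal_expect v p.
  elim=> [t|t|f h tf If th Ih|a f tf If].
  - by rewrite Dc; exact: cosY.
  - by rewrite Ds; exact: sinY.
  - rewrite (meanD pmD (DT _ tf) (DT _ th)).
    under eq_cvg => n do rewrite (ope_ED (uT _ _ tf) (uT _ _ th)).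
    exact: cvgD.
  - rewrite (meanZ pmD _ (DT _ tf)).
    under eq_cvg => n do rewrite (ope_EZ _ (uT _ _ tf)).
    by apply: cvgM => //; exact: cvg_cst.
apply/cvgrPdist_le => e e0.
(* Exceeds both 1 + v and 1 + B, the two means of the weight. *)
pose K := 2 + v + `|B|.
have K0 : 0 < K by rewrite /K -addrA ltr_pwDl// addr_ge0.
have e30 : 0 < e / (3 * K) by rewrite divr_gt0// mulr_gt0.
have [p tp gp] := trigpoly_approx cg gM e30.
have lim : `|normal_expect v g - normal_expect v p| <= e / 3.
  have Dg := Db _ _ cg gM; have Dp := DT _ tp.
  have D1 : D (fun x => 1 + x ^+ 2) by exact: (mean_domD pmD (mean_dom_cst pmD 1) D2).
  rewrite -(meanB pmD)//.
  have := mean_norm pmD (mean_domB pmD Dg Dp) (mean_domZ pmD (e / (3 * K)) D1) gp.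
  rewrite (meanZ pmD)// (meanD pmD (mean_dom_cst pmD 1) D2) (mean_cst pmD) E2.
  move=> /le_trans; apply.
  have -> : e / 3 = e / (3 * K) * K by field; rewrite gt_eqF.
  by rewrite ler_wpM2l ?ltW// /K; have := normr_ge0 B; lra.
have e3 : 0 < e / 3 by rewrite divr_gt0.
near=> n.
have un : `|ope_E n (fun s => g (Y n s)) - ope_E n (fun s => p (Y n s))| <= e / 3.
  have pm := positive_mean_ope n.
  have ug : ucont n (fun s => g (Y n s)) by exact: ucont_comp.
  have uY2 : ucont n (fun s => Y n s ^+ 2) by exact: ucontX.
  have u1 : ucont n (fun s => 1 + Y n s ^+ 2) by apply: ucontD => //; exact: ucont_cst.
  rewrite -ope_EB//; last exact: uT.
  have := mean_norm pm (ucontB ug (uT p n tp)) (ucontZ (e / (3 * K)) u1) (fun s => gp (Y n s)).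
  rewrite (ope_EZ _ u1) (ope_ED (ucont_cst n 1) uY2) ope_E_cst => /le_trans; apply.
  have hB : ope_E n (fun s => Y n s ^+ 2) <= B by near: n.
  have -> : e / 3 = e / (3 * K) * K by field; rewrite gt_eqF.
  by rewrite ler_wpM2l ?ltW// /K; have := ler_norm B; have := v0; lra.
have mid : `|normal_expect v p - ope_E n (fun s => p (Y n s))| <= e / 3.
  by near: n; have /cvgrPdist_le := cvgT _ tp; apply.
have -> : normal_expect v g - ope_E n (fun s => g (Y n s)) =
  (normal_expect v g - normal_expect v p) +
  (normal_expect v p - ope_E n (fun s => p (Y n s))) -
  (ope_E n (fun s => g (Y n s)) - ope_E n (fun s => p (Y n s))) by ring.
apply: (le_trans (ler_normB _ _)).
have := ler_normD (normal_expect v g - normal_expect v p)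
  (normal_expect v p - ope_E n (fun s => p (Y n s))).
lra.
Unshelve. all: by end_near. Qed.

End WeakConvergence.

(** * Lipschitz bounds and the remainder of the exponential series *)

Section Lipschitz.
Variable R : realType.
Implicit Types a b : R.

Lemma lipschitz1_of_derivative (f df : R -> R) : (forall x : R, is_derive x 1 f (df x)) ->
  (forall x, `|df x| <= 1) -> forall a b, `|f a - f b| <= `|a - b|.
Proof.
move=> d b1; suff h a b : a <= b -> `|f a - f b| <= `|a - b|.
  move=> a b; have [|/ltW] := leP a b; first exact: h.
  by rewrite distrC (distrC a); exact: h.
move=> ab.
have cf : {within `[a, b], continuous f}.
  by apply: continuous_subspaceT; exact: is_derive_continuous d.
have [c _ e] := MVT_segment ab (fun y _ => d y) cf.
by rewrite distrC e normrM (distrC a) ler_piMl.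
Qed.

Lemma cos_lipschitz a b : `|cos a - cos b| <= `|a - b|.
Proof.
apply: (@lipschitz1_of_derivative _ (fun x => - sin x)) => x.
by rewrite normrN ler_norml sin_geN1 sin_le1.
Qed.

Lemma sin_lipschitz a b : `|sin a - sin b| <= `|a - b|.
Proof.
apply: (@lipschitz1_of_derivative _ cos) => x.
by rewrite ler_norml cos_geN1 cos_le1.
Qed.

(** Read off from the Gaussian law: [mean_cos] at t = 1 for variance 2 y. The case y = 0 is apart
    because the variance must be positive. *)
Lemma expRN_series (y : R) m : 0 <= y ->
  `|expR (- y) - series (exp_coeff (- y)) m| <= exp_coeff y m.
Proof.
rewrite le_eqVlt => /predU1P[<-|y0].
  rewrite oppr0 expR0; case: m => [|m]; last by rewrite series_exp_coeff0 subrr normr0 exp_coeff_ge0.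
  by rewrite /series /= big_geq// subr0 normr1 exp_coeffE /= fact0 invr1 mul1r.
pose s := Num.sqrt (2 * y).
have s0 : 0 < s by rewrite sqrtr_gt0 mulr_gt0.
have s2 : 1 ^+ 2 * s ^+ 2 / 2 = y by rewrite sqr_sqrtr ?mulr_ge0 ?ltW//; field.
have dc : gauss_dom (fun x : R => cos (1 * x)).
  have -> : (fun x : R => cos (1 * x)) = cos by apply/funext => x; rewrite mul1r.
  apply: (@gauss_dom_bounded _ _ 1) => [x|x]; last by rewrite ler_norml cos_geN1 cos_le1.
  exact: continuous_cos.
have := @mean_cos _ _ _ _ (positive_mean_gauss s0) id (s ^+ 2) m (@gauss_dom_pow R)
   (fun j _ => (gauss_moments s0 j).1) 1 dc.
by rewrite gauss_cos// s2.
Qed.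

End Lipschitz.

(** * A central limit criterion in terms of Chebyshev coefficients *)

Section CentralLimit.
Variables (R : realType) (F : nat -> R -> R) (c : nat -> R) (g : nat -> nat -> R) (v : R).
Hypothesis cont2_F : forall n, cont2 (F n).
Variable d : nat -> nat -> R.
Hypothesis d_cvg0 : forall r, (0 < r)%N -> d r n @[n --> \oo] --> (0 : R).
Hypothesis F_approx : forall r n x, (0 < r)%N -> `|x| <= 2 ->
  n%:R * `|F n x - c n - \sum_(k < n %/ r) g n k.+1 * chebT k.+1 x| <= d r n.
Hypothesis variance_cvg : forall r, (0 < r)%N ->
  \sum_(k < n %/ r) k.+1%:R * g n k.+1 ^+ 2 @[n --> \oo] --> v.

Let L n (s : seq R) := \sum_(x <- s) F n x.
Let Y n (s : seq R) := L n s - ope_E n (L n).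
(** The parameter r is the order up to which moments are exact: the degree n / r makes r times the
    degree at most n. *)
Let X r n := trigstat n (n %/ r) (g n).
Let V r n := \sum_(k < n %/ r) k.+1%:R * g n k.+1 ^+ 2.

Let LE n s : size s = n -> L n s = \sum_(j < n) F n s`_j.
Proof. by move=> sn; rewrite /L (big_nth 0) sn big_mkord. Qed.

Let uL n : ucont n (L n).
Proof.
have u : ucont n (fun s => \sum_(j < n) F n s`_j).
  by apply: ucont_sum => j; exact: ucont_cont2.
have E s : cube n s -> L n s = \sum_(j < n) F n s`_j.
  by move=> /andP[/eqP sn _]; exact: LE.
have [[M hM] uu] := u; split.
  by exists M => s cs; rewrite E//; exact: hM.
move=> e e0; have [dl dl0 hd] := uu _ e0; exists dl => // s t cs ct st.
by rewrite !E//; exact: hd.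
Qed.

Let uY n : ucont n (Y n).
Proof. by apply: ucontB; [exact: uL|exact: ucont_cst]. Qed.

Let uX r n : ucont n (X r n). Proof. exact: ucont_trigstat. Qed.

Let V_ge0 r n : 0 <= V r n.
Proof. by apply: sumr_ge0 => k _; rewrite mulr_ge0// sqr_ge0. Qed.

Let v0 : 0 <= v.
Proof.
have cv := @variance_cvg 1 isT.
rewrite -(cvg_lim _ cv)//; apply: limr_ge; first by apply/cvg_ex; exists v.
by apply: nearW => n; exact: (V_ge0 1 n).
Qed.

Let LX r n s : (0 < r)%N -> cube n s ->
  `|L n s - (X r n s + (n%:R * c n - \sum_(k < n %/ r) g n k.+1 * (~~ odd k.+1)%:R))| <= d r n.
Proof.
move=> r0 cs; have [/eqP sn _] := andP cs.
pose D (j : nat) := F n s`_j - c n - \sum_(k < n %/ r) g n k.+1 * chebT k.+1 s`_j.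
have -> : L n s - (X r n s + (n%:R * c n - \sum_(k < n %/ r) g n k.+1 * (~~ odd k.+1)%:R)) =
    \sum_(j < n) D j.
  have hX : X r n s = \sum_(k < n %/ r) g n k.+1 * powsum n k.+1 s +
      \sum_(k < n %/ r) g n k.+1 * (~~ odd k.+1)%:R.
    by rewrite -big_split; apply: eq_bigr => k _; rewrite mulrDr.
  have hP : \sum_(k < n %/ r) g n k.+1 * powsum n k.+1 s =
      \sum_(j < n) \sum_(k < n %/ r) g n k.+1 * chebT k.+1 s`_j.
    by rewrite exchange_big; apply: eq_bigr => k _; rewrite mulr_sumr.
  rewrite hX hP LE// /D !sumrB sumr_const card_ord -mulr_natl; ring.
have [n0|n0] := posnP n.
  have := @F_approx r n 0 r0; rewrite normr0 => /(_ (ler0n _ 2)).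
  rewrite {1}n0 mul0r; apply: le_trans.
  by rewrite (eq_bigr (fun=> 0)) ?big1 ?normr0// => j; have := ltn_ord j; rewrite {2}n0.
apply: (le_trans (ler_norm_sum _ _ _)).
apply: (@le_trans _ _ (\sum_(j < n) d r n / n%:R)).
  apply: ler_sum => j _; rewrite ler_pdivlMr ?ltr0n// mulrC; apply: F_approx => //.
  exact: cube_nth cs.
by rewrite sumr_const card_ord -[X in X <= _]mulr_natl mulrC divfK// pnatr_eq0 -lt0n.
Qed.

Let EX r n : (0 < r)%N -> ope_E n (X r n) = 0.
Proof.
move=> r0.
have := @ope_E_trigstat_rec R n (n %/ r) (g n) 0 _.
rewrite !mul0r mul1n => <-; last exact: leq_div.
by congr ope_E; apply/funext => s; rewrite expr1.
Qed.

(** The truncation error is paid twice: once for the statistic and once for its mean, since [X r n]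
    already has mean 0. *)
Let YX r n s : (0 < r)%N -> cube n s -> `|Y n s - X r n s| <= 2 * d r n.
Proof.
move=> r0 cs; set C := n%:R * c n - \sum_(k < n %/ r) g n k.+1 * (~~ odd k.+1)%:R.
have uXC : ucont n (fun s => X r n s + C) by apply: ucontD => //; exact: ucont_cst.
have EXC : ope_E n (fun s => X r n s + C) = C.
  by rewrite ope_ED ?EX ?ope_E_cst ?add0r//; exact: ucont_cst.
have EL : `|ope_E n (L n) - C| <= d r n.
  rewrite -EXC -ope_EB// ler_norml; apply/andP; split.
    rewrite -(ope_E_cst n (- d r n)); apply: le_ope_E; [exact: ucont_cst|exact: ucontB|].
    by move=> t ct; have := LX r0 ct; rewrite ler_norml => /andP[].
  rewrite -[leRHS](ope_E_cst n); apply: le_ope_E; [exact: ucontB|exact: ucont_cst|].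
  by move=> t ct; have := LX r0 ct; rewrite ler_norml => /andP[].
have -> : Y n s - X r n s = (L n s - (X r n s + C)) - (ope_E n (L n) - C) by rewrite /Y; ring.
apply: (le_trans (ler_normB _ _)).
have := LX r0 cs; rewrite -/C => h; lra.
Qed.

Let d_ge0 r n : (0 < r)%N -> 0 <= d r n.
Proof.
move=> r0; have := @F_approx r n 0 r0; rewrite normr0 => /(_ (ler0n _ 2)).
by apply: le_trans; rewrite mulr_ge0.
Qed.

Let E_lipschitz r n (h : R -> R) (K : R) : (0 < r)%N -> continuous h -> 0 <= K ->
  (forall a b, `|h a - h b| <= K * `|a - b|) ->
  `|ope_E n (fun s => h (Y n s)) - ope_E n (fun s => h (X r n s))| <= K * (2 * d r n).
Proof.
move=> r0 ch K0 hK.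
have u1 : ucont n (fun s => h (Y n s)) by exact: ucont_comp.
have u2 : ucont n (fun s => h (X r n s)) by exact: ucont_comp.
have b s : cube n s -> `|h (Y n s) - h (X r n s)| <= K * (2 * d r n).
  by move=> cs; apply: (le_trans (hK _ _)); rewrite ler_wpM2l// YX.
rewrite -ope_EB// ler_norml; apply/andP; split.
  rewrite -(ope_E_cst n (- _)); apply: le_ope_E; [exact: ucont_cst|exact: ucontB|].
  by move=> t ct; have := b t ct; rewrite ler_norml => /andP[].
rewrite -[leRHS](ope_E_cst n); apply: le_ope_E; [exact: ucontB|exact: ucont_cst|].
by move=> t ct; have := b t ct; rewrite ler_norml => /andP[].
Qed.

Let EX_moments m n j : (j <= m)%N ->
  ope_E n (fun s => X m.*2.+1 n s ^+ j.*2) =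
    (j.*2)`!%:R / (2 ^+ j * j`!%:R) * V m.*2.+1 n ^+ j /\
  ope_E n (fun s => X m.*2.+1 n s ^+ j.*2.+1) = 0.
Proof.
move=> jm; apply: ope_E_trigstat_moments.
apply: leq_trans (leq_divM n m.*2.+1); rewrite mulnC leq_mul2l; apply/orP; right; lia.
Qed.

Let ucos n (Z : seq R -> R) (t : R) : ucont n Z -> ucont n (fun s => cos (t * Z s)).
Proof.
by move=> uZ; apply: (ucont_comp (@continuous_cos R)); exact: ucontZ.
Qed.

Let usin n (Z : seq R -> R) (t : R) : ucont n Z -> ucont n (fun s => sin (t * Z s)).
Proof.
by move=> uZ; apply: (ucont_comp (@continuous_sin R)); exact: ucontZ.
Qed.

Let exp_coeff_small (y e : R) : 0 < e -> exists m, exp_coeff y m <= e.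
Proof.
move=> e0; have := cvg_exp_coeff y => /cvgrPdist_le/(_ e e0)/filter_ex[m hm].
by exists m; apply: le_trans hm; rewrite sub0r normrN; exact: ler_norm.
Qed.

Let exp_coeff_le (y z : R) m : 0 <= y <= z -> exp_coeff y m <= exp_coeff z m.
Proof.
move=> /andP[y0 yz]; rewrite !exp_coeffE /= ler_wpM2l ?invr_ge0//.
by rewrite lerXn2r// nnegrE// (le_trans y0).
Qed.

Let ctimes (t : R) : continuous (fun x : R => t * x).
Proof. by move=> x; apply: cvgM; [exact: cvg_cst|exact: cvg_id]. Qed.

Let cosY (t : R) :
  ope_E n (fun s => cos (t * Y n s)) @[n --> \oo] --> expR (- (t ^+ 2 * v / 2)).
Proof.
have ccos : continuous (fun x : R => cos (t * x)).
  by move=> x; apply: (continuous_comp (f := fun x => t * x)); [exact: ctimes|exact: continuous_cos].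
have lcos (a b : R) : `|cos (t * a) - cos (t * b)| <= `|t| * `|a - b|.
  by apply: (le_trans (cos_lipschitz _ _)); rewrite -mulrBr normrM.
apply/cvgrPdist_le => e e0.
have e4 : 0 < e / 4 by lra.
(* The order m, hence r = 2 m + 1, is fixed before n. Using v + 1 makes the choice valid for all
   large n, because [V r n] tends to the same v for every r. *)
have [m hm] := exp_coeff_small (t ^+ 2 * (v + 1) / 2) e4.
pose r := m.*2.+1.
have cV : V r n @[n --> \oo] --> v by exact: variance_cvg.
have cexp : expR (- (t ^+ 2 * V r n / 2)) @[n --> \oo] --> expR (- (t ^+ 2 * v / 2)).
  have c2 : - (t ^+ 2 * V r n / 2) @[n --> \oo] --> - (t ^+ 2 * v / 2); last first.
    exact: (cvg_comp _ _ c2 (@continuous_expR R _)).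
  apply: cvgN; apply: cvgM; last exact: cvg_cst.
  by apply: cvgM; [exact: cvg_cst|exact: cV].
have cd : `|t| * (2 * d r n) @[n --> \oo] --> (0 : R).
  rewrite -[X in _ --> X](mulr0 `|t|); apply: cvgM; first exact: cvg_cst.
  rewrite -[X in _ --> X](mulr0 2); apply: cvgM; first exact: cvg_cst.
  exact: d_cvg0.
near=> n.
have h1 : `|expR (- (t ^+ 2 * v / 2)) - expR (- (t ^+ 2 * V r n / 2))| <= e / 4.
  by near: n; have /cvgrPdist_le := cexp; apply.
have h2 : `|t| * (2 * d r n) <= e / 4.
  have : `|0 - `|t| * (2 * d r n)| <= e / 4 by near: n; have /cvgrPdist_le := cd; apply.
  by rewrite sub0r normrN; apply: le_trans; exact: ler_norm.
have h3 : V r n <= v + 1.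
  have : `|v - V r n| <= 1 by near: n; have /cvgrPdist_le := cV; apply.
  by rewrite ler_norml => /andP[]; lra.
set y := t ^+ 2 * V r n / 2 in h1 *.
have y0 : 0 <= y by apply: divr_ge0 => //; apply: mulr_ge0; [exact: sqr_ge0|exact: V_ge0].
have h4 : exp_coeff y m <= e / 4.
  apply: le_trans hm; apply: exp_coeff_le; rewrite y0 /y.
  by rewrite ler_pM2r ?invr_gt0// ler_wpM2l ?sqr_ge0.
have h5 := expRN_series m y0.
have h6 := @mean_cos _ _ _ _ (positive_mean_ope R n) (X r n) (V r n) m
  (fun j => ucontX j (uX r n)) (fun j jm => (EX_moments n jm).1) t (ucos t (uX r n)).
rewrite -/y in h6.
have h7 := @E_lipschitz r n _ _ isT ccos (normr_ge0 t) lcos.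
set S := series _ _ in h5 h6; set A := ope_E n _ in h7 *; set B := ope_E n _ in h6 h7.
have -> : expR (- (t ^+ 2 * v / 2)) - A = (expR (- (t ^+ 2 * v / 2)) - expR (- y)) +
  (expR (- y) - S) - (B - S) - (A - B) by ring.
have n1 := ler_normD (expR (- (t ^+ 2 * v / 2)) - expR (- y)) (expR (- y) - S).
have n2 := ler_normB ((expR (- (t ^+ 2 * v / 2)) - expR (- y)) + (expR (- y) - S)) (B - S).
apply: (le_trans (ler_normB _ _)); lra.
Unshelve. all: by end_near. Qed.

Let sinY (t : R) : ope_E n (fun s => sin (t * Y n s)) @[n --> \oo] --> (0 : R).
Proof.
have csin : continuous (fun x : R => sin (t * x)).
  by move=> x; apply: (continuous_comp (f := fun x => t * x)); [exact: ctimes|exact: continuous_sin].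
have lsin (a b : R) : `|sin (t * a) - sin (t * b)| <= `|t| * `|a - b|.
  by apply: (le_trans (sin_lipschitz _ _)); rewrite -mulrBr normrM.
apply/cvgrPdist_le => e e0.
have e4 : 0 < e / 4 by lra.
have [m hm] := exp_coeff_small (t ^+ 2 * (v + 1) / 2) e4.
pose r := m.*2.+1.
have cV : V r n @[n --> \oo] --> v by exact: variance_cvg.
have cd : `|t| * (2 * d r n) @[n --> \oo] --> (0 : R).
  rewrite -[X in _ --> X](mulr0 `|t|); apply: cvgM; first exact: cvg_cst.
  rewrite -[X in _ --> X](mulr0 2); apply: cvgM; first exact: cvg_cst.
  exact: d_cvg0.
near=> n.
have h2 : `|t| * (2 * d r n) <= e / 4.
  have : `|0 - `|t| * (2 * d r n)| <= e / 4 by near: n; have /cvgrPdist_le := cd; apply.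
  by rewrite sub0r normrN; apply: le_trans; exact: ler_norm.
have h3 : V r n <= v + 1.
  have : `|v - V r n| <= 1 by near: n; have /cvgrPdist_le := cV; apply.
  by rewrite ler_norml => /andP[]; lra.
have y0 : 0 <= t ^+ 2 * V r n / 2.
  by apply: divr_ge0 => //; apply: mulr_ge0; [exact: sqr_ge0|exact: V_ge0].
have h4 : exp_coeff (t ^+ 2 * V r n / 2) m <= e / 4.
  apply: le_trans hm; apply: exp_coeff_le; rewrite y0.
  by rewrite ler_pM2r ?invr_gt0// ler_wpM2l ?sqr_ge0.
have h6 := @mean_sin _ _ _ _ (positive_mean_ope R n) (X r n) (V r n) m
  (fun j => ucontX j (uX r n)) (fun j jm => (EX_moments n jm).1)
  (fun j jm => (EX_moments n (ltnW jm)).2) t (usin t (uX r n)).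
have h7 := @E_lipschitz r n _ _ isT csin (normr_ge0 t) lsin.
set A := ope_E n _ in h7 *; set B := ope_E n _ in h6 h7.
have -> : 0 - A = - (A - B) - B by ring.
apply: (le_trans (ler_normB _ _)); rewrite normrN; lra.
Unshelve. all: by end_near. Qed.

Let secondY : \forall n \near \oo, ope_E n (fun s => Y n s ^+ 2) <= 2 * (v + 1) + 8.
Proof.
have cV : V 3 n @[n --> \oo] --> v by exact: variance_cvg.
have cd : d 3 n @[n --> \oo] --> (0 : R) by exact: d_cvg0.
near=> n.
have h2 : d 3 n <= 1.
  have : `|0 - d 3 n| <= 1 by near: n; have /cvgrPdist_le := cd; apply.
  by rewrite sub0r normrN; apply: le_trans; exact: ler_norm.
have h3 : V 3 n <= v + 1.
  have : `|v - V 3 n| <= 1 by near: n; have /cvgrPdist_le := cV; apply.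
  by rewrite ler_norml => /andP[]; lra.
have uX2 : ucont n (fun s => X 3 n s ^+ 2) by exact: ucontX.
(* From |Y - X| <= 2 follows Y^2 <= 2 X^2 + 2 (Y - X)^2 <= 2 X^2 + 8; r = 3 is enough for an exact
   second moment. *)
apply: (@le_trans _ _ (ope_E n (fun s => 2 * X 3 n s ^+ 2 + 8))).
  apply: le_ope_E; [exact: ucontX|exact: (ucontD (ucontZ 2 uX2) (ucont_cst n 8))|].
  move=> s cs; have := @YX 3 n s isT cs; rewrite ler_norml => /andP[l1 l2].
  set a := Y n s in l1 l2 *; set b := X 3 n s in l1 l2 *.
  have : (a - b) ^+ 2 <= 4 by nra.
  by have := sqr_ge0 (a - 2 * b); nra.
rewrite (ope_ED (ucontZ 2 uX2) (ucont_cst n 8)) ope_EZ// ope_E_cst lerD2r ler_pM2l//.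
have [+ _] := @EX_moments 1 n 1 isT; rewrite /= expr1 => ->.
by rewrite !factS fact0 !muln1 expr1 mulr1 divff ?mul1r// pnatr_eq0.
Unshelve. all: by end_near. Qed.

Theorem ope_clt_criterion : ope_cvg_in_distribution_normal
  (fun n s => \sum_(x <- s) F n x - ope_E n (fun s => \sum_(x <- s) F n x)) v.
Proof. exact: (ope_weak_cvg v0 uY cosY sinY secondY). Qed.

End CentralLimit.

(** * Complex limits by real and imaginary parts *)

Section ComplexConvergence.
Variable R : realType.
Implicit Types (z w : R[i]) (u : nat -> R[i]).
Notation Re := (@complex.Re R).
Notation Im := (@complex.Im R).
Notation normc := (@ComplexField.Normc.normc R).

Lemma cReD z w : Re (z + w) = Re z + Re w. Proof. by case: z w => a b [c d]. Qed.
Lemma cImD z w : Im (z + w) = Im z + Im w. Proof. by case: z w => a b [c d]. Qed.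
Lemma cReN z : Re (- z) = - Re z. Proof. by case: z. Qed.
Lemma cImN z : Im (- z) = - Im z. Proof. by case: z. Qed.
Lemma cReM z w : Re (z * w) = Re z * Re w - Im z * Im w.
Proof. by case: z w => a b [c d]. Qed.
Lemma cImM z w : Im (z * w) = Re z * Im w + Im z * Re w.
Proof. by case: z w => a b [c d]. Qed.
Lemma cReV z : Re z^-1 = Re z / (Re z ^+ 2 + Im z ^+ 2). Proof. by case: z. Qed.
Lemma cImV z : Im z^-1 = - (Im z / (Re z ^+ 2 + Im z ^+ 2)). Proof. by case: z. Qed.

Lemma normc_sqr z : normc z ^+ 2 = Re z ^+ 2 + Im z ^+ 2.
Proof. by case: z => a b /=; rewrite sqr_sqrtr// addr_ge0 ?sqr_ge0. Qed.

Lemma normc_ge0 z : 0 <= normc z. Proof. by case: z => a b; exact: sqrtr_ge0. Qed.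

Lemma Re_le_normc z : `|Re z| <= normc z.
Proof.
rewrite -(@ler_pXn2r _ 2) ?nnegrE ?normc_ge0// real_normK ?num_real// normc_sqr.
by rewrite lerDl sqr_ge0.
Qed.

Lemma Im_le_normc z : `|Im z| <= normc z.
Proof.
rewrite -(@ler_pXn2r _ 2) ?nnegrE ?normc_ge0// real_normK ?num_real// normc_sqr.
by rewrite lerDr sqr_ge0.
Qed.

Lemma normcX z k : normc (z ^+ k) = normc z ^+ k.
Proof.
elim: k => [|k IH]; first by rewrite !expr0 ComplexField.Normc.normc1.
by rewrite !exprS ComplexField.Normc.normcM IH.
Qed.

Lemma normc_conj z : normc (conjc z) = normc z.
Proof. by case: z => a b /=; rewrite sqrrN. Qed.

Lemma normc_gt0 z : z != 0 -> 0 < normc z.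
Proof.
move=> z0; rewrite lt_neqAle normc_ge0 andbT; apply: contraNneq z0 => e.
by apply/eqP/ComplexField.Normc.eq0_normc.
Qed.

Lemma normc_real (x : R) : normc (x%:C)%C = `|x|.
Proof. by rewrite /= expr0n /= addr0 sqrtr_sqr. Qed.

Lemma ler_normcB z w : normc z - normc w <= normc (z - w).
Proof. by rewrite lerBlDr; apply: le_trans (le_normcD _ _); rewrite subrK. Qed.

Definition cvgC u z := Re (u n) @[n --> \oo] --> Re z /\ Im (u n) @[n --> \oo] --> Im z.

Lemma cvgC_cst z : cvgC (fun=> z) z. Proof. by split; exact: cvg_cst. Qed.

Lemma cvgCD u1 u2 z w : cvgC u1 z -> cvgC u2 w -> cvgC (fun n => u1 n + u2 n) (z + w).
Proof.
move=> [r1 i1] [r2 i2]; split; rewrite ?cReD ?cImD.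
  by under eq_cvg => n do rewrite cReD; exact: cvgD.
by under eq_cvg => n do rewrite cImD; exact: cvgD.
Qed.

Lemma cvgCN u z : cvgC u z -> cvgC (fun n => - u n) (- z).
Proof.
move=> [r1 i1]; split; rewrite ?cReN ?cImN.
  by under eq_cvg => n do rewrite cReN; exact: cvgN.
by under eq_cvg => n do rewrite cImN; exact: cvgN.
Qed.

Lemma cvgCM u1 u2 z w : cvgC u1 z -> cvgC u2 w -> cvgC (fun n => u1 n * u2 n) (z * w).
Proof.
move=> [r1 i1] [r2 i2]; split; rewrite ?cReM ?cImM.
  by under eq_cvg => n do rewrite cReM; apply: cvgB; exact: cvgM.
by under eq_cvg => n do rewrite cImM; apply: cvgD; exact: cvgM.
Qed.

Lemma cvgC_conj u z : cvgC u z -> cvgC (fun n => conjc (u n)) (conjc z).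
Proof.
move=> [r1 i1]; have e w : Re (conjc w) = Re w /\ Im (conjc w) = - Im w by case: w.
split; rewrite ?(e z).1 ?(e z).2.
  by under eq_cvg => n do rewrite (e (u n)).1.
by under eq_cvg => n do rewrite (e (u n)).2; exact: cvgN.
Qed.

Lemma cvgCV u z : z != 0 -> cvgC u z -> cvgC (fun n => (u n)^-1) z^-1.
Proof.
move=> z0 [r1 i1].
have n0 : Re z ^+ 2 + Im z ^+ 2 != 0.
  by rewrite -normc_sqr expf_neq0// gt_eqF// normc_gt0.
have cn : (Re (u n) ^+ 2 + Im (u n) ^+ 2)^-1 @[n --> \oo] --> (Re z ^+ 2 + Im z ^+ 2)^-1.
  by apply: cvgV => //; apply: cvgD; rewrite expr2; exact: cvgM.
split; rewrite ?cReV ?cImV.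
  by under eq_cvg => n do rewrite cReV; exact: cvgM.
by under eq_cvg => n do rewrite cImV; apply: cvgN; exact: cvgM.
Qed.

Lemma cvgC_normc u z (e : nat -> R) : (forall n, (0 < n)%N -> normc (u n - z) <= e n) ->
  e n @[n --> \oo] --> (0 : R) -> cvgC u z.
Proof.
move=> ue e0.
have key (P : R[i] -> R) : (forall w w', P (w + w') = P w + P w') ->
    (forall w, `|P w| <= normc w) -> P (u n) @[n --> \oo] --> P z.
  move=> PD Pn; apply/cvgrPdist_le => d d0.
  have := e0 => /cvgrPdist_le/(_ d d0) h.
  near=> n.
  have -> : P z - P (u n) = - P (u n - z).
    have -> : P (u n) = P (u n - z) + P z by rewrite -PD subrK.
    by ring.
  rewrite normrN; apply: (le_trans (Pn _)).
  have n0 : (0 < n)%N by near: n; exists 1%N.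
  apply: (le_trans (ue n n0)).
  have : `|0 - e n| <= d by near: n.
  by rewrite sub0r normrN; apply: le_trans; exact: ler_norm.
by split; apply: key; [exact: cReD|exact: Re_le_normc|exact: cImD|exact: Im_le_normc].
Unshelve. all: by end_near. Qed.

Lemma cvgC_near u1 u2 z : (forall n, (0 < n)%N -> u1 n = u2 n) -> cvgC u1 z -> cvgC u2 z.
Proof.
move=> e [r i]; split.
  apply: cvg_trans r; apply: near_eq_cvg; exists 1%N => // n /= n1; by rewrite e.
apply: cvg_trans i; apply: near_eq_cvg; exists 1%N => // n /= n1; by rewrite e.
Qed.

End ComplexConvergence.

(** * The Joukowski map and the Chebyshev expansion of a resolvent *)

Section Joukowski.
Variable R : realType.
Implicit Types (z w u : R[i]) (x : R).
Notation Re := (@complex.Re R).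
Notation Im := (@complex.Im R).
Notation normc := (@ComplexField.Normc.normc R).

Lemma Im_add_inv u z : u != 0 -> u + u^-1 = z ->
  normc u ^+ 2 * Im z = - Im u * (1 - normc u ^+ 2).
Proof.
move=> u0 <-; have := normc_gt0 u0 => n0.
rewrite cImD cImV normc_sqr.
have : Re u ^+ 2 + Im u ^+ 2 != 0 by rewrite -normc_sqr expf_neq0// gt_eqF.
by move=> h; field.
Qed.

(** The roots of w^2 - z w + 1 have product 1, so one lies inside the unit disc unless both lie on
    the circle; by [Im_add_inv] the latter would make z real. *)
Lemma joukowski_exists z : 0 < Im z -> exists u, [/\ u != 0, normc u < 1 & u + u^-1 = z].
Proof.
move=> z0; pose s := sqrtC (z ^+ 2 - 4).
have s2 : s ^+ 2 = z ^+ 2 - 4 by exact: sqrtCK.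
have prod1 : (z - s) / 2 * ((z + s) / 2) = 1.
  have -> : (z - s) / 2 * ((z + s) / 2) = (z ^+ 2 - s ^+ 2) / 4 by field.
  by rewrite s2; field.
have nz u w : u * w = 1 -> u != 0.
  by move=> e; apply: contra_eq_neq e => ->; rewrite mul0r eq_sym oner_neq0.
have inv u w : u * w = 1 -> u^-1 = w.
  by move=> e; rewrite -[w]mul1r -(mulVf (nz _ _ e)) -mulrA e mulr1.
have sum1 : (z - s) / 2 + (z + s) / 2 = z by field.
have root u w : u * w = 1 -> u + w = z -> normc u < 1 ->
    exists u, [/\ u != 0, normc u < 1 & u + u^-1 = z].
  by move=> e1 e2 h; exists u; split; [exact: nz e1| |rewrite (inv _ _ e1)].
have [h|h|h] := ltgtP (normc ((z - s) / 2)) 1.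
- exact: root prod1 sum1 h.
- have prod2 : (z + s) / 2 * ((z - s) / 2) = 1 by rewrite mulrC.
  have sum2 : (z + s) / 2 + (z - s) / 2 = z by rewrite addrC.
  apply: root prod2 sum2 _; rewrite -(inv _ _ prod1) ComplexField.Normc.normcV invf_lt1//.
  by apply: lt_trans h.
- have := Im_add_inv (nz _ _ prod1) (z := z).
  rewrite (inv _ _ prod1) sum1 h expr1n mul1r subrr mulr0 => /(_ erefl) e.
  by move: z0; rewrite e ltxx.
Qed.

Section Root.
Variables (u z : R[i]).
Hypotheses (u0 : u != 0) (u1 : normc u < 1) (uz : u + u^-1 = z) (z0 : 0 < Im z).

Let nu0 : 0 < normc u. Proof. exact: normc_gt0. Qed.

Lemma joukowski_Im_lt0 : Im u < 0.
Proof.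
have := Im_add_inv u0 uz; have : 0 < normc u ^+ 2 * Im z by rewrite mulr_gt0// exprn_gt0.
move=> h e; rewrite ltNge; apply/negP => i0.
have : - Im u * (1 - normc u ^+ 2) <= 0.
  by rewrite mulNr oppr_le0 mulr_ge0// subr_ge0 expr_le1// ltW.
lra.
Qed.

(** [Im_add_inv] combined with |Im u| <= |u|. This is how the height of z above the real line
    becomes a distance of u from the unit circle. *)
Lemma joukowski_gap : Im z * normc u <= 1 - normc u ^+ 2.
Proof.
rewrite -(ler_pM2l nu0) mulrCA -expr2 mulrC Im_add_inv//.
have h : 0 <= 1 - normc u ^+ 2 by rewrite subr_ge0 expr_le1// ltW.
rewrite ler_wpM2r//; have := Im_le_normc u; rewrite ler_norml => /andP[h1 _].
by rewrite lerNl.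
Qed.

(** Keeps |u| away from 0 while z stays bounded, so that the factor |u| in [joukowski_gap] can be
    replaced by a constant. *)
Lemma joukowski_normc_ge : 1 <= normc u * (1 + normc z).
Proof.
have e : u^-1 = z - u by rewrite -uz; ring.
have : normc u^-1 <= normc z + normc u.
  by rewrite e; apply: (le_trans (le_normcD _ _)); rewrite normcN.
rewrite ComplexField.Normc.normcV => h.
rewrite -ler_pdivrMl// mulr1; apply: (le_trans h).
by rewrite addrC lerD2r ltW.
Qed.

(** Finite form of the generating function: the full series 1 + sum of u^k [chebT k x] equals (1 -
    u^2) / (1 - u x + u^2). *)
Lemma poisson_partial x K :
  (1 - u * (x%:C)%C + u ^+ 2) * (1 + \sum_(k < K) u ^+ k.+1 * (chebT k.+1 x)%:C%C) =
  1 - u ^+ 2 - u ^+ K.+1 * (chebT K.+1 x)%:C%C + u ^+ K.+2 * (chebT K x)%:C%C.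
Proof.
elim: K => [|K IH].
  rewrite big_ord0 /= (_ : (2%:C)%C = 2 :> R[i]); last by rewrite rmorph_nat.
  by ring.
pose f k := u ^+ k.+1 * (chebT k.+1 x)%:C%C.
have -> : \sum_(k < K.+1) f k = \sum_(k < K) f k + f K by rewrite big_ord_recr.
have rec : chebT K.+2 x = x * chebT K.+1 x - chebT K x by [].
by rewrite addrA mulrDr IH /f rec rmorphB rmorphM !(exprS u K.+1, exprS u K.+2, exprS u K); ring.
Qed.

(** Equal to 1 / (u^-1 - u), the common factor in 1 / (z - x) = [jcoef] times (1 + sum of u^k
    [chebT k x]). *)
Definition jcoef : R[i] := u / (1 - u ^+ 2).

Let u21 : 1 - u ^+ 2 != 0.
Proof.
apply/eqP => /eqP; rewrite subr_eq0 => /eqP e.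
have := congr1 normc e; rewrite normcX ComplexField.Normc.normc1 => e1.
have : normc u ^+ 2 < 1 by rewrite expr_lt1// normc_ge0.
by rewrite -e1 ltxx.
Qed.

Lemma normc_1Bsqr : 1 - normc u ^+ 2 <= normc (1 - u ^+ 2).
Proof. by apply: le_trans (ler_normcB _ _); rewrite normcX ComplexField.Normc.normc1. Qed.

Lemma resolvent_partial x K : `|x| <= 2 ->
  `|Im ((x%:C)%C - z)^-1 + Im jcoef + \sum_(k < K) Im (jcoef * u ^+ k.+1) * chebT k.+1 x| <=
  4 * normc u ^+ K.+1 / ((1 - normc u ^+ 2) * Im z).
Proof.
move=> x2.
pose q := 1 - u * (x%:C)%C + u ^+ 2.
have qE : q = u * (z - (x%:C)%C) by rewrite /q -uz; field.
have Imxz : Im (z - (x%:C)%C) = Im z by rewrite cImD cImN /= oppr0 addr0.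
have zx0 : z - (x%:C)%C != 0.
  by apply: contraTneq z0 => e; rewrite -Imxz e ltxx.
have q0 : q != 0 by rewrite qE mulf_neq0.
pose T k := (chebT k x)%:C%C : R[i].
pose rest := jcoef * u ^+ K.+1 * (T K.+1 - u * T K) / q.
have main : ((x%:C)%C - z)^-1 + jcoef * (1 + \sum_(k < K) u ^+ k.+1 * T k.+1) = - rest.
  have -> : ((x%:C)%C - z)^-1 = - (u / q).
    by rewrite qE -opprB invrN; congr (- _); field; rewrite u0 zx0.
  have := poisson_partial x K; rewrite -/q -/(T K.+1) -/(T K).
  set S := 1 + _ => e.
  have -> : S = (1 - u ^+ 2 - u ^+ K.+1 * T K.+1 + u ^+ K.+2 * T K) / q.
    by rewrite -e; field.
  by rewrite /rest /jcoef [u ^+ K.+2]exprS; field; rewrite q0 u21.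
have -> : Im ((x%:C)%C - z)^-1 + Im jcoef + \sum_(k < K) Im (jcoef * u ^+ k.+1) * chebT k.+1 x =
    Im (- rest).
  rewrite -main mulrDr mulr1 !cImD addrA; congr (_ + _).
  rewrite mulr_sumr (big_morph Im (@cImD R) (erefl (Im 0))); apply: eq_bigr => k _.
  by rewrite mulrA [RHS]cImM /= mulr0 add0r.
apply: (le_trans (Im_le_normc _)); rewrite normcN.
rewrite /rest /jcoef !(ComplexField.Normc.normcM, ComplexField.Normc.normcV) normcX.
have hT : normc (T K.+1 - u * T K) <= 4.
  apply: (le_trans (le_normcD _ _)); rewrite normcN ComplexField.Normc.normcM !normc_real.
  have := chebT_le K.+1 x2; have h := chebT_le K x2.
  have : normc u * `|chebT K x| <= 1 * 2 by rewrite ler_pM ?normc_ge0// ltW.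
  lra.
have hq : normc u * Im z <= normc q.
  rewrite qE ComplexField.Normc.normcM ler_pM2l// -Imxz.
  by apply: le_trans (Im_le_normc _); exact: ler_norm.
have g0 : 0 < 1 - normc u ^+ 2 by rewrite subr_gt0 expr_lt1// normc_ge0.
have gz : 0 < normc u * Im z by exact: mulr_gt0.
have hq0 : 0 < normc q by exact: lt_le_trans hq.
have hd := normc_1Bsqr.
have hd0 : 0 < normc (1 - u ^+ 2) by exact: lt_le_trans hd.
set U := normc u ^+ K.+1.
have U0 : 0 <= U by rewrite exprn_ge0// normc_ge0.
rewrite [leLHS](_ : _ = U * normc (T K.+1 - u * T K) * (normc u / (normc (1 - u ^+ 2) * normc q))); last first.
  by field; rewrite !gt_eqF.
rewrite [leRHS](_ : _ = U * 4 * (normc u / ((1 - normc u ^+ 2) * (normc u * Im z)))); last first.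
  by field; rewrite !gt_eqF.
apply: ler_pM.
- by rewrite mulr_ge0// normc_ge0.
- by apply: divr_ge0; rewrite ?mulr_ge0 ?normc_ge0.
- by rewrite ler_wpM2l.
rewrite ler_pM2l// lef_pV2 ?posrE ?mulr_gt0//.
by rewrite ler_pM// ltW.
Qed.

Lemma normc_jcoef_le : normc jcoef <= (1 - normc u ^+ 2)^-1.
Proof.
have g0 : 0 < 1 - normc u ^+ 2 by rewrite subr_gt0 expr_lt1// normc_ge0.
have hd := normc_1Bsqr.
rewrite /jcoef ComplexField.Normc.normcM ComplexField.Normc.normcV.
rewrite -[leRHS]mul1r ler_pM ?invr_ge0 ?normc_ge0//; first exact: ltW.
by rewrite lef_pV2// posrE (lt_le_trans g0).
Qed.

End Root.

(** Finite form of the series of k w^k, whose sum is w / (1 - w)^2. *)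
Lemma sum_kpow w K : (1 - w) ^+ 2 * \sum_(k < K) k.+1%:R * w ^+ k.+1 =
  w - K.+1%:R * w ^+ K.+1 + K%:R * w ^+ K.+2.
Proof.
elim: K => [|K IH]; first by rewrite big_ord0 /= expr1; ring.
rewrite big_ord_recr /= mulrDr IH -[K.+2%:R]natr1 -[K.+1%:R]natr1 !exprS; ring.
Qed.

Lemma Im_mul_Im z w : Im z * Im w = (Re (z * conjc w) - Re (z * w)) / 2.
Proof. by case: z w => a b [c d]; rewrite !cReM /=; field. Qed.

End Joukowski.

Lemma double_le_triple (k n : nat) : (k <= n)%N -> (0 < n)%N -> (k + k.+1 <= 3 * n)%N.
Proof. lia. Qed.

Lemma cvg_sum_seq (R : realType) (I : Type) (r : seq I) (f : I -> nat -> R) (l : I -> R) :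
  (forall i, f i n @[n --> \oo] --> l i) ->
  \sum_(i <- r) f i n @[n --> \oo] --> \sum_(i <- r) l i.
Proof.
move=> fl; elim: r => [|i r IH].
  by rewrite big_nil; under eq_cvg => n do rewrite big_nil; exact: cvg_cst.
by rewrite big_cons; under eq_cvg => n do rewrite big_cons; exact: cvgD.
Qed.

(** * Mesoscopic asymptotics: truncation error and limiting variance *)

Section Mesoscopic.
Variables (R : realType) (x0 alpha : R) (N : nat) (eta : 'I_N -> R[i]) (c : 'I_N -> R).
Notation Re := (@complex.Re R).
Notation Im := (@complex.Im R).
Notation normc := (@ComplexField.Normc.normc R).
Hypothesis x0b : -2 < x0 < 2.
Hypothesis alphab : 0 < alpha < 1.
Hypothesis eta0 : forall j, 0 < Im (eta j).

Let dlt (n : nat) : R := (n%:R `^ alpha)^-1.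

Let pow_gt0 n : (0 < n)%N -> 0 < n%:R `^ alpha :> R.
Proof. by move=> n0; rewrite powR_gt0// ltr0n. Qed.

Let pow_le n : (0 < n)%N -> n%:R `^ alpha <= n%:R :> R.
Proof.
move=> n0; rewrite -[leRHS]powRr1//; apply: ler_powR; first by rewrite ler1n.
by have /andP[_ /ltW] := alphab.
Qed.

Let pow_ge1 n : (0 < n)%N -> 1 <= n%:R `^ alpha :> R.
Proof.
move=> n0; rewrite -[leLHS](powRr0 n%:R); apply: ler_powR; first by rewrite ler1n.
by have /andP[/ltW] := alphab.
Qed.

Let dlt_gt0 n : (0 < n)%N -> 0 < dlt n.
Proof. by move=> n0; rewrite invr_gt0 pow_gt0. Qed.

Let dlt_le1 n : (0 < n)%N -> dlt n <= 1.
Proof. by move=> n0; rewrite invf_le1 ?pow_ge1// pow_gt0. Qed.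

Lemma inv_nat_cvg0 (C : R) : C / n%:R @[n --> \oo] --> (0 : R).
Proof.
rewrite -[X in _ --> X](mulr0 C); apply: cvgM; first exact: cvg_cst.
by apply/gtr0_cvgV0; [exists 1%N => // n /= n1; rewrite ltr0n|exact: cvgr_idn].
Qed.

Let dlt_cvg0 : dlt n @[n --> \oo] --> (0 : R).
Proof.
have /andP[a0 _] := alphab.
apply/gtr0_cvgV0; first by exists 1%N => // n /= n1; exact: pow_gt0.
apply/cvgryPge => M.
exists (Num.truncn (`|M| `^ alpha^-1)).+1 => // n /= hn.
have h : `|M| `^ alpha^-1 <= n%:R.
  apply: ltW; apply: (@lt_le_trans _ _ (Num.truncn (`|M| `^ alpha^-1)).+1%:R); last by rewrite ler_nat.
  by have /andP[] := truncn_itv (powR_ge0 `|M| alpha^-1).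
apply: (@le_trans _ _ ((`|M| `^ alpha^-1) `^ alpha)).
  by rewrite -powRrM mulVf ?gt_eqF// powRr1// ler_norm.
by rewrite ge0_ler_powR// ?nnegrE ?powR_ge0// ltW.
Qed.

(** The power is at most exp(-y) with y = (kap / r) n^(1 - alpha), and exp(-y) <= m! / y^m. The
    exponent 4 is what [geom_tail] spends: n on the end terms of the sum, n^2 on (1 - w)^-2, and 1 /
    n is left. *)
Lemma exp_tail (kap : R) (r : nat) : 0 < kap -> (0 < r)%N -> exists2 C, 0 <= C &
  forall n q, (0 < n)%N -> 0 <= q -> q <= 1 - kap * dlt n -> q ^+ (n %/ r).+1 <= C / n%:R ^+ 4.
Proof.
move=> k0 r0; have /andP[a0 a1] := alphab.
have r0' : 0 < r%:R :> R by rewrite ltr0n.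
have a1' : 0 < 1 - alpha by lra.
pose m := (Num.truncn (4 / (1 - alpha))).+1.
have hm : 4 <= m%:R * (1 - alpha).
  rewrite -ler_pdivrMr//; apply: ltW.
  by have /andP[] := @truncn_itv R (4 / (1 - alpha)) (divr_ge0 (ler0n _ 4) (ltW a1')).
have C0 : 0 <= m`!%:R * (r%:R / kap) ^+ m.
  by rewrite mulr_ge0// exprn_ge0// divr_ge0// ltW.
exists (m`!%:R * (r%:R / kap) ^+ m) => // n q n0 q0 q1.
have nR : 0 < n%:R :> R by rewrite ltr0n.
pose y := kap * dlt n * (n%:R / r%:R).
have y0 : 0 < y by rewrite !mulr_gt0 ?dlt_gt0 ?invr_gt0.
have qy : q ^+ (n %/ r).+1 <= expR (- y).
  apply: (@le_trans _ _ (expR (- (kap * dlt n)) ^+ (n %/ r).+1)).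
    rewrite lerXn2r ?nnegrE ?expR_ge0//; apply: (le_trans q1).
    exact: expR_ge1Dx.
  rewrite -expRM_natl ler_expR mulrN lerN2 /y [leRHS]mulrC ler_wpM2l//.
    by rewrite mulr_ge0 ?ltW ?dlt_gt0.
  by rewrite ler_pdivrMr// -natrM ler_nat ltnW// ltn_ceil.
have ym : y ^+ m / m`!%:R <= expR y.
  have h := @expR_ge1Dxn R y m.-1 (ltW y0).
  by apply: le_trans h; rewrite lerDr.
apply: (le_trans qy); rewrite expRN.
have f0 : 0 < (m`!)%:R :> R by rewrite ltr0n fact_gt0.
apply: (@le_trans _ _ (m`!%:R / y ^+ m)).
  rewrite -[leRHS]invf_div lef_pV2 ?posrE ?expR_gt0// divr_gt0// exprn_gt0//.
have yE : y = kap / r%:R * n%:R `^ (1 - alpha).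
  rewrite powRB; last by rewrite gt_eqF// implybT.
  by rewrite powRr1 ?ler0n// /y /dlt; field; rewrite !gt_eqF ?pow_gt0.
have n4 : n%:R ^+ 4 <= (n%:R `^ (1 - alpha)) ^+ m :> R.
  rewrite -[leRHS]powR_mulrn ?powR_ge0// -powRrM -[leLHS]powR_mulrn ?ler0n//.
  by apply: ler_powR; rewrite ?ler1n// mulrC.
rewrite yE exprMn -mulrA ler_pM2l//.
have n40 : 0 < n%:R ^+ 4 :> R by exact: exprn_gt0.
have e : ((kap / r%:R) ^+ m)^-1 = (r%:R / kap) ^+ m by rewrite -exprVn invf_div.
rewrite invfM e ler_wpM2l//; first by rewrite exprn_ge0// divr_ge0// ltW.
by rewrite lef_pV2 ?posrE// exprn_gt0// powR_gt0.
Qed.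

Variable u : nat -> 'I_N -> R[i].
Let z n j : R[i] := (x0%:C)%C + ((dlt n)%:C)%C * eta j.
Hypothesis u_root : forall n j, (0 < n)%N ->
  [/\ u n j != 0, normc (u n j) < 1 & u n j + (u n j)^-1 = z n j].

Let Im_z n j : Im (z n j) = dlt n * Im (eta j).
Proof. by rewrite /z cImD cImM /= mul0r addr0 add0r. Qed.

Let Im_z_gt0 n j : (0 < n)%N -> 0 < Im (z n j).
Proof. by move=> n0; rewrite Im_z mulr_gt0// dlt_gt0. Qed.

(** [joukowski_gap] and [joukowski_normc_ge] with one constant for all poles and all n > 0. *)
Let gap : exists kap, [/\ 0 < kap, kap <= 1, forall j, kap <= Im (eta j) &
  forall n j, (0 < n)%N -> normc (u n j) <= 1 - kap * dlt n /\
     kap * dlt n <= 1 - normc (u n j) ^+ 2].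
Proof.
pose B j : R := 1 + `|x0| + normc (eta j).
have B1 j : 1 <= B j by rewrite /B -addrA lerDl addr_ge0// normc_ge0.
have B0 j : 0 < B j by exact: lt_le_trans (B1 j).
(* The factor 2 leaves room to pass from |u|^2 <= 1 - 2 s to |u| <= 1 - s, as 1 - 2 s <= (1 -
   s)^2. *)
pose ki j := Im (eta j) / (2 * B j).
have ki0 j : 0 < ki j by rewrite divr_gt0// mulr_gt0.
(* The inverse of a sum of inverses lies below every [ki j] and below 1, and makes sense for an
   empty family too. *)
pose K := 1 + \sum_j (ki j)^-1.
have K1 : 1 <= K by rewrite lerDl sumr_ge0// => j _; rewrite invr_ge0 ltW.
have K0 : 0 < K by exact: lt_le_trans K1.
have Kj j : K^-1 <= ki j.
  rewrite -[leRHS]invrK lef_pV2 ?posrE ?invr_gt0// /K (bigD1 j)//= addrCA lerDl.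
  by rewrite addr_ge0// sumr_ge0// => i _; rewrite invr_ge0 ltW.
exists K^-1; split; first by rewrite invr_gt0.
- by rewrite invf_le1.
- move=> j; apply: (le_trans (Kj j)); rewrite ler_pdivrMr ?mulr_gt0//.
  by rewrite ler_peMr ?ltW//; have := B1 j; lra.
move=> n j n0; have [un0 un1 uz] := u_root j n0.
have d0 := dlt_gt0 n0.
have nz : 1 + normc (z n j) <= B j.
  rewrite /B -addrA lerD2l; apply: (le_trans (le_normcD _ _)).
  rewrite ComplexField.Normc.normcM !normc_real lerD2l.
  by rewrite ler_piMl ?normc_ge0// gtr0_norm ?dlt_le1.
have lowu : (B j)^-1 <= normc (u n j).
  have h := joukowski_normc_ge un0 un1 uz.
  rewrite -[leLHS]mul1r ler_pdivrMr//; apply: (le_trans h).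
  by rewrite ler_wpM2l ?normc_ge0.
have g := joukowski_gap un0 un1 uz; rewrite Im_z in g.
have g2 : 2 * (K^-1 * dlt n) <= 1 - normc (u n j) ^+ 2.
  apply: le_trans g; apply: (@le_trans _ _ (dlt n * Im (eta j) * (B j)^-1)).
    have -> : dlt n * Im (eta j) * (B j)^-1 = 2 * (ki j * dlt n).
      by rewrite /ki; field; rewrite gt_eqF.
    by rewrite ler_pM2l// ler_pM2r.
  by rewrite ler_wpM2l// ltW// mulr_gt0.
have kd0 : 0 <= K^-1 * dlt n by rewrite ltW// mulr_gt0// invr_gt0.
move: g2; have := normc_ge0 (u n j); move: (normc (u n j)) un1 => a a1 a0 g2.
by split; nra.
Qed.

Let F n x : R := \sum_(j < N) c j * Im (((n%:R `^ alpha * (x - x0))%:C)%C - eta j)^-1.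
Let cst n : R := - (dlt n * \sum_(j < N) c j * Im (jcoef (u n j))).
Let g n k : R := - (dlt n * \sum_(j < N) c j * Im (jcoef (u n j) * u n j ^+ k)).

Let F_resolvent n x : (0 < n)%N ->
  F n x = dlt n * \sum_(j < N) c j * Im ((x%:C)%C - z n j)^-1.
Proof.
move=> n0; rewrite mulr_sumr; apply: eq_bigr => j _.
have d0 : ((dlt n)%:C)%C != 0 :> R[i].
  by apply/eqP => /complexI e; have := dlt_gt0 n0; rewrite e ltxx.
have -> : ((n%:R `^ alpha * (x - x0))%:C)%C - eta j = ((dlt n)%:C)%C^-1 * ((x%:C)%C - z n j).
  have -> : n%:R `^ alpha = (dlt n)^-1 by rewrite invrK.
  by rewrite /z rmorphM rmorphB fmorphV; field.
by rewrite invfM invrK cImM /= mul0r addr0 mulrCA.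
Qed.

(** Rescaling writes [F n] as [dlt n] times a combination of resolvents at [z n j]. The bound of
    [resolvent_partial] loses only powers of n against the tail of [exp_tail]; the factor n in front
    pays for summing over n points. *)
Lemma mesoscopic_approx r : (0 < r)%N -> exists C, forall n x, `|x| <= 2 ->
  n%:R * `|F n x - cst n - \sum_(k < n %/ r) g n k.+1 * chebT k.+1 x| <= C / n%:R.
Proof.
move=> r0; have [kap [k0 k1 kI kn]] := gap.
have [C C0 hC] := exp_tail k0 r0.
exists (4 * (\sum_(j < N) `|c j|) * C / kap ^+ 2) => n x x2.
have [->|n0] := posnP n; first by rewrite mul0r invr0 mulr0.
have nR : 0 < n%:R :> R by rewrite ltr0n.
have n1 : 1 <= n%:R :> R by rewrite ler1n.
set K := (n %/ r)%N.
pose D j := Im ((x%:C)%C - z n j)^-1 + Im (jcoef (u n j)) +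
  \sum_(k < K) Im (jcoef (u n j) * u n j ^+ k.+1) * chebT k.+1 x.
have -> : F n x - cst n - \sum_(k < K) g n k.+1 * chebT k.+1 x = dlt n * \sum_(j < N) c j * D j.
  rewrite F_resolvent// /cst opprK -mulrDr.
  have -> : \sum_(k < K) g n k.+1 * chebT k.+1 x =
      - (dlt n * \sum_(j < N) c j * \sum_(k < K) Im (jcoef (u n j) * u n j ^+ k.+1) * chebT k.+1 x).
    rewrite -mulrN -sumrN mulr_sumr.
    under [RHS]eq_bigr do rewrite mulr_sumr -sumrN mulr_sumr.
    rewrite exchange_big; apply: eq_bigr => k _.
    rewrite /g mulNr -mulrA mulr_suml -mulrN -sumrN mulr_sumr; apply: eq_bigr => j _; ring.
  rewrite opprK -mulrDr -!big_split; congr (_ * _); apply: eq_bigr => j _.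
  by rewrite /D !mulrDr.
rewrite normrM (gtr0_norm (dlt_gt0 n0)).
have d0 := dlt_gt0 n0.
have hD j : dlt n * `|D j| <= 4 * C / (kap ^+ 2 * n%:R ^+ 3).
  have [un0 un1 uz] := u_root j n0.
  have [q1 q2] := kn n j n0.
  have h := resolvent_partial un0 un1 uz (Im_z_gt0 j n0) K x2.
  have kd : 0 < kap * dlt n by rewrite mulr_gt0.
  have gz := Im_z_gt0 j n0; have g1 := lt_le_trans kd q2.
  have h2 : `|D j| <= 4 * (C / n%:R ^+ 4) / ((kap * dlt n) * (dlt n * kap)).
    apply: (le_trans h); apply: ler_pM.
    - by rewrite mulr_ge0// exprn_ge0// normc_ge0.
    - by rewrite invr_ge0 ltW// mulr_gt0.
    - by rewrite ler_pM2l// hC// normc_ge0.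
    rewrite lef_pV2 ?posrE; last 2 first.
    - exact: mulr_gt0.
    - by rewrite !mulr_gt0.
    apply: ler_pM => //; [exact: ltW|by rewrite ltW// mulr_gt0|].
    by rewrite Im_z ler_pM2l.
  apply: (@le_trans _ _ (dlt n * (4 * (C / n%:R ^+ 4) / ((kap * dlt n) * (dlt n * kap))))).
    by rewrite ler_wpM2l// ltW.
  have -> : dlt n * (4 * (C / n%:R ^+ 4) / ((kap * dlt n) * (dlt n * kap))) =
     4 * C / (kap ^+ 2 * n%:R ^+ 4) * (dlt n)^-1 by field; rewrite !gt_eqF.
  have -> : 4 * C / (kap ^+ 2 * n%:R ^+ 3) = 4 * C / (kap ^+ 2 * n%:R ^+ 4) * n%:R.
    by field; rewrite !gt_eqF.
  rewrite ler_wpM2l//; last by rewrite /dlt invrK pow_le.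
  by rewrite divr_ge0// ?mulr_ge0// ltW// mulr_gt0// exprn_gt0.
have hS : dlt n * `|\sum_(j < N) c j * D j| <=
    (\sum_(j < N) `|c j|) * (4 * C / (kap ^+ 2 * n%:R ^+ 3)).
  apply: (@le_trans _ _ (dlt n * \sum_(j < N) `|c j| * `|D j|)).
    rewrite ler_pM2l//; apply: (le_trans (ler_norm_sum _ _ _)).
    by apply: ler_sum => j _; rewrite normrM.
  rewrite mulr_sumr mulr_suml; apply: ler_sum => j _.
  by rewrite mulrCA ler_wpM2l.
apply: (@le_trans _ _ (n%:R * ((\sum_(j < N) `|c j|) * (4 * C / (kap ^+ 2 * n%:R ^+ 3))))).
  by rewrite ler_wpM2l// ltW.
set S := \sum_(_ < _) _.
have S0 : 0 <= S by apply: sumr_ge0.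
have -> : n%:R * (S * (4 * C / (kap ^+ 2 * n%:R ^+ 3))) = 4 * S * C / kap ^+ 2 / n%:R * n%:R^-1.
  by field; rewrite !gt_eqF.
rewrite ler_piMr ?invf_le1//.
by rewrite !divr_ge0// ?mulr_ge0// ltW// exprn_gt0.
Qed.

Let sg : R := Num.sqrt (4 - x0 ^+ 2) / 2.
(** The root of w + 1 / w = x0 in the lower half-plane, the side on which [joukowski_Im_lt0] places
    the [u n j]. *)
Let om : R[i] := Complex (x0 / 2) (- sg).

Let sg_gt0 : 0 < sg.
Proof. by rewrite divr_gt0// sqrtr_gt0; have := x0b; nra. Qed.

Let sg_sqr : sg ^+ 2 = 1 - (x0 / 2) ^+ 2.
Proof. by rewrite /sg exprMn sqr_sqrtr; [field|have := x0b; nra]. Qed.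

Let om_conj : om * conjc om = 1.
Proof.
apply/eqP; rewrite eq_complex /= opprK; apply/andP; split; apply/eqP; last by ring.
by rewrite mulNr opprK -!expr2 sg_sqr; ring.
Qed.

Let om_neq0 : om != 0.
Proof. by apply: contra_eq_neq om_conj => ->; rewrite mul0r eq_sym oner_neq0. Qed.

Let om_conj_neq0 : conjc om != 0.
Proof. by rewrite conjc_eq0. Qed.

Let om_sub_neq0 : om - conjc om != 0.
Proof.
apply/eqP => e; have : Im (om - conjc om) = - (2 * sg) by rewrite cImD cImN /=; ring.
by rewrite e /= => /esym/eqP; rewrite oppr_eq0 gt_eqF// mulr_gt0.
Qed.

Let om_1B : 1 - om ^+ 2 = om * (conjc om - om).
Proof. by rewrite mulrBr om_conj expr2. Qed.

Let om_1B_neq0 : 1 - om ^+ 2 != 0.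
Proof. by rewrite om_1B mulf_neq0// -opprB oppr_eq0. Qed.

(** The product (u - om)(u - conj om) equals u [dlt n] eta. As Im u < 0, the second factor is at
    least [sg] in modulus, so the first is of order [dlt n]; this is where x0 strictly inside (-2,
    2) enters. *)
Let u_cvg j : cvgC (fun n => u n j) om.
Proof.
apply: (@cvgC_normc _ _ _ (fun n => dlt n * (normc (eta j) / sg))); last first.
  rewrite -[X in _ --> X](mul0r (normc (eta j) / sg)); apply: cvgM => //; exact: cvg_cst.
move=> n n0; have [un0 un1 uz] := u_root j n0.
have d0 := dlt_gt0 n0.
have e : (u n j - om) * (u n j - conjc om) = u n j * (((dlt n)%:C)%C * eta j).
  have -> : ((dlt n)%:C)%C * eta j = z n j - (x0%:C)%C by rewrite /z addrC addKr.
  have -> : (x0%:C)%C = om + conjc om by apply/eqP; rewrite eq_complex /= addrN eqxx andbT; apply/eqP; field.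
  rewrite -uz; transitivity (u n j * u n j - u n j * (om + conjc om) + om * conjc om); first by ring.
  by rewrite om_conj -(divff un0); ring.
have iu := joukowski_Im_lt0 un0 un1 uz (Im_z_gt0 j n0).
have low : sg <= normc (u n j - conjc om).
  apply: le_trans (Im_le_normc _); rewrite cImD cImN /= opprK ltr0_norm.
    by rewrite opprB lerBrDr gerDl ltW.
  by rewrite subr_lt0; apply: (lt_trans iu).
have := congr1 normc e; rewrite !ComplexField.Normc.normcM normc_real gtr0_norm// => en.
rewrite mulrA ler_pdivlMr//.
apply: (@le_trans _ _ (normc (u n j - om) * normc (u n j - conjc om))).
  by rewrite ler_wpM2l// normc_ge0.
by rewrite en ler_piMl ?mulr_ge0 ?normc_ge0 ?ltW.
Qed.

Let a n j := jcoef (u n j).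
Let dC n : R[i] := ((dlt n ^+ 2)%:C)%C.

Let a_cvg j : cvgC (fun n => a n j) (jcoef om).
Proof.
apply: cvgCM; first exact: u_cvg.
apply: cvgCV => //; apply: cvgCD; first exact: cvgC_cst.
by apply: cvgCN; apply: cvgCM; exact: u_cvg.
Qed.

Let dC_cvg : cvgC dC 0.
Proof.
split => /=; last exact: cvg_cst.
by rewrite -[X in _ --> X](mul0r (0 : R)); apply: cvgM; exact: dlt_cvg0.
Qed.

Let eta_conj j l : eta j - conjc (eta l) != 0.
Proof.
apply/eqP => e; have : 0 < Im (eta j - conjc (eta l)); last by rewrite e ltxx.
rewrite cImD cImN; case: (eta l) (eta0 l) => p q /= q0; rewrite opprK.
by rewrite addr_gt0.
Qed.

Let u_lt1 n j : (0 < n)%N -> normc (u n j) < 1.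
Proof. by move=> n0; have [] := u_root j n0. Qed.

Let normc_lt1_neq (w : R[i]) : normc w < 1 -> 1 - w != 0.
Proof.
move=> w1; apply: contraTneq w1 => /eqP; rewrite subr_eq0 => /eqP <-.
by rewrite ComplexField.Normc.normc1 ltxx.
Qed.

(* Both roots tend to [om = exp(- i theta0)], where [x0 = 2 cos theta0], and
   [|om| = 1]: hence [1 - u_j * conj u_l] tends to 0 at the rate [dlt n], while
   [1 - u_j * u_l] tends to [1 - om ^+ 2 != 0]. *)
Let diag_cvg j l : cvgC (fun n => dC n * (a n j * conjc (a n l)) *
    ((u n j * conjc (u n l)) / (1 - u n j * conjc (u n l)) ^+ 2))
  (- (eta j - conjc (eta l)) ^- 2).
Proof.
pose E := (eta j - conjc (eta l)) ^- 2.
have lim : jcoef om * conjc (jcoef om) * ((om - conjc om) * (om - conjc om) / (om * conjc om)) * E = - E.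
  rewrite om_conj divr1; have -> : conjc (jcoef om) = conjc om / (1 - conjc om ^+ 2).
    by rewrite /jcoef rmorphM fmorphV rmorphB rmorph1 rmorphXn.
  have -> : 1 - conjc om ^+ 2 = conjc om * (om - conjc om).
    by rewrite mulrBr [conjc om * om]mulrC om_conj expr2.
  rewrite /jcoef om_1B.
  have h : conjc om - om != 0 by rewrite -opprB oppr_eq0.
  by field; rewrite h om_neq0 om_conj_neq0 om_sub_neq0.
rewrite -lim.
apply: (@cvgC_near _ (fun n => a n j * conjc (a n l) *
  ((u n j - conjc (u n l)) * (u n j - conjc (u n l)) / (u n j * conjc (u n l))) * E)); last first.
  have cc := cvgC_conj (u_cvg l).
  apply: cvgCM; last exact: cvgC_cst.
  apply: cvgCM; first by apply: cvgCM => //; exact: cvgC_conj.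
  apply: cvgCM; first by apply: cvgCM; apply: cvgCD => //; exact: cvgCN.
  by apply: cvgCV; [rewrite om_conj oner_neq0|exact: cvgCM].
move=> n n0; have [uj0 uj1 uzj] := u_root j n0; have [ul0 ul1 uzl] := u_root l n0.
have vl0 : conjc (u n l) != 0 by rewrite conjc_eq0.
have w1 : normc (u n j * conjc (u n l)) < 1.
  rewrite ComplexField.Normc.normcM normc_conj.
  by apply: (le_lt_trans _ uj1); rewrite ler_piMr ?normc_ge0// ltW.
have hw := normc_lt1_neq w1.
(* Subtracting conj z_l from z_j = u_j + 1 / u_j gives an exact identity, by which [dlt n] / (1 - w)
   is expressed through quantities that converge. *)
have key : (u n j * conjc (u n l)) * (((dlt n)%:C)%C * (eta j - conjc (eta l))) =
    (u n j - conjc (u n l)) * (u n j * conjc (u n l) - 1).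
  have -> : ((dlt n)%:C)%C * (eta j - conjc (eta l)) = z n j - conjc (z n l).
    have -> : conjc (z n l) = (x0%:C)%C + ((dlt n)%:C)%C * conjc (eta l).
      rewrite /z; case: (eta l) => p q; apply/eqP; rewrite eq_complex /=.
      by apply/andP; split; apply/eqP; ring.
    by rewrite /z; ring.
  by rewrite -uzj -uzl rmorphD fmorphV /=; field; rewrite vl0.
have dC2 : dC n = ((dlt n)%:C)%C ^+ 2 by rewrite /dC rmorphXn.
have e2 : ((u n j * conjc (u n l)) * (((dlt n)%:C)%C * (eta j - conjc (eta l)))) ^+ 2 =
    ((u n j - conjc (u n l)) * (u n j * conjc (u n l) - 1)) ^+ 2 by rewrite key.
rewrite dC2 /E; move: e2 hw; set w := u n j * _ => e2 hw.
have w0 : w != 0 by rewrite mulf_neq0.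
have ee := eta_conj j l.
have -> : (u n j - conjc (u n l)) * (u n j - conjc (u n l)) =
    (w * (((dlt n)%:C)%C * (eta j - conjc (eta l)))) ^+ 2 / (1 - w) ^+ 2.
  by rewrite e2; field.
by field; rewrite hw w0 ee.
Qed.

Let offdiag_cvg j l : cvgC (fun n => dC n * (a n j * a n l) *
    ((u n j * u n l) / (1 - u n j * u n l) ^+ 2)) 0.
Proof.
rewrite -(mul0r ((om * om) / (1 - om * om) ^+ 2)) -(mul0r (jcoef om * jcoef om)).
apply: cvgCM; first by apply: cvgCM => //; exact: cvgCM.
apply: cvgCM; first exact: cvgCM.
have c1 : cvgC (fun n => 1 - u n j * u n l) (1 - om * om).
  by apply: cvgCD; [exact: cvgC_cst|apply: cvgCN; exact: cvgCM].
have n0 : 1 - om * om != 0 by rewrite -expr2.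
by apply: cvgCV; [rewrite expf_neq0|apply: cvgCM].
Qed.

(** Exchanges the full series w / (1 - w)^2 for its truncation at n / r: by [sum_kpow] the
    difference is explicit, and [exp_tail] beats the powers of n coming from the remaining
    factors. *)
Let geom_tail (kap C : R) r (w p q : nat -> R[i]) (l : R[i]) : 0 < kap -> kap <= 1 -> 0 <= C ->
  (forall n, (0 < n)%N -> [/\ normc (w n) <= 1 - kap * dlt n,
     normc (p n) * (kap * dlt n) <= 1 & normc (q n) * (kap * dlt n) <= 1]) ->
  (forall n x, (0 < n)%N -> 0 <= x -> x <= 1 - kap * dlt n -> x ^+ (n %/ r).+1 <= C / n%:R ^+ 4) ->
  cvgC (fun n => dC n * (p n * q n) * (w n / (1 - w n) ^+ 2)) l ->
  cvgC (fun n => dC n * (p n * q n) * \sum_(k < n %/ r) k.+1%:R * w n ^+ k.+1) l.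
Proof.
move=> k0 k1 C0 wpq tail cl; rewrite -[l]addr0.
pose D n := dC n * (p n * q n) * ((\sum_(k < n %/ r) k.+1%:R * w n ^+ k.+1) - w n / (1 - w n) ^+ 2).
have -> : (fun n => dC n * (p n * q n) * \sum_(k < n %/ r) k.+1%:R * w n ^+ k.+1) =
    (fun n => dC n * (p n * q n) * (w n / (1 - w n) ^+ 2) + D n).
  by apply/funext => n; rewrite /D; ring.
apply: cvgCD => //.
apply: (@cvgC_normc _ _ _ (fun n => (3 * C / kap ^+ 4) / n%:R)); last exact: inv_nat_cvg0.
move=> n n0; rewrite subr0; have [w1 p1 q1] := wpq n n0.
have d0 := dlt_gt0 n0.
have kd : 0 < kap * dlt n by rewrite mulr_gt0.
have nR : 0 < n%:R :> R by rewrite ltr0n.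
set K := (n %/ r)%N.
have wl1 : normc (w n) < 1 by apply: (le_lt_trans w1); rewrite gtrBl.
have hw := normc_lt1_neq wl1.
have low : kap * dlt n <= normc (1 - w n).
  apply: le_trans (ler_normcB _ _); rewrite ComplexField.Normc.normc1.
  by rewrite lerBrDr addrC -lerBrDr.
have wn0 := normc_ge0 (w n).
have DE : D n = dC n * (p n * q n) * (K%:R * w n ^+ K.+2 - K.+1%:R * w n ^+ K.+1) / (1 - w n) ^+ 2.
  rewrite /D -/K; have := sum_kpow (w n) K; set S := \sum_(_ < _) _ => e.
  have -> : S = (w n - K.+1%:R * w n ^+ K.+1 + K%:R * w n ^+ K.+2) / (1 - w n) ^+ 2.
    by rewrite -e; field.
  by field.
have normc_nat m : normc (m%:R : R[i]) = m%:R.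
  have -> : (m%:R : R[i]) = ((m%:R)%:C)%C by rewrite rmorph_nat.
  by rewrite normc_real normr_nat.
have hnum : normc (K%:R * w n ^+ K.+2 - K.+1%:R * w n ^+ K.+1) <= 3 * n%:R * (C / n%:R ^+ 4).
  apply: (le_trans (le_normcD _ _)); rewrite normcN !ComplexField.Normc.normcM !normc_nat !normcX.
  apply: (@le_trans _ _ ((K + K.+1)%:R * normc (w n) ^+ K.+1)).
    rewrite natrD mulrDl lerD2r ler_wpM2l//; apply: ler_piMl; last exact: ltW.
    exact: exprn_ge0.
  apply: ler_pM => //; [exact: exprn_ge0| |exact: tail].
  by rewrite -natrM ler_nat double_le_triple// leq_div.
rewrite DE !(ComplexField.Normc.normcM, ComplexField.Normc.normcV) -[normc (1 - w n) * _]expr2.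
rewrite /dC normc_real ger0_norm ?sqr_ge0//.
have hpq : dlt n ^+ 2 * (normc (p n) * normc (q n)) <= kap ^- 2.
  rewrite -[leRHS]mul1r ler_pdivlMr ?exprn_gt0//.
  have -> : dlt n ^+ 2 * (normc (p n) * normc (q n)) * kap ^+ 2 =
    (normc (p n) * (kap * dlt n)) * (normc (q n) * (kap * dlt n)) by ring.
  by rewrite -[leRHS]mulr1 ler_pM// mulr_ge0 ?normc_ge0// ltW.
have hinv : (normc (1 - w n) ^+ 2)^-1 <= kap ^- 2 * n%:R ^+ 2.
  have -> : kap ^- 2 * n%:R ^+ 2 = ((kap / n%:R) ^+ 2)^-1 by field; rewrite !gt_eqF.
  rewrite lef_pV2 ?posrE ?exprn_gt0 ?divr_gt0//; last exact: lt_le_trans low.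
  have kn' : kap / n%:R <= normc (1 - w n).
    apply: le_trans low; rewrite ler_pM2l// /dlt lef_pV2 ?posrE ?pow_gt0//.
    exact: pow_le.
  by apply: lerXn2r; rewrite ?nnegrE ?normc_ge0// divr_ge0// ltW.
have -> : 3 * C / kap ^+ 4 / n%:R = kap ^- 2 * (3 * n%:R * (C / n%:R ^+ 4)) * (kap ^- 2 * n%:R ^+ 2).
  by field; rewrite !gt_eqF.
have g0 : 0 <= dlt n ^+ 2 * (normc (p n) * normc (q n)).
  by rewrite !mulr_ge0 ?normc_ge0// ltW.
apply: ler_pM => //.
- by rewrite mulr_ge0// normc_ge0.
- by rewrite invr_ge0 exprn_ge0// normc_ge0.
- by apply: ler_pM => //; exact: normc_ge0.
Qed.

(** Squaring [g] gives products Im A Im B = (Re(A conj B) - Re(A B)) / 2, hence two families of sums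
    of k w^k: w = u_j conj u_l, which yields the limit, and w = u_j u_l, which disappears. *)
Lemma mesoscopic_variance r : (0 < r)%N ->
  \sum_(k < n %/ r) k.+1%:R * g n k.+1 ^+ 2 @[n --> \oo] -->
  \sum_(j < N) \sum_(l < N) c j * c l * (- Re ((eta j - conjc (eta l)) ^- 2) / 2).
Proof.
move=> r0; have [kap [k0 k1 kI kn]] := gap.
have [C C0 hC] := exp_tail k0 r0.
have a_bound n j : (0 < n)%N -> normc (a n j) * (kap * dlt n) <= 1.
  move=> n0; have [un0 un1 uz] := u_root j n0; have [q1 q2] := kn n j n0.
  have kd : 0 < kap * dlt n by rewrite mulr_gt0// dlt_gt0.
  rewrite -ler_pdivlMr// mul1r; apply: (le_trans (normc_jcoef_le un1)).
  by rewrite lef_pV2 ?posrE// (lt_le_trans kd).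
pose W n j l : R[i] := dC n * (a n j * conjc (a n l)) *
  \sum_(k < n %/ r) k.+1%:R * (u n j * conjc (u n l)) ^+ k.+1.
pose W' n j l : R[i] := dC n * (a n j * a n l) *
  \sum_(k < n %/ r) k.+1%:R * (u n j * u n l) ^+ k.+1.
have prod_le n (x y : R[i]) : (0 < n)%N -> normc x <= 1 - kap * dlt n -> normc y < 1 ->
    normc (x * y) <= 1 - kap * dlt n.
  move=> n0 hx hy; rewrite ComplexField.Normc.normcM; apply: le_trans hx.
  by rewrite ler_piMr ?normc_ge0// ltW.
have cW j l : cvgC (fun n => W n j l) (- (eta j - conjc (eta l)) ^- 2).
  apply: (geom_tail k0 k1 C0 _ hC); last exact: diag_cvg.
  move=> n n0; rewrite !normc_conj; split; [|exact: a_bound|exact: a_bound].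
  by apply: prod_le => //; [exact: (kn n j n0).1|rewrite normc_conj; exact: u_lt1].
have cW' j l : cvgC (fun n => W' n j l) 0.
  apply: (geom_tail k0 k1 C0 _ hC); last exact: offdiag_cvg.
  move=> n n0; split; [|exact: a_bound|exact: a_bound].
  by apply: prod_le => //; [exact: (kn n j n0).1|exact: u_lt1].
have VE n : \sum_(k < n %/ r) k.+1%:R * g n k.+1 ^+ 2 =
    \sum_(j < N) \sum_(l < N) c j * c l * ((Re (W n j l) - Re (W' n j l)) / 2).
  set K := (n %/ r)%N.
  pose I j k := Im (a n j * u n j ^+ k).
  have sq k : g n k ^+ 2 = \sum_(j < N) \sum_(l < N) c j * c l * (dlt n ^+ 2 * (I j k * I l k)).
    rewrite /g sqrrN exprMn expr2 [X in _ * X]expr2 mulr_suml mulr_sumr; apply: eq_bigr => j _.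
    rewrite mulr_sumr mulr_sumr; apply: eq_bigr => l _; rewrite /I /a; ring.
  under eq_bigr do rewrite sq mulr_sumr.
  rewrite exchange_big; apply: eq_bigr => j _.
  under eq_bigr do rewrite mulr_sumr.
  rewrite exchange_big; apply: eq_bigr => l _.
  under eq_bigr do rewrite mulrCA.
  rewrite -mulr_sumr; congr (_ * _).
  have ReW (x y : R[i]) (p : R[i]) : Re (dC n * x * \sum_(k < K) k.+1%:R * y ^+ k.+1) =
     \sum_(k < K) k.+1%:R * (dlt n ^+ 2 * Re (x * y ^+ k.+1)).
    rewrite mulr_sumr (big_morph Re (@cReD R) (erefl (Re 0))); apply: eq_bigr => k _.
    have -> : dC n * x * (k.+1%:R * y ^+ k.+1) = ((k.+1%:R * dlt n ^+ 2)%:C)%C * (x * y ^+ k.+1).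
      have e : ((k.+1%:R)%:C)%C = k.+1%:R :> R[i] by rewrite rmorph_nat.
      by rewrite /dC [((k.+1%:R * _)%:C)%C]rmorphM /= e; ring.
    by rewrite cReM /= mul0r subr0 mulrA.
  rewrite /W /W' !ReW// -sumrB mulr_suml; apply: eq_bigr => k _.
  rewrite /I Im_mul_Im.
  have -> : a n j * u n j ^+ k.+1 * conjc (a n l * u n l ^+ k.+1) =
      a n j * conjc (a n l) * (u n j * conjc (u n l)) ^+ k.+1.
    by rewrite rmorphM rmorphXn exprMn; ring.
  have -> : a n j * u n j ^+ k.+1 * (a n l * u n l ^+ k.+1) =
      a n j * a n l * (u n j * u n l) ^+ k.+1 by rewrite exprMn; ring.
  by ring.
under eq_cvg => n do rewrite VE.
apply: cvg_sum_seq => j; apply: cvg_sum_seq => l.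
apply: cvgM; first exact: cvg_cst.
apply: cvgM; last exact: cvg_cst.
rewrite -[X in _ --> X]subr0 -cReN; apply: cvgB; first exact: (cW j l).1.
exact: (cW' j l).1.
Qed.

End Mesoscopic.

(** * Integrals over the line of products of two resolvents *)

Section LineIntegrals.
Variable R : realType.
Notation mu := (@lebesgue_measure R).
Implicit Types (h k : R -> R) (a b x y : R).

(** Continuity and decay like 1 / y^2: a class closed under linear combinations that ensures
    integrability and contains the products of two resolvent parts. *)
Definition sqdecay h := continuous h /\ exists C, forall y, `|h y| <= C / (1 + y ^+ 2).
Definition lint h : R := Rintegral mu setT h.

Let oneD_gt0 y : 0 < 1 + y ^+ 2.
Proof. by rewrite ltr_pwDl// sqr_ge0. Qed.

Let integrable_base : mu.-integrable setT (EFin \o (fun y : R => (1 + y ^+ 2)^-1)).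
Proof.
have cf : continuous (fun y : R => (1 + y ^+ 2)^-1) by exact: continuous_oneDsqrV.
apply/integrableP; split.
  by apply/measurable_EFinP; exact: continuous_measurable_fun.
under eq_integral do rewrite /= ger0_norm ?invr_ge0 ?ltW//.
rewrite ge0_symfun_integralT//; last 2 first.
- by move=> x; rewrite invr_ge0 ltW.
- by move=> x /=; rewrite sqrrN.
have := @integral0y_oneDsqr R; rewrite set_itvcy => ->.
by rewrite -EFinM ltry.
Qed.

Lemma sqdecay_integrable h : sqdecay h -> mu.-integrable setT (EFin \o h).
Proof.
move=> [ch [C hC]].
have ib : mu.-integrable setT (EFin \o (fun y : R => `|C| * (1 + y ^+ 2)^-1)).
  by have := integrableZl measurableT `|C| integrable_base; apply: eq_integrable.
apply: le_integrable ib => //.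
  by apply/measurable_EFinP; exact: continuous_measurable_fun.
move=> y _ /=; rewrite lee_fin; apply: le_trans (ler_norm _).
apply: (le_trans (hC y)); rewrite ler_wpM2r ?ler_norm//.
by rewrite invr_ge0 ltW.
Qed.

Lemma sqdecayD h k : sqdecay h -> sqdecay k -> sqdecay (fun y => h y + k y).
Proof.
move=> [ch [C hC]] [ck [C' kC']]; split; first by move=> y; apply: cvgD; [exact: ch|exact: ck].
by exists (C + C') => y; apply: (le_trans (ler_normD _ _)); rewrite mulrDl lerD.
Qed.

Lemma sqdecayZ a h : sqdecay h -> sqdecay (fun y => a * h y).
Proof.
move=> [ch [C hC]]; split; first by move=> y; apply: cvgM; [exact: cvg_cst|exact: ch].
by exists (`|a| * C) => y; rewrite normrM -mulrA ler_wpM2l.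
Qed.

Lemma lintD h k : sqdecay h -> sqdecay k -> lint (fun y => h y + k y) = lint h + lint k.
Proof. by move=> dh dk; rewrite /lint RintegralD//; exact: sqdecay_integrable. Qed.

Lemma lintZ a h : sqdecay h -> lint (fun y => a * h y) = a * lint h.
Proof. by move=> dh; rewrite /lint RintegralZl//; exact: sqdecay_integrable. Qed.

Lemma sqdecay0 : sqdecay (fun=> 0).
Proof. by split; [move=> y; exact: cvg_cst|exists 0 => y; rewrite normr0 mul0r]. Qed.

Lemma sqdecay_sum (I : Type) (r : seq I) (f : I -> R -> R) :
  (forall i, sqdecay (f i)) -> sqdecay (fun y => \sum_(i <- r) f i y).
Proof.
move=> df; elim: r => [|i r IH].
  by under eq_fun do rewrite big_nil; exact: sqdecay0.
by under eq_fun do rewrite big_cons; exact: sqdecayD.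
Qed.

Lemma lint_sum (I : Type) (r : seq I) (f : I -> R -> R) : (forall i, sqdecay (f i)) ->
  lint (fun y => \sum_(i <- r) f i y) = \sum_(i <- r) lint (f i).
Proof.
move=> df; elim: r => [|i r IH].
  under eq_fun do rewrite big_nil; rewrite big_nil.
  rewrite -[RHS](mul0r (lint (fun=> 0))) -(lintZ 0 sqdecay0).
  by congr lint; apply/funext => y; rewrite mul0r.
under eq_fun do rewrite big_cons; rewrite big_cons lintD//; last exact: sqdecay_sum.
by rewrite IH.
Qed.

(** [resRe] and [resIm] are the real and imaginary parts of 1 / (y - eta) for eta = a + i b. *)
Definition resRe a b y := (y - a) / ((y - a) ^+ 2 + b ^+ 2).
Definition resIm a b y := b / ((y - a) ^+ 2 + b ^+ 2).

Section Bounds.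
Variables (a b : R).
Hypothesis b0 : 0 < b.

Let den_gt0 y : 0 < (y - a) ^+ 2 + b ^+ 2.
Proof. by rewrite ltr_wpDl ?sqr_ge0// exprn_gt0. Qed.

Lemma is_derive_den y : is_derive y 1 (fun y : R => (y - a) ^+ 2 + b ^+ 2) (2 * (y - a)).
Proof. by apply: is_derive_eq; rewrite /GRing.scale /=; ring. Qed.

Lemma is_derive_resIm y : is_derive y 1 (resIm a b) (- (2 * (resRe a b y * resIm a b y))).
Proof.
have d := is_derive_den y.
have dn : (y - a) ^+ 2 + b ^+ 2 != 0 by rewrite gt_eqF.
rewrite /resIm; apply: is_derive_eq.
by rewrite /GRing.scale /= /resRe; field.
Qed.

Lemma is_derive_resRe y : is_derive y 1 (resRe a b) (resIm a b y ^+ 2 - resRe a b y ^+ 2).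
Proof.
have d := is_derive_den y.
have dn : (y - a) ^+ 2 + b ^+ 2 != 0 by rewrite gt_eqF.
rewrite /resRe; apply: is_derive_eq.
by rewrite /GRing.scale /= /resIm; field.
Qed.

Lemma continuous_resIm : continuous (resIm a b).
Proof. exact: is_derive_continuous is_derive_resIm. Qed.

Lemma continuous_resRe : continuous (resRe a b).
Proof. exact: is_derive_continuous is_derive_resRe. Qed.

Lemma resIm_ge0 y : 0 <= resIm a b y.
Proof. by rewrite divr_ge0// ltW. Qed.

Lemma res_sqr y : resRe a b y ^+ 2 + resIm a b y ^+ 2 = resIm a b y / b.
Proof. by rewrite /resRe /resIm; field; rewrite !gt_eqF. Qed.

Lemma sqdecay_resIm : sqdecay (resIm a b).
Proof.
split; first exact: continuous_resIm.
have bb : 0 < b ^+ 2 by exact: exprn_gt0.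
exists (b * (2 + (1 + 2 * a ^+ 2) / b ^+ 2)) => y; rewrite (ger0_norm (resIm_ge0 y)) /resIm.
rewrite ler_pdivlMr ?oneD_gt0// mulrAC ler_pdivrMr ?den_gt0// -mulrA ler_pM2l//.
have e : (2 + (1 + 2 * a ^+ 2) / b ^+ 2) * ((y - a) ^+ 2 + b ^+ 2) =
   2 * (y - a) ^+ 2 + 2 * b ^+ 2 + (1 + 2 * a ^+ 2) + (1 + 2 * a ^+ 2) / b ^+ 2 * (y - a) ^+ 2.
  by field; rewrite gt_eqF.
rewrite e.
have h : 0 <= (1 + 2 * a ^+ 2) / b ^+ 2 * (y - a) ^+ 2.
  apply: mulr_ge0; last exact: sqr_ge0.
  by apply: divr_ge0; [rewrite addr_ge0// mulr_ge0// sqr_ge0|exact: ltW].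
have h2 : y ^+ 2 <= 2 * (y - a) ^+ 2 + 2 * a ^+ 2.
  by have := sqr_ge0 (y - 2 * a); nra.
have := sqr_ge0 b; lra.
Qed.

End Bounds.

Lemma sqdecay_dom h k l : continuous h -> sqdecay k -> sqdecay l ->
  (forall y, `|h y| <= k y + l y) -> sqdecay h.
Proof.
move=> ch dk dl b; split=> //; have [_ [C hC]] := sqdecayD dk dl.
by exists C => y; apply: le_trans (hC y); apply: le_trans (b y) _; exact: ler_norm.
Qed.

(** The sign [s], with s^2 = 1, treats both ends of the line at once. *)
Let cvg_scale_inv (y : nat -> R) (s a b : R) : s ^+ 2 = 1 ->
  (forall n, y n = s * n%:R) -> n%:R^-1 ^+ 2 * ((y n - a) ^+ 2 + b ^+ 2) @[n --> \oo] --> (1 : R).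
Proof.
move=> s2 yE; have i0 : (n%:R^-1 : R) @[n --> \oo] --> (0 : R).
  have := @inv_nat_cvg0 R 1; by under eq_cvg => n do rewrite mul1r.
have e : (s - 0 * a) ^+ 2 + (0 * b) ^+ 2 = 1 :> R by rewrite !mul0r subr0 s2 expr0n addr0.
rewrite -[X in _ --> X]e.
apply: (@cvg_trans _ (((s - n%:R^-1 * a) ^+ 2 + (n%:R^-1 * b) ^+ 2) @[n --> \oo])).
  apply: near_eq_cvg; exists 1%N => // n /= n1; rewrite yE.
  by field; rewrite pnatr_eq0 -lt0n.
have ca (c : R) : n%:R^-1 * c @[n --> \oo] --> 0 * c by apply: cvgM => //; exact: cvg_cst.
have cs : (s - n%:R^-1 * a) @[n --> \oo] --> s - 0 * a by apply: cvgB => //; exact: cvg_cst.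
by apply: cvgD; rewrite expr2; apply: cvgM.
Qed.

Let cvg_den_inv (y : nat -> R) (s a b : R) : s ^+ 2 = 1 ->
  (forall n, y n = s * n%:R) -> ((y n - a) ^+ 2 + b ^+ 2)^-1 * n%:R ^+ 2 @[n --> \oo] --> (1 : R).
Proof.
move=> s2 yE; rewrite -[X in _ --> X]invr1.
rewrite (_ : (fun n => _) = (fun n => (n%:R^-1 ^+ 2 * ((y n - a) ^+ 2 + b ^+ 2))^-1)).
  by apply: cvgV; [exact: oner_neq0|exact: cvg_scale_inv s2 yE].
by apply/funext => n; rewrite invfM exprVn invrK mulrC.
Qed.

Lemma resRe_cvg0 (y : nat -> R) (s a b : R) : s ^+ 2 = 1 -> (forall n, y n = s * n%:R) ->
  resRe a b (y n) @[n --> \oo] --> (0 : R).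
Proof.
move=> s2 yE; have i0 : (n%:R^-1 : R) @[n --> \oo] --> (0 : R).
  have := @inv_nat_cvg0 R 1; by under eq_cvg => n do rewrite mul1r.
have e : (0 * (s - 0 * a)) * 1 = 0 :> R by rewrite !mul0r.
rewrite -[X in _ --> X]e.
apply: (@cvg_trans _ ((n%:R^-1 * (s - n%:R^-1 * a)) * (((y n - a) ^+ 2 + b ^+ 2)^-1 * n%:R ^+ 2) @[n --> \oo])).
  apply: near_eq_cvg; exists 1%N => // n /= n1.
  have n0 : n%:R != 0 :> R by rewrite pnatr_eq0 -lt0n.
  by rewrite /resRe; move: ((y n - a) ^+ 2 + b ^+ 2)^-1 => X; rewrite yE; field.
apply: cvgM; last exact: cvg_den_inv s2 yE.
apply: cvgM => //; apply: cvgB; first exact: cvg_cst.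
by apply: cvgM => //; exact: cvg_cst.
Qed.

Lemma resIm_cvg0 (y : nat -> R) (s a b : R) : s ^+ 2 = 1 -> (forall n, y n = s * n%:R) ->
  resIm a b (y n) @[n --> \oo] --> (0 : R).
Proof.
move=> s2 yE; have i0 : (n%:R^-1 : R) @[n --> \oo] --> (0 : R).
  have := @inv_nat_cvg0 R 1; by under eq_cvg => n do rewrite mul1r.
have e : (0 * 0 * b) * 1 = 0 :> R by rewrite !mul0r.
rewrite -[X in _ --> X]e.
apply: (@cvg_trans _ ((n%:R^-1 * n%:R^-1 * b) * (((y n - a) ^+ 2 + b ^+ 2)^-1 * n%:R ^+ 2) @[n --> \oo])).
  apply: near_eq_cvg; exists 1%N => // n /= n1.
  have n0 : n%:R != 0 :> R by rewrite pnatr_eq0 -lt0n.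
  by rewrite /resIm; move: ((y n - a) ^+ 2 + b ^+ 2)^-1 => X; field.
apply: cvgM; last exact: cvg_den_inv s2 yE.
by apply: cvgM; [exact: cvgM|exact: cvg_cst].
Qed.

Lemma cvg_affine_y (a b : R) : 0 < b -> (n%:R - a) / b @[n --> \oo] --> +oo.
Proof.
move=> b0; apply/cvgryPge => M.
exists (Num.truncn `|M * b + a|).+1 => // n /= hn.
rewrite ler_pdivlMr// lerBrDr; apply: (le_trans (ler_norm _)); apply: ltW.
apply: (@lt_le_trans _ _ (Num.truncn `|M * b + a|).+1%:R); last by rewrite ler_nat.
by have /andP[] := truncn_itv (normr_ge0 (M * b + a)).
Qed.

Let one_sqr : (1 : R) ^+ 2 = 1. Proof. exact: expr1n. Qed.
Let mone_sqr : (-1 : R) ^+ 2 = 1. Proof. by rewrite sqrrN expr1n. Qed.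
Let one_seq (n : nat) : n%:R = 1 * n%:R :> R. Proof. by rewrite mul1r. Qed.
Let mone_seq (n : nat) : - n%:R = -1 * n%:R :> R. Proof. by rewrite mulN1r. Qed.

Lemma lint_FTC0 (f F : R -> R) : sqdecay f -> (forall x : R, is_derive x 1 F (f x)) ->
  (forall (y : nat -> R) (s : R), s ^+ 2 = 1 -> (forall n, y n = s * n%:R) ->
     F (y n) @[n --> \oo] --> (0 : R)) -> lint f = 0.
Proof.
move=> df dF F0; rewrite -[RHS](subrr 0) /lint.
apply: (integral_line_FTC df.1 dF (sqdecay_integrable df)).
  exact: (F0 _ 1).
exact: (F0 _ (-1)).
Qed.

Lemma lint_resIm a b : 0 < b -> lint (resIm a b) = pi.
Proof.
move=> b0; have bn : b != 0 by rewrite gt_eqF.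
pose F y := atan ((y - a) / b).
have dF (y : R) : is_derive y 1 F (resIm a b y).
  have d1 : is_derive y 1 (fun y => (y - a) / b) b^-1.
    by apply: is_derive_eq; rewrite /GRing.scale /=; ring.
  have d2 := @is_derive1_comp _ (@atan R) (fun y => (y - a) / b) y _ _ (is_derive1_atan _) d1.
  apply: (is_derive_eq d2); rewrite /GRing.scale /= /resIm; field.
  by rewrite bn andbT gt_eqF// ltr_wpDl ?sqr_ge0// exprn_gt0.
have c (a' : R) : atan ((n%:R - a') / b) @[n --> \oo] --> (pi / 2 : R).
  exact: (cvg_comp _ _ (cvg_affine_y a' b0) (@cvgy_atan R)).
transitivity (pi / 2 - (- (pi / 2)) : R); last by field.
rewrite /lint; apply: (@integral_line_FTC R (resIm a b) F (pi / 2) (- (pi / 2)) (@continuous_resIm a b b0) dF).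
- exact: sqdecay_integrable (sqdecay_resIm a b0).
- exact: c.
- rewrite (_ : (fun n => _) = (fun n => - atan ((n%:R - (- a)) / b))).
    by apply: cvgN; exact: c.
  by apply/funext => n; rewrite /F -atanN; congr atan; field.
Qed.

Section TwoPoints.
Variables (a b a' b' : R).
Hypotheses (b0 : 0 < b) (b0' : 0 < b').
Local Notation P := (resRe a b).
Local Notation Q := (resIm a b).
Local Notation P' := (resRe a' b').
Local Notation Q' := (resIm a' b').

Let prod_decay h k : continuous h -> continuous k ->
  (forall y, h y ^+ 2 <= Q y / b) -> (forall y, k y ^+ 2 <= Q' y / b') ->
  sqdecay (fun y => h y * k y).
Proof.
move=> ch ck hh hk.
apply: (@sqdecay_dom _ (fun y => b^-1 * Q y) (fun y => b'^-1 * Q' y)).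
- by move=> y; apply: cvgM; [exact: ch|exact: ck].
- by apply: sqdecayZ; exact: sqdecay_resIm.
- by apply: sqdecayZ; exact: sqdecay_resIm.
move=> y; have := hh y; have := hk y; rewrite [_^-1 * Q y]mulrC [_^-1 * Q' y]mulrC.
move: (Q y / b) (Q' y / b') => u v; rewrite ler_norml.
have := sqr_ge0 (h y - k y); have := sqr_ge0 (h y + k y) => *.
have := sqr_ge0 (h y); have := sqr_ge0 (k y) => *.
by apply/andP; split; nra.
Qed.

Let PQb (p q : R) (q0 : 0 < q) y : resRe p q y ^+ 2 <= resIm p q y / q.
Proof. by rewrite -(res_sqr p q0) lerDl sqr_ge0. Qed.
Let QQb (p q : R) (q0 : 0 < q) y : resIm p q y ^+ 2 <= resIm p q y / q.
Proof. by rewrite -(res_sqr p q0) lerDr sqr_ge0. Qed.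

Lemma sqdecay_ReRe : sqdecay (fun y => P y * P' y).
Proof. by apply: prod_decay; [exact: continuous_resRe|exact: continuous_resRe|exact: PQb|exact: PQb]. Qed.
Lemma sqdecay_ReIm : sqdecay (fun y => P y * Q' y).
Proof. by apply: prod_decay; [exact: continuous_resRe|exact: continuous_resIm|exact: PQb|exact: QQb]. Qed.
Lemma sqdecay_ImRe : sqdecay (fun y => Q y * P' y).
Proof. by apply: prod_decay; [exact: continuous_resIm|exact: continuous_resRe|exact: QQb|exact: PQb]. Qed.
Lemma sqdecay_ImIm : sqdecay (fun y => Q y * Q' y).
Proof. by apply: prod_decay; [exact: continuous_resIm|exact: continuous_resIm|exact: QQb|exact: QQb]. Qed.

Let den_gt0 (p q : R) y : 0 < q -> 0 < (y - p) ^+ 2 + q ^+ 2.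
Proof. by move=> q0; rewrite ltr_wpDl ?sqr_ge0// exprn_gt0. Qed.

Let PP := lint (fun y => P y * P' y).
Let PQ := lint (fun y => P y * Q' y).
Let QP := lint (fun y => Q y * P' y).
Let QQ := lint (fun y => Q y * Q' y).

(** A single [resRe] decays only like 1 / y; the difference of two is a combination of products,
    hence integrable, and half the logarithm of the quotient of the denominators is a primitive that
    vanishes at both ends. *)
Lemma lint_resRe_sub : sqdecay (fun y => P y - P' y) /\ lint (fun y => P y - P' y) = 0.
Proof.
have e y : P y - P' y = (a - a') * (P y * P' y) + ((a - a') * (Q y * Q' y) +
    ((- (b + b')) * (Q y * P' y) + (b + b') * (P y * Q' y))).
  rewrite /resRe /resIm; field.
  by rewrite !gt_eqF// den_gt0.
have dd : sqdecay (fun y => P y - P' y).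
  under eq_fun do rewrite e.
  apply: sqdecayD; first by apply: sqdecayZ; exact: sqdecay_ReRe.
  apply: sqdecayD; first by apply: sqdecayZ; exact: sqdecay_ImIm.
  by apply: sqdecayD; apply: sqdecayZ; [exact: sqdecay_ImRe|exact: sqdecay_ReIm].
split=> //.
pose F y := 2^-1 * (ln ((y - a) ^+ 2 + b ^+ 2) - ln ((y - a') ^+ 2 + b' ^+ 2)).
apply: (@lint_FTC0 _ F) => //.
  move=> y.
  have dl (c d : R) (d0 : 0 < d) : is_derive y 1 (fun y : R => ln ((y - c) ^+ 2 + d ^+ 2)) (2 * resRe c d y).
    have h := @is_derive1_comp _ (@ln R) (fun y => (y - c) ^+ 2 + d ^+ 2) y _ _ (is_derive1_ln (den_gt0 c y d0)) (is_derive_den c d y).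
    by apply: (is_derive_eq h); rewrite /GRing.scale /= /resRe; ring.
  have h := is_deriveZ 2^-1 (is_deriveB (dl a b b0) (dl a' b' b0')).
  by apply: (is_derive_eq h); rewrite /GRing.scale /=; field.
move=> y s s2 yE.
have ln0 (c d : R) : 0 < d -> ln (n%:R^-1 ^+ 2 * ((y n - c) ^+ 2 + d ^+ 2)) @[n --> \oo] --> (0 : R).
  move=> d0; rewrite -[X in _ --> X](@ln1 R).
  exact: (cvg_comp _ _ (cvg_scale_inv c d s2 yE) (continuous_ln ltr01)).
have z : 2^-1 * (0 - 0) = 0 :> R by rewrite subrr mulr0.
rewrite -[X in _ --> X]z.
(* Each logarithm diverges. A factor n^-2 inserted in both cancels in the difference and makes the
   two arguments tend to 1. *)
apply: (@cvg_trans _ ((2^-1 * (ln (n%:R^-1 ^+ 2 * ((y n - a) ^+ 2 + b ^+ 2)) -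
   ln (n%:R^-1 ^+ 2 * ((y n - a') ^+ 2 + b' ^+ 2)))) @[n --> \oo])).
  apply: near_eq_cvg; exists 1%N => // n /= n1.
  have i0 : 0 < (n%:R^-1 : R) by rewrite invr_gt0 ltr0n.
  rewrite /F !lnM ?posrE ?den_gt0 ?i0//=.
  - by ring.
  - exact: exprn_gt0.
  - exact: exprn_gt0.
by apply: cvgM; [exact: cvg_cst|apply: cvgB; exact: ln0].
Qed.

Lemma lint_resIm_add : lint (fun y => Q y + Q' y) = 2 * pi.
Proof. by rewrite lintD ?lint_resIm//; [ring|exact: sqdecay_resIm|exact: sqdecay_resIm]. Qed.

(* With [r = P + iQ = 1 / (y - eta)], the real and imaginary parts of
   [r - conj r' = (eta - conj eta') * r * conj r'] give a linear system. *)
Let mixed : PP + QQ = 2 * pi * (b + b') / ((a - a') ^+ 2 + (b + b') ^+ 2) /\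
  QP - PQ = 2 * pi * (a - a') / ((a - a') ^+ 2 + (b + b') ^+ 2).
Proof.
have dPP := sqdecay_ReRe; have dPQ := sqdecay_ReIm.
have dQP := sqdecay_ImRe; have dQQ := sqdecay_ImIm.
have e1 : (a - a') * (PP + QQ) - (b + b') * (QP - PQ) = 0.
  rewrite -lint_resRe_sub.2.
  transitivity (lint (fun y => (a - a') * (P y * P' y) + ((a - a') * (Q y * Q' y) +
    ((- (b + b')) * (Q y * P' y) + (b + b') * (P y * Q' y))))).
    rewrite lintD ?lintD ?lintZ -/PP -/QQ -/PQ -/QP; first ring; by repeat (exact: dPP || exact: dPQ || exact: dQP || exact: dQQ || apply: sqdecayZ || apply: sqdecayD).
  congr lint; apply/funext => y; rewrite /resRe /resIm; field.
  by rewrite !gt_eqF// den_gt0.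
have e2 : (b + b') * (PP + QQ) + (a - a') * (QP - PQ) = 2 * pi.
  rewrite -lint_resIm_add.
  transitivity (lint (fun y => (b + b') * (P y * P' y) + ((b + b') * (Q y * Q' y) +
    ((a - a') * (Q y * P' y) + (- (a - a')) * (P y * Q' y))))).
    rewrite lintD ?lintD ?lintZ -/PP -/QQ -/PQ -/QP; first ring; by repeat (exact: dPP || exact: dPQ || exact: dQP || exact: dQQ || apply: sqdecayZ || apply: sqdecayD).
  congr lint; apply/funext => y; rewrite /resRe /resIm; field.
  by rewrite !gt_eqF// den_gt0.
have D0 : (a - a') ^+ 2 + (b + b') ^+ 2 != 0.
  by rewrite gt_eqF// ltr_wpDl ?sqr_ge0// exprn_gt0// addr_gt0.
move: e1 e2 D0; move: (a - a') (b + b') (PP + QQ) (QP - PQ) => d s X Y e1 e2 D0.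
split; apply/eqP; rewrite eq_sym -(inj_eq (mulIf D0)) divfK//; apply/eqP; rewrite -e2.
  by transitivity (s * (s * X + d * Y) + d * (d * X - s * Y)); [rewrite e1; ring|ring].
by transitivity (d * (s * X + d * Y) - s * (d * X - s * Y)); [rewrite e1; ring|ring].
Qed.

(* When [eta = eta'], [- r * r'] is the derivative of [r]; otherwise
   [r - r' = (eta - eta') * r * r'] gives a linear system as above. *)
Let diagonal : a = a' -> b = b' -> PP - QQ = 0 /\ PQ + QP = 0.
Proof.
move=> ea eb; have z (x : R) : - x = 0 -> x = 0 by move/eqP; rewrite oppr_eq0 => /eqP.
have d1 : sqdecay (fun y => Q y * Q' y + (-1) * (P y * P' y)).
  by apply: sqdecayD; [exact: sqdecay_ImIm|apply: sqdecayZ; exact: sqdecay_ReRe].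
have d2 : sqdecay (fun y => (-1) * (P y * Q' y + Q y * P' y)).
  by apply: sqdecayZ; apply: sqdecayD; [exact: sqdecay_ReIm|exact: sqdecay_ImRe].
split; apply: z.
  rewrite (_ : - (PP - QQ) = lint (fun y => Q y * Q' y + (-1) * (P y * P' y))); last first.
    rewrite lintD ?lintZ -/PP -/QQ; first ring; by repeat (exact: sqdecay_ReRe || exact: sqdecay_ImIm || apply: sqdecayZ).
  apply: (@lint_FTC0 _ P d1).
    by move=> y; apply: (is_derive_eq (is_derive_resRe a b0 y)); rewrite -ea -eb; ring.
  by move=> y s s2 yE; exact: resRe_cvg0 s2 yE.
rewrite (_ : - (PQ + QP) = lint (fun y => (-1) * (P y * Q' y + Q y * P' y))); last first.
  rewrite lintZ ?lintD -/PQ -/QP; first ring; by repeat (exact: sqdecay_ReIm || exact: sqdecay_ImRe || apply: sqdecayD).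
apply: (@lint_FTC0 _ Q d2).
  by move=> y; apply: (is_derive_eq (is_derive_resIm a b0 y)); rewrite -ea -eb; ring.
by move=> y s s2 yE; exact: resIm_cvg0 s2 yE.
Qed.

Let offdiagonal : PP - QQ = 0 /\ PQ + QP = 0.
Proof.
have [[ea eb]|ne] := pselect (a = a' /\ b = b'); first exact: diagonal.
have dPP := sqdecay_ReRe; have dPQ := sqdecay_ReIm.
have dQP := sqdecay_ImRe; have dQQ := sqdecay_ImIm.
have e1 : (a - a') * (PP - QQ) - (b - b') * (PQ + QP) = 0.
  rewrite -lint_resRe_sub.2.
  transitivity (lint (fun y => (a - a') * (P y * P' y) + ((- (a - a')) * (Q y * Q' y) +
    ((- (b - b')) * (Q y * P' y) + (- (b - b')) * (P y * Q' y))))).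
    rewrite lintD ?lintD ?lintZ -/PP -/QQ -/PQ -/QP; first ring; by repeat (exact: dPP || exact: dPQ || exact: dQP || exact: dQQ || apply: sqdecayZ || apply: sqdecayD).
  congr lint; apply/funext => y; rewrite /resRe /resIm; field.
  by rewrite !gt_eqF// den_gt0.
have e2 : (b - b') * (PP - QQ) + (a - a') * (PQ + QP) = 0.
  have e : lint (fun y => Q y + (-1) * Q' y) = 0.
    by rewrite lintD ?(lintZ (-1)) ?lint_resIm//; [ring|exact: sqdecay_resIm|exact: sqdecay_resIm|apply: sqdecayZ; exact: sqdecay_resIm].
  rewrite -e.
  transitivity (lint (fun y => (b - b') * (P y * P' y) + ((- (b - b')) * (Q y * Q' y) +
    ((a - a') * (Q y * P' y) + (a - a') * (P y * Q' y))))).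
    rewrite lintD ?lintD ?lintZ -/PP -/QQ -/PQ -/QP; first ring; by repeat (exact: dPP || exact: dPQ || exact: dQP || exact: dQQ || apply: sqdecayZ || apply: sqdecayD).
  congr lint; apply/funext => y; rewrite /resRe /resIm; field.
  by rewrite !gt_eqF// den_gt0.
have D0 : (a - a') ^+ 2 + (b - b') ^+ 2 != 0.
  apply/negP; rewrite paddr_eq0 ?sqr_ge0// !sqrf_eq0 !subr_eq0 => /andP[/eqP ? /eqP ?].
  exact: ne.
move: e1 e2 D0; move: (a - a') (b - b') (PP - QQ) (PQ + QP) => d s X Y e1 e2 D0.
split; apply/eqP; rewrite -(mulIr_eq0 _ (mulIf D0)); apply/eqP.
  by transitivity (s * (s * X + d * Y) + d * (d * X - s * Y)); [ring|rewrite e1 e2; ring].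
by transitivity (d * (s * X + d * Y) - s * (d * X - s * Y)); [ring|rewrite e1 e2; ring].
Qed.

Local Notation D2 := ((a - a') ^+ 2 + (b + b') ^+ 2).

Lemma lint_res_products :
  [/\ lint (fun y => P y * P' y) = pi * (b + b') / D2,
      lint (fun y => Q y * Q' y) = pi * (b + b') / D2,
      lint (fun y => Q y * P' y) = pi * (a - a') / D2 &
      lint (fun y => P y * Q' y) = - (pi * (a - a') / D2)].
Proof.
rewrite -/PP -/QQ -/PQ -/QP; have [e1 e2] := mixed; have [e3 e4] := offdiagonal.
move: e1 e2 e3 e4; rewrite -!mulrA; move: ((b + b') / D2) ((a - a') / D2) => M L e1 e2 e3 e4.
by split; lra.
Qed.

End TwoPoints.

End LineIntegrals.

(** * The double integral defining the variance *)

Section VarianceFunctional.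
Variables (R : realType) (N : nat) (a b c : 'I_N -> R).
Hypothesis b0 : forall j, 0 < b j.
Notation mu := (@lebesgue_measure R).
Local Notation P j := (resRe (a j) (b j)).
Local Notation Q j := (resIm (a j) (b j)).

Let f x := \sum_(j < N) c j * Q j x.

Let G x y := \sum_(j < N) \sum_(l < N) c j * c l *
  (P j x * P l x * (Q j y * Q l y) + (P j x * Q l x * (Q j y * P l y) +
  (Q j x * P l x * (P j y * Q l y) + Q j x * Q l x * (P j y * P l y)))).

Let M j l := pi * (b j + b l) / ((a j - a l) ^+ 2 + (b j + b l) ^+ 2).
Let L j l := pi * (a j - a l) / ((a j - a l) ^+ 2 + (b j + b l) ^+ 2).

(** Imaginary part of r(x) - r(y) = - (x - y) r(x) r(y). Dividing by x - y leaves products that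
    separate the variables. *)
Let resIm_sub j x y :
  Q j x - Q j y = - (x - y) * (P j x * Q j y + Q j x * P j y).
Proof.
have d z : (z - a j) ^+ 2 + b j ^+ 2 != 0.
  by rewrite gt_eqF// ltr_wpDl ?sqr_ge0// exprn_gt0.
by rewrite /resRe /resIm; field; rewrite !d.
Qed.

Let quotient_sqr x y : x != y -> ((f x - f y) / (x - y)) ^+ 2 = G x y.
Proof.
move=> xy; have d0 : x - y != 0 by rewrite subr_eq0.
have -> : (f x - f y) / (x - y) = - \sum_(j < N) c j * (P j x * Q j y + Q j x * P j y).
  apply: (mulIf d0); rewrite divfK// /f -sumrB mulNr mulr_suml -sumrN.
  by apply: eq_bigr => j _; rewrite -mulrBr resIm_sub; ring.
rewrite sqrrN expr2 /G mulr_suml; apply: eq_bigr => j _.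
by rewrite mulr_sumr; apply: eq_bigr => l _; ring.
Qed.

Let dPP j l : sqdecay (fun y => P j y * P l y). Proof. exact: sqdecay_ReRe. Qed.
Let dPQ j l : sqdecay (fun y => P j y * Q l y). Proof. exact: sqdecay_ReIm. Qed.
Let dQP j l : sqdecay (fun y => Q j y * P l y). Proof. exact: sqdecay_ImRe. Qed.
Let dQQ j l : sqdecay (fun y => Q j y * Q l y). Proof. exact: sqdecay_ImIm. Qed.

Let term_decay j l (w1 w2 w3 w4 : R) :
  sqdecay (fun y => w1 * (Q j y * Q l y) + (w2 * (Q j y * P l y) +
    (w3 * (P j y * Q l y) + w4 * (P j y * P l y)))).
Proof. by repeat (apply: sqdecayD || apply: sqdecayZ). Qed.

Let term_lint j l (w1 w2 w3 w4 : R) :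
  lint (fun y => w1 * (Q j y * Q l y) + (w2 * (Q j y * P l y) +
    (w3 * (P j y * Q l y) + w4 * (P j y * P l y)))) =
  w1 * M j l + (w2 * L j l + (w3 * - L j l + w4 * M j l)).
Proof.
have [e1 e2 e3 e4] := lint_res_products (a j) (a l) (b0 j) (b0 l).
rewrite /M /L -e1 -e3.
transitivity (w1 * lint (fun y => Q j y * Q l y) + (w2 * lint (fun y => Q j y * P l y) +
    (w3 * lint (fun y => P j y * Q l y) + w4 * lint (fun y => P j y * P l y)))).
  by rewrite !(lintD, lintZ)//; repeat (apply: sqdecayD || apply: sqdecayZ).
by rewrite e1 e2 e3 e4.
Qed.

Let G_decay x : sqdecay (G x).
Proof. by do 2 apply: sqdecay_sum => ?; apply: sqdecayZ; exact: term_decay. Qed.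

Let H x := \sum_(j < N) \sum_(l < N) c j * c l *
  (M j l * (Q j x * Q l x) + ((- L j l) * (Q j x * P l x) +
   (L j l * (P j x * Q l x) + M j l * (P j x * P l x)))).

Let lint_G x : lint (G x) = H x.
Proof.
rewrite /G lint_sum => [|j]; last first.
  by apply: sqdecay_sum => l; apply: sqdecayZ; exact: term_decay.
apply: eq_bigr => j _; rewrite lint_sum => [|l]; last by apply: sqdecayZ; exact: term_decay.
apply: eq_bigr => l _; rewrite lintZ; last exact: term_decay.
by rewrite term_lint; ring.
Qed.

(** The second integration reproduces the constants of the first. The mixed products are paired
    crosswise and their integrals are L and - L, hence the minus sign in front of L^2. *)
Let lint_H : lint H = \sum_(j < N) \sum_(l < N) c j * c l * (2 * (M j l ^+ 2 - L j l ^+ 2)).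
Proof.
rewrite /H lint_sum => [|j]; last first.
  by apply: sqdecay_sum => l; apply: sqdecayZ; exact: term_decay.
apply: eq_bigr => j _; rewrite lint_sum => [|l]; last by apply: sqdecayZ; exact: term_decay.
apply: eq_bigr => l _; rewrite lintZ; last exact: term_decay.
by rewrite term_lint; ring.
Qed.

Let lint_EFin h : sqdecay h -> (\int[mu]_x (h x)%:E)%E = (lint h)%:E.
Proof.
move=> dh; rewrite /lint /Rintegral fineK//.
by apply: integrable_fin_num => //; exact: sqdecay_integrable.
Qed.

(* At [y = x] the quotient is the junk value 0 / 0 = 0, so the two integrands
   agree only off a point. *)
Let inner x : (\int[mu]_y (((f x - f y) / (x - y)) ^+ 2)%:E)%E = (H x)%:E.
Proof.
have mD : measurable ([set: R] `\ x) by apply: measurableD.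
have mG : measurable_fun ([set: R] `\ x) (fun y => (G x y)%:E).
  apply: measurable_funS (measurableT) _ _ => //.
  by apply/measurable_EFinP; apply: continuous_measurable_fun; exact: (G_decay x).1.
have e : {in [set: R] `\ x, (fun y => (G x y)%:E) =1 (fun y => (((f x - f y) / (x - y)) ^+ 2)%:E)}.
  move=> y; rewrite inE => -[_ /eqP yx]; rewrite quotient_sqr//.
  by rewrite eq_sym.
rewrite -(@integral_setD1 R _ x setT)//; last exact: eq_measurable_fun e mG.
transitivity (\int[mu]_(y in [set: R] `\ x) (G x y)%:E)%E; first by apply: eq_integral => y yD; rewrite -e.
rewrite (@integral_setD1 R _ x setT)// lint_EFin//.
by rewrite lint_G.
Qed.

Lemma sigma2_resIm : sigma2 f = \sum_(j < N) \sum_(l < N) c j * c l *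
  (((b j + b l) ^+ 2 - (a j - a l) ^+ 2) / (2 * ((a j - a l) ^+ 2 + (b j + b l) ^+ 2) ^+ 2)).
Proof.
have dH : sqdecay H by do 2 apply: sqdecay_sum => ?; apply: sqdecayZ; exact: term_decay.
rewrite /sigma2.
have -> : (\int[mu]_x \int[mu]_y (((f x - f y) / (x - y)) ^+ 2)%:E)%E = (lint H)%:E.
  by rewrite -lint_EFin//; apply: eq_integral => x _; exact: inner.
rewrite /= lint_H mulr_suml; apply: eq_bigr => j _.
rewrite mulr_suml; apply: eq_bigr => l _; rewrite -[LHS]mulrA; congr (_ * _).
have p0 : pi != 0 :> R by rewrite gt_eqF// pi_gt0.
have D0 : (a j - a l) ^+ 2 + (b j + b l) ^+ 2 != 0.
  by rewrite gt_eqF// ltr_wpDl ?sqr_ge0// exprn_gt0// addr_gt0.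
rewrite /M /L; move: pi p0 => p p0; rewrite -[p ^+ 2 *+ 4]mulr_natr; field.
by rewrite D0 p0.
Qed.

End VarianceFunctional.

(** * The variance in complex form and the limit theorem *)

Section Resolvents.
Variables (R : realType) (N : nat) (eta : 'I_N -> R[i]) (c : 'I_N -> R).
Hypothesis eta0 : forall j, 0 < complex.Im (eta j).

Lemma Im_resolvent j (x : R) : complex.Im (((x%:C)%C - eta j)^-1) =
  resIm (complex.Re (eta j)) (complex.Im (eta j)) x.
Proof.
by rewrite cImV cReD cImD cReN cImN /resIm /= add0r sqrrN mulNr opprK.
Qed.

Lemma sigma2_resolvents :
  sigma2 (fun x : R => \sum_(j < N) c j * complex.Im (((x%:C)%C - eta j)^-1)) =
  \sum_(j < N) \sum_(l < N) c j * c l *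
    (- complex.Re ((eta j - conjc (eta l)) ^- 2) / 2).
Proof.
under [X in sigma2 X]eq_fun do under eq_bigr do rewrite Im_resolvent.
rewrite (sigma2_resIm (fun j => complex.Re (eta j)) c eta0); apply: eq_bigr => j _; apply: eq_bigr => l _.
congr (_ * _).
have : 0 < complex.Im (eta j) + complex.Im (eta l) by rewrite addr_gt0.
rewrite -exprVn expr2 cReM cReV cImV.
move: (eta j) (eta l) => [a b] [a' b'] /= s0.
have D0 : (a - a') ^+ 2 + (b + b') ^+ 2 != 0.
  by rewrite gt_eqF// ltr_wpDl ?sqr_ge0// exprn_gt0.
by rewrite opprK; field.
Qed.

End Resolvents.

Theorem theorem4p7 (R : realType) (x0 alpha : R) (N : nat)
    (eta : 'I_N -> R[i]) (c : 'I_N -> R) :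
  -2 < x0 < 2 -> 0 < alpha < 1 ->
  (forall j, 0 < complex.Im (eta j)) ->
  let f := fun x : R => \sum_(j < N) c j * complex.Im (((x%:C)%C - eta j)^-1) in
  ope_cvg_in_distribution_normal
    (fun n s => lin_stat f alpha x0 n s - ope_E n (lin_stat f alpha x0 n))
    (sigma2 f).
Proof.
move=> x0b alphab eta0 f.
(* At n = 0 the scale is 0 and the point degenerates to the real number x0, so the roots are
   required for n > 0 only. *)
have hu n : exists un : 'I_N -> R[i], forall j, (0 < n)%N ->
    [/\ un j != 0, ComplexField.Normc.normc (un j) < 1 &
      un j + (un j)^-1 = (x0%:C)%C + (((n%:R `^ alpha)^-1)%:C)%C * eta j].
  have [n0|n0] := posnP n; first by exists (fun=> 0) => j; rewrite n0.
  have /choice[un hun] j : exists w : R[i], [/\ w != 0, ComplexField.Normc.normc w < 1 &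
      w + w^-1 = (x0%:C)%C + (((n%:R `^ alpha)^-1)%:C)%C * eta j].
    apply: joukowski_exists; rewrite cImD cImM /= mul0r addr0 add0r.
    by rewrite mulr_gt0// invr_gt0 powR_gt0 ?ltr0n.
  by exists un => j _; exact: hun.
have [u u_root] := choice hu.
(* Stated for [r.+1], so that choice gives a plain function of r; the error used below is
   accordingly [C r.-1 / n%:R]. *)
have /choice[C hC] r := @mesoscopic_approx R x0 alpha N eta c alphab eta0 u u_root r.+1 isT.
rewrite /f (sigma2_resolvents c eta0).
pose g n k := - ((n%:R `^ alpha)^-1 * \sum_(j < N) c j * complex.Im (jcoef (u n j) * u n j ^+ k)).
pose cst n := - ((n%:R `^ alpha)^-1 * \sum_(j < N) c j * complex.Im (jcoef (u n j))).
apply: (@ope_clt_criterion R (fun n x => f (n%:R `^ alpha * (x - x0))) cst g _ _ (fun r n => C r.-1 / n%:R)).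
- move=> n; apply: continuous_cont2.
  rewrite /f; under eq_fun do under eq_bigr do rewrite Im_resolvent.
  apply: continuous_big => [|j _]; first exact: add_continuous.
  move=> x; apply: cvgM; first exact: cvg_cst.
  apply: (continuous_comp (f := fun x => n%:R `^ alpha * (x - x0))); last exact: continuous_resIm.
  by apply: cvgM; [exact: cvg_cst|apply: cvgB; [exact: cvg_id|exact: cvg_cst]].
- by move=> r _; exact: inv_nat_cvg0.
- by move=> [//|r] n x _ x2; exact: hC.
- by move=> r r0; exact: mesoscopic_variance u_root r r0.
Qed.
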